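(* Let $\lambda\in\mathbb{R}$ with $0<|\lambda|<1$, and let $\alpha=p/q\in\mathbb{T}$, with $(p,q)=1$, be the frequency of the almost Mathieu operator $H_{\alpha,\theta}$ with potential $v(x)=2\lambda\cos(2\pi x)$. Let $\{p_n/q_n\}$ be a sequence of rationals that converges to $\alpha$, and represent $\alpha-p_n/q_n$ as $\widetilde p_n/\widetilde q_n$ with $(\widetilde p_n,\widetilde q_n)=1$. Then $$\lim_{p_n/q_n\to\alpha}\mathrm{Cap}\big(S_-(\widetilde p_n/\widetilde q_n)\big)=1\ \ne\ \big(1-|\lambda|^q\big)^{1/q}=\mathrm{Cap}\big(S_-(p/q)\big).$$
   Context: $\mathbb{T}=\mathbb{R}/\mathbb{Z}$. For $\alpha,\theta\in\mathbb{T}$, $H_{\alpha,\theta}$ acts on $\ell^2(\mathbb{Z})$ by $(H_{\alpha,\theta}\psi)_n=\psi_{n-1}+\psi_{n+1}+v(\alpha n+\theta)\psi_n$, with absolutely continuous spectrum $\sigma_{ac}(\alpha,\theta)$. For a rational $r/s$ in lowest terms ($s\ge1$), $S_-(r/s)=\bigcap_{\theta\in\mathbb{T}}\sigma_{ac}(r/s,\theta)$ (at rational frequency the operator is periodic and its spectrum is purely absolutely continuous). Logarithmic capacity: for a Borel probability measure $\mu$ with compact support in $\mathbb{C}$, $I(\mu)=\iint\log\frac1{|z-w|}\,d\mu(w)\,d\mu(z)$, and $\mathrm{Cap}(E)=\sup\exp(-I(\mu))$ over Borel probability measures $\mu$ compactly supported in $E$.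
   Formalization: It is additionally assumed that p_n/q_n differs from α in T for all large n; otherwise (e.g. p_n/q_n = α for all n) the difference is 0/1 and Cap(S_-(0)) = 1-|λ|, so the limit 1 fails. *)

(* Defs.v *)
From HB Require Import structures.
From mathcomp Require Import all_boot all_order all_algebra.
From mathcomp Require Import complex.
From mathcomp Require Import all_classical all_reals all_analysis.

Set Implicit Arguments.
Unset Strict Implicit.
Unset Printing Implicit Defensive.

Import Order.TTheory GRing.Theory Num.Theory.
Import numFieldNormedType.Exports.

Local Open Scope classical_set_scope.
Local Open Scope ring_scope.
Local Open Scope complex_scope.

(* Points of T = R/Z are given by real representatives, so that equality and
   convergence in T are equality and convergence up to integer translations. *)
Definition torus_eq (R : realType) (x y : R) : Prop :=
  exists m : int, x - y = m%:~R.

Definition torus_cvg (R : realType) (u : nat -> R) (x : R) : Prop :=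
  forall e : R, 0 < e ->
    \forall n \near \oo, exists m : int, `|u n - x - m%:~R| < e.

Section L2.
Variable R : realType.

(* Extended-real squared norm of an arbitrary sequence over Z; it is finite
   exactly on l^2(Z). *)
Definition l2sqnorm (psi : int -> R[i]) : \bar R :=
  (\esum_(n in [set: int]) ((Normc.normc (psi n)) ^+ 2)%:E)%E.

Definition l2 : set (int -> R[i]) := [set psi | (l2sqnorm psi < +oo)%E].

Definition l2norm (psi : int -> R[i]) : R := Num.sqrt (fine (l2sqnorm psi)).

(* Two-sided series, summed symmetrically; only used for absolutely
   convergent series, for which the order of summation is immaterial. *)
Definition zseries (f : int -> R) : R :=
  lim ((\sum_(i < N.*2.+1) f (i%:Z - N%:Z)) @[N --> \oo]).

Definition l2inner (phi psi : int -> R[i]) : R[i] :=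
  zseries (fun n => complex.Re ((phi n)^* * psi n)) +i*
  zseries (fun n => complex.Im ((phi n)^* * psi n)).

End L2.

Section Spectrum.
Variable R : realType.
Implicit Type A : (int -> R[i]) -> (int -> R[i]).

(* mu is the spectral measure of psi for the bounded self-adjoint operator A:
   <psi, f(A) psi> = \int f dmu for every polynomial f. As mu has compact
   support, this determines mu. *)
Definition spectral_measure A (psi : int -> R[i])
    (mu : {finite_measure set (measurableTypeR R) -> \bar R}) : Prop :=
  (exists M : R, mu (~` `[- M, M]) = 0%E) /\
  forall k : nat,
    l2inner psi (iter k A psi) = (Rintegral mu setT (fun t : R => t ^+ k))%:C.

Definition ac_subspace A : set (int -> R[i]) :=
  [set psi | l2 psi /\
    exists2 mu : {finite_measure set (measurableTypeR R) -> \bar R},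
      spectral_measure A psi mu & mu `<< (@lebesgue_measure R)].

Definition shift_op A (E : R) : (int -> R[i]) -> (int -> R[i]) :=
  fun psi n => A psi n - E%:C * psi n.

(* E belongs to the resolvent set of the restriction of A to V. *)
Definition resolvent_on A (V : set (int -> R[i])) (E : R) : Prop :=
  set_bij V V (shift_op A E) /\
  exists C : R, forall psi, V psi ->
    l2norm psi <= C * l2norm (shift_op A E psi).

(* The spectrum of the restriction of A to its absolutely continuous subspace;
   A being self-adjoint, only real spectral parameters are considered. *)
Definition ac_spectrum A : set R := [set E | ~ resolvent_on A (ac_subspace A) E].

End Spectrum.

Section Schrodinger.
Variable R : realType.

Definition schrodinger (v : R -> R) (alpha theta : R) (psi : int -> R[i]) :
    int -> R[i] :=
  fun n => psi (n - 1) + psi (n + 1) + (v (alpha * n%:~R + theta))%:C * psi n.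

Definition amo_potential (lambda : R) : R -> R :=
  fun x => 2 * lambda * cos (2 * pi * x).

Definition S_minus (v : R -> R) (alpha : R) : set R :=
  \bigcap_(theta in [set: R]) ac_spectrum (schrodinger v alpha theta).

End Schrodinger.

Section Capacity.
Variable R : realType.

(* The complex plane is identified with R * R; its Borel sets form the product
   sigma-algebra. *)
Local Notation plane := (measurableTypeR R * measurableTypeR R)%type.

Definition plane_dist (z w : R * R) : R :=
  Num.sqrt ((z.1 - w.1) ^+ 2 + (z.2 - w.2) ^+ 2).

(* The kernel is log (1 / |z - w|), equal to +oo on the diagonal since
   lne 0 = -oo. *)
Definition log_energy (mu : probability plane R) : \bar R :=
  (\int[mu]_z \int[mu]_w (- lne (plane_dist z w)%:E))%E.

Definition compactly_supported_in (E : set (R * R)) (mu : probability plane R) :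
    Prop :=
  exists K : set (R * R), [/\ compact K, K `<=` E & mu (~` K) = 0%E].

(* The supremum is taken in [0, +oo], so that the empty set has capacity 0. *)
Definition capacity (E : set (R * R)) : \bar R :=
  maxe 0%E (ereal_sup [set expeR (- log_energy mu)%E |
    mu in [set mu | compactly_supported_in E mu]]).

Definition on_real_line (E : set R) : set (R * R) := [set (x, 0) | x in E].

End Capacity.

(* Main.v *)
(* For q-periodic v the discriminant D satisfies D(A) = S^q + S^-q, S the shift.
   The spectral measure of delta_0 is explicit on the bands |D| < 2 and is
   absolutely continuous, while a Neumann series for D(A) inverts A - E when
   |D(E)| > 2, so the a.c. spectrum is {|D| <= 2} up to endpoints.  By Chambers' formula
   the discriminant of the almost Mathieu operator at frequency p/q is
   D_0 + 2 kappa cos(2 pi q theta) with |kappa| = |lambda|^q: averaging over the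
   rotations by p/q kills all frequencies strictly between 0 and q.  Hence S_-(p/q)
   is {|D_0| <= c}, c = 2 - 2 |lambda|^q, up to endpoints, and the capacity of such a
   preimage is (c/2)^(1/q): from above, points of small discrete energy are compared with
   the Vandermonde determinant of the scaled polynomials T_m(D_0/c); from below, the
   arcsine law is pulled back, its logarithmic potential V being controlled by
   V(x^2 - 2) = 2 V(x).  Finally the denominators of p/q - p_n/q_n tend to infinity. *)
Require Import Defs.
From HB Require Import structures.
From mathcomp Require Import all_boot all_order all_algebra.
From mathcomp Require Import fingroup perm complex polyrcf zify ring lra.
From mathcomp Require Import all_classical all_reals all_analysis measurable_realfun.

Import Order.TTheory GRing.Theory Num.Theory.
Import numFieldNormedType.Exports.

Set Implicit Arguments.
Unset Strict Implicit.
Unset Printing Implicit Defensive.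

Local Open Scope classical_set_scope.
Local Open Scope ring_scope.

(** * Discriminants *)

(** Two difficulties shape the argument. The absolutely continuous subspace is given through moments
    of measures and no functional calculus is used, so its stability under [(A - E)^-1] has to be
    proved: if [mu] belongs to [psi], the candidate for [(A - E)^-1 psi] is [(t - E)^-2 mu], cut off
    to a region [|D| < c] with [2 < c < |D(E)|], and its moments are identified by comparing growth
    along the powers of [D]. In the other direction one vector suffices: polynomials in [A] peaked
    at [E], applied to the point mass, violate any resolvent bound when [|D(E)| < 2]. The endpoints
    of the bands are never decided. The upper capacity estimate uses only the closed condition
    [|D_0| <= c], the lower one works at levels [c' < c], and both give the same number. Since the
    logarithmic kernel is unbounded with both signs, energies are handled after truncating it from
    below and adding a constant, which makes Tonelli available and changes nothing on a bounded
    support. *)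

Section Continuant.
Variable R : realType.
Implicit Types (v : int -> R) (n : int) (k : nat).

(* [pd v n k] is the characteristic polynomial, of degree [k - 1], of the Jacobi
   matrix with diagonal [v (n + 1), ..., v (n + k - 1)]. *)
Fixpoint pd_rec v n k : {poly R} :=
  match k with
  | 0 => 0
  | k1.+1 => match k1 with
             | 0 => 1
             | k2.+1 => ('X - (v (n + k1%:Z))%:P) * pd_rec v n k1 - pd_rec v n k2
             end
  end.

(** Locked so that simplification never unfolds the recursion; it is handled through [pd0], [pd1]
    and [pdSS]. *)
Definition pd v n k : {poly R} := locked (pd_rec v n k).

Lemma pd0 v n : pd v n 0 = 0.
Proof. by rewrite /pd -lock. Qed.

Lemma pd1 v n : pd v n 1 = 1.
Proof. by rewrite /pd -lock. Qed.

Lemma pdSS v n k :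
  pd v n k.+2 = ('X - (v (n + k.+1%:Z))%:P) * pd v n k.+1 - pd v n k.
Proof. by rewrite /pd -!lock. Qed.

(** The determinant expanded along its first row instead of its last one. *)
Lemma pdSSl v n k :
  pd v n k.+2 = ('X - (v (n + 1))%:P) * pd v (n + 1) k.+1 - pd v (n + 2) k.
Proof.
elim/ltn_ind: k => -[|[|k]] IH; first by rewrite pdSS !pd1 !pd0 mulr1.
  rewrite !pdSS !pd0 !pd1 !subr0 !mulr1 mulrC.
  by congr (_ * ('X - (v _)%:P) - 1); rewrite -addrA.
rewrite pdSS (IH k.+1)// (IH k)// (pdSS v (n + 1) k.+1) (pdSS v (n + 2) k).
have -> : n + 1 + k.+2%:Z = n + k.+3%:Z by lia.
have -> : n + 2 + k.+1%:Z = n + k.+3%:Z by lia.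
by ring.
Qed.

Lemma pd_monic_size v n k : pd v n k.+1 \is monic /\ size (pd v n k.+1) = k.+1.
Proof.
elim/ltn_ind: k => -[|k] IH; first by rewrite pd1 monic1 size_polyC oner_neq0.
have [mk sk] := IH k (ltnSn _).
have sk' : (size (pd v n k) <= k)%N.
  by case: k IH {mk sk} => [|k] IH; [rewrite pd0 size_poly0|have [_ ->] := IH k (ltnW (ltnSn _))].
have sM : size (('X - (v (n + k.+1%:Z))%:P) * pd v n k.+1) = k.+2.
  by rewrite size_Mmonic ?polyXsubC_eq0// size_XsubC sk.
have lts : (size (- pd v n k)%R < size (('X - (v (n + k.+1%:Z))%:P) * pd v n k.+1)%R)%N.
  by rewrite size_polyN sM ltnS (leq_trans sk').
rewrite pdSS; split; last by rewrite size_polyDl.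
by rewrite monicE lead_coefDl// lead_coef_monicM// ?monicXsubC// (monicP mk).
Qed.

Lemma pd_monic v n k : pd v n k.+1 \is monic.
Proof. by case: (pd_monic_size v n k). Qed.

Lemma size_pd v n k : size (pd v n k) = k.
Proof. by case: k => [|k]; [rewrite pd0 size_poly0|case: (pd_monic_size v n k)]. Qed.

(** Each one-step transfer matrix has determinant 1; the left-hand side is the determinant of their
    product, hence independent of [k]. *)
Lemma pd_wronskian v n k :
  pd v n k.+1 * pd v (n + 1) k.+1 - pd v n k.+2 * pd v (n + 1) k = 1.
Proof.
elim: k => [|k IH]; first by rewrite pd0 !pd1 mulr0 subr0 mulr1.
rewrite -[RHS]IH (pdSS v n k.+1) (pdSS v (n + 1) k).
have -> : n + 1 + k.+1%:Z = n + k.+2%:Z by lia.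
by ring.
Qed.

Lemma pd_shift v w n m k :
  (forall j, v (n + j%:Z) = w (m + j%:Z)) -> pd v n k = pd w m k.
Proof.
move=> vw; elim/ltn_ind: k => -[|[|k]] IH; rewrite ?pd0 ?pd1//.
by rewrite !pdSS !IH ?vw//; lia.
Qed.

(* The trace of the transfer matrix over the sites [n + 1, ..., n + q]. *)
Definition disc v n (q : nat) : {poly R} := pd v n q.+1 - pd v (n + 1) q.-1.

(** Moving the base point by one site conjugates the monodromy matrix, which leaves its trace
    unchanged. *)
Lemma disc_succ v n q : (0 < q)%N -> (forall m, v (m + q%:Z) = v m) ->
  disc v (n + 1) q = disc v n q.
Proof.
move=> q0 vq; case: q q0 vq => // k _ vq.
change (pd v (n + 1) k.+2 - pd v (n + 1 + 1) k = pd v n k.+2 - pd v (n + 1) k).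
rewrite (pdSSl v n k) pdSS vq.
have -> : n + 1 + 1 = n + 2 by lia.
by ring.
Qed.

Lemma disc_base v n m q : (0 < q)%N -> (forall m, v (m + q%:Z) = v m) ->
  disc v n q = disc v m q.
Proof.
move=> q0 vq; suff H (k : int) : disc v k q = disc v 0 q by rewrite (H n) (H m).
elim/int_rec: k => [//|k IH|k IH]; first by rewrite -IH -addn1 PoszD disc_succ.
rewrite -IH -[LHS](disc_succ _ q0 vq); by rewrite -addn1 PoszD opprD addrNK.
Qed.

Lemma disc_monic_size v n q : (0 < q)%N ->
  disc v n q \is monic /\ size (disc v n q) = q.+1.
Proof.
move=> q0.
have h : (size (- pd v (n + 1) q.-1)%R < size (pd v n q.+1))%N.
  by rewrite size_polyN !size_pd; lia.
rewrite /disc monicE lead_coefDl// size_polyDl// size_pd.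
by rewrite (monicP (pd_monic _ _ _)).
Qed.

End Continuant.

(** * Sturm sequences, interlacing zeros and alternation of the discriminant *)

Section Interlacing.
Variable R : realType.
Implicit Types (P : {poly R}) (z y : nat -> R).

(** The sign is normalised to be positive at the last point, as suits a monic [P] of degree [d].
    Every level [x] with [|x| < c] is then crossed between consecutive points, so that [P - x] has
    [d] distinct real roots. *)
Definition alternating (c : R) P (d : nat) z :=
  (forall i, (i < d)%N -> z i < z i.+1) /\
  (forall i, (i <= d)%N -> c <= (-1) ^+ (d - i) * P.[z i]).

Lemma incr_chain d z : (forall i, (i < d)%N -> z i < z i.+1) ->
  forall i j, (i < j <= d)%N -> z i < z j.
Proof.
move=> zi i j; elim: j => [|j IH]; first by rewrite andbC.
move=> /andP[ij jd]; move: ij; rewrite ltnS leq_eqVlt => /orP[/eqP->|ij].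
  exact: zi.
by apply: (lt_trans (IH _)); [lia|exact: zi].
Qed.

Lemma incr_chainW d z : (forall i, (i < d)%N -> z i < z i.+1) ->
  forall i j, (i <= j <= d)%N -> z i <= z j.
Proof.
move=> zi i j /andP[]; rewrite leq_eqVlt => /orP[/eqP->//|ij jd].
by apply/ltW/(incr_chain zi); rewrite ij.
Qed.

Lemma interlace_uniq d z y : (forall i, (i < d)%N -> z i < z i.+1) ->
  (forall i, (i < d)%N -> z i < y i < z i.+1) ->
  uniq [seq y i | i <- iota 0 d].
Proof.
move=> zi yi; rewrite map_inj_in_uniq ?iota_uniq// => i j.
rewrite !mem_iota !add0n /= => id jd.
have H a b : (a < b)%N -> (b < d)%N -> y a < y b.
  move=> ab bd; have /andP[_ h1] := yi a (ltn_trans ab bd).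
  have /andP[h2 _] := yi b bd.
  apply: (lt_trans h1); apply: le_lt_trans h2.
  by apply: (incr_chainW zi); lia.
case: (ltngtP i j) => // ij e; first by have := H _ _ ij jd; rewrite e ltxx.
by have := H _ _ ij id; rewrite e ltxx.
Qed.

Lemma interlace_prod P d z y : P \is monic -> size P = d.+1 ->
  (forall i, (i < d)%N -> z i < z i.+1) ->
  (forall i, (i < d)%N -> z i < y i < z i.+1) ->
  (forall i, (i < d)%N -> root P (y i)) ->
  P = \prod_(i < d) ('X - (y i)%:P).
Proof.
move=> mP sP zi yi rP.
have := @all_roots_prod_XsubC _ P [seq y i | i <- iota 0 d].
rewrite size_map size_iota uniq_rootsE (interlace_uniq zi yi) (monicP mP) scale1r.
rewrite big_map -[X in iota 0 X]subn0 -/(index_iota 0 d) big_mkord; apply => //.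
by rewrite all_map; apply/allP => i; rewrite mem_index_iota => id; apply: rP.
Qed.

Lemma alternating_ivt P d z : (forall i, (i < d)%N -> z i < z i.+1) ->
  (forall i, (i <= d)%N -> 0 < (-1) ^+ (d - i) * P.[z i]) ->
  forall i, (i < d)%N -> exists2 t, z i < t < z i.+1 & root P t.
Proof.
move=> zi Pz i id.
have [|t tI rt] := @poly_ivtoo R P (z i) (z i.+1) (ltW (zi i id)).
  have h1 := Pz i (ltnW id); have h2 := Pz i.+1 id.
  have := mulr_gt0 h1 h2.
  have -> : (d - i = (d - i.+1).+1)%N by lia.
  rewrite exprS mulN1r mulrACA mulNr -expr2 -exprM mulnC exprM sqrrN expr1n expr1n mulN1r.
  by rewrite oppr_gt0.
by exists t => //; move: tI; rewrite in_itv.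
Qed.

Lemma alternating_roots P d z : P \is monic -> size P = d.+1 ->
  (forall i, (i < d)%N -> z i < z i.+1) ->
  (forall i, (i <= d)%N -> 0 < (-1) ^+ (d - i) * P.[z i]) ->
  exists y, (forall i, (i < d)%N -> z i < y i < z i.+1) /\
    P = \prod_(i < d) ('X - (y i)%:P).
Proof.
move=> mP sP zi Pz.
have H i : exists t, (i < d)%N -> z i < t < z i.+1 /\ root P t.
  have [id|_] := boolP (i < d)%N; last by exists 0.
  by have [t t1 t2] := alternating_ivt zi Pz id; exists t.
have [y yP] := boolp.choice H.
exists y; split; first by move=> i /yP[].
by apply: (interlace_prod mP sP zi) => i /yP[].
Qed.

Lemma monic_large P d (B : R) : P \is monic -> size P = d.+2 ->
  exists M0, forall x, M0 <= x -> B <= P.[x] /\ B <= (-1) ^+ d.+1 * P.[- x].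
Proof.
move=> mP sP.
have aux (Q : {poly R}) : Q \is monic -> size Q = d.+2 ->
    exists M0, forall x, M0 <= x -> B <= Q.[x].
  move=> mQ sQ.
  have h : lead_coef (Q - B%:P) = 1.
    by rewrite lead_coefDl ?(monicP mQ)// size_polyN sQ (leq_ltn_trans (size_polyC_leq1 _)).
  have [|M0 M0P] := @poly_pinfty_gt_lc R (Q - B%:P); first by rewrite h.
  exists M0 => x /M0P; rewrite h !hornerE => Hx.
  lra.
have [M1 M1P] := aux P mP sP.
have sX : size (- 'X : {poly R}) = 2 by rewrite size_polyN size_polyX.
have [||M2 M2P] := aux ((-1) ^+ d.+1 *: (P \Po (- 'X))).
- rewrite monicE lead_coefZ lead_coef_comp ?sX// (monicP mP) lead_coefN lead_coefX sP /=.
  by rewrite mul1r -expr2 -exprM mulnC exprM sqrrN expr1n expr1n.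
- by rewrite size_scale ?signr_eq0// size_comp_poly2.
exists (Num.max M1 M2) => x; rewrite ge_max => /andP[/M1P h1 /M2P h2]; split => //.
by move: h2; rewrite hornerZ horner_comp hornerN hornerX.
Qed.

Lemma sign_prod k i y (t : R) : (i <= k)%N ->
  (forall l, (l < i)%N -> y l < t) ->
  (forall l, (i <= l < k)%N -> t < y l) ->
  0 < (-1) ^+ (k - i) * \prod_(l < k) (t - y l).
Proof.
move=> ik h1 h2; rewrite -(subnKC ik) big_split_ord /= addKn mulrCA.
apply: mulr_gt0.
  by apply: prodr_gt0 => l _; rewrite subr_gt0; apply: h1.
rewrite -[X in _ ^+ X]card_ord -prodr_const -big_split /=.
by apply: prodr_gt0 => l _; rewrite mulN1r opprB subr_gt0; apply: h2; have := ltn_ord l; lia.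
Qed.

Lemma extend_chain k y (M0 : R) : (forall i, (i.+1 < k)%N -> y i < y i.+1) ->
  exists z M, [/\ (forall i, (i < k.+1)%N -> z i < z i.+1),
    forall i, (i < k)%N -> z i.+1 = y i, z 0 = - M, z k.+1 = M & M0 <= M].
Proof.
move=> yi.
pose M := Num.max M0 (1 + \sum_(i < k) `|y i|).
have M1 : 1 + \sum_(i < k) `|y i| <= M by rewrite le_max lexx orbT.
have yM i : (i < k)%N -> - M < y i < M.
  move=> ik; rewrite -ltr_norml; apply: lt_le_trans M1.
  rewrite (bigD1 (Ordinal ik))//= addrCA ltrDl ltr_pwDl// sumr_ge0//.
have M0' : 0 < M by apply: lt_le_trans M1; rewrite ltr_pwDl// sumr_ge0.
exists (fun i => if i is j.+1 then if (j < k)%N then y j else M else - M), M.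
split; rewrite ?ltnn//; last by rewrite le_max lexx.
  move=> [|i] ik.
    by case: ifP => [/yM/andP[]//|_]; rewrite -subr_gt0 opprK addr_gt0.
  have ik' : (i < k)%N by lia.
  by rewrite ik'; case: ifP => [/yi//|_]; have /andP[] := yM i ik'.
by move=> i ->.
Qed.

(** Sign information at [k] inner points is completed by two far points [-M] and [M], where the
    leading term of [P] dominates. [Q] is positivity in [sturm] and [2 <= x] in
    [disc_alternating]. *)
Lemma extend_alternating (Q : R -> Prop) c P k y :
  (forall x, c <= x -> Q x) ->
  P \is monic -> size P = k.+2 ->
  (forall i, (i.+1 < k)%N -> y i < y i.+1) ->
  (forall i, (i < k)%N -> Q ((-1) ^+ (k - i) * P.[y i])) ->
  exists z, [/\ (forall i, (i < k.+1)%N -> z i < z i.+1),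
    forall i, (i < k)%N -> z i.+1 = y i &
    forall i, (i <= k.+1)%N -> Q ((-1) ^+ (k.+1 - i) * P.[z i])].
Proof.
move=> cQ mP sP yi Py; have [M0 M0P] := monic_large c mP sP.
have [z [M [z1 z2 z3 z4 M0M]]] := extend_chain M0 yi.
exists z; split=> // -[|i] ik.
  by rewrite z3; apply: cQ; have [_] := M0P M M0M.
have [->|ik'] : i = k \/ (i < k)%N by lia.
  by rewrite z4 subnn mul1r; apply: cQ; have [] := M0P M M0M.
by rewrite z2// subSS; apply: Py.
Qed.

Lemma interlace_incr d z y : (forall i, (i < d)%N -> z i < y i < z i.+1) ->
  forall i, (i.+1 < d)%N -> y i < y i.+1.
Proof.
move=> zy i id; have /andP[_ h1] := zy i (ltnW id); have /andP[h2 _] := zy _ id.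
exact: lt_trans h1 h2.
Qed.

Lemma interlace_prod_sign P k z y : P = \prod_(i < k) ('X - (z i.+1)%:P) ->
  (forall i, (i < k.+1)%N -> z i < z i.+1) ->
  (forall i, (i < k.+1)%N -> z i < y i < z i.+1) ->
  forall i, (i <= k)%N -> 0 < (-1) ^+ (k - i) * P.[y i].
Proof.
move=> -> zi zy i ik; rewrite horner_prod.
under eq_bigr do rewrite hornerXsubC.
have /andP[y1 y2] : z i < y i < z i.+1 by apply: zy; lia.
apply: (sign_prod (y := fun l => z l.+1)) => // l li.
  by apply: le_lt_trans y1; apply: (incr_chainW zi); lia.
by apply: (lt_le_trans y2); apply: (incr_chainW zi); lia.
Qed.

(** Sturm's argument: at a zero of one continuant the three-term recurrence makes the next one equal
    to minus the previous one, whose sign there is known by interlacing. The outer points [z 0] and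
    [z k.+1] are not zeros but points far out. *)
Lemma sturm (v : int -> R) n k : exists z,
  [/\ (forall i, (i < k.+1)%N -> z i < z i.+1),
    pd v n k.+1 = \prod_(i < k) ('X - (z i.+1)%:P) &
    forall i, (i <= k.+1)%N -> 0 < (-1) ^+ (k.+1 - i) * (pd v n k.+2).[z i]].
Proof.
have lt01P (x : R) : 1 <= x -> 0 < x by apply: lt_le_trans.
elim: k => [|k [z [zi pz Pz]]].
  have [||z [z1 z2 z3]] := @extend_alternating _ _ (pd v n 2) 0 (fun=> 0) lt01P
     (pd_monic _ _ _) (size_pd _ _ _) => //.
  by exists z; split => //; rewrite big_ord0 pd1.
have [y [zy py]] := alternating_roots (pd_monic _ _ _) (size_pd _ _ _) zi Pz.
have ys := interlace_prod_sign pz zi zy.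
have [||z' [z'1 z'2 z'3]] := @extend_alternating _ _ (pd v n k.+3) k.+1 y lt01P
     (pd_monic _ _ _) (size_pd _ _ _).
- exact: interlace_incr zy.
- move=> i ik; have := ys i ik; rewrite pdSS hornerD hornerM hornerN py.
  have /rootP -> : root (\prod_(i < k.+1) ('X - (y i)%:P)) (y i).
    by rewrite (bigD1 (Ordinal ik))//= rootM root_XsubC eqxx.
  by rewrite mulr0 add0r subSn// exprS mulN1r mulNr mulrN opprK.
exists z'; split => //; rewrite py; apply: eq_bigr => i _.
by rewrite z'2.
Qed.

Lemma two_le_addV (x : R) : 0 < x -> 2 <= x + x^-1.
Proof.
move=> x0; rewrite -subr_ge0.
have -> : x + x^-1 - 2 = (x - 1) ^+ 2 / x by field; rewrite gt_eqF.
by rewrite divr_ge0 ?sqr_ge0// ltW.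
Qed.

(* At a Dirichlet eigenvalue the monodromy matrix is triangular with
   eigenvalues [m] and [1/m], so that its trace is at least 2 in modulus. *)
Lemma disc_alternating (v : int -> R) n q : (0 < q)%N ->
  exists z, alternating 2 (disc v n q) q z /\
    pd v n q = \prod_(i < q.-1) ('X - (z i.+1)%:P).
Proof.
case: q => // k _; have [z [zi pz Pz]] := sturm v n k.
have [mD sD] := disc_monic_size v n (ltn0Sn k).
have [|||z' [z'1 z'2 z'3]] := @extend_alternating (fun x => 2 <= x) 2 (disc v n k.+1) k
    (fun i => z i.+1) _ mD sD => //.
- by move=> i ik; apply: zi; lia.
- move=> i ik; have /= := Pz i.+1 ltac:(lia); rewrite subSS.
  have := congr1 (fun p => p.[z i.+1]) (pd_wronskian v n k).
  rewrite /disc hornerD [(- _ : {poly R}).[_]]hornerN !(hornerD, hornerN, hornerM) [(1 : {poly R}).[_]]hornerC.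
  have -> : (pd v n k.+1).[z i.+1] = 0.
    apply/rootP; rewrite pz (bigD1 (Ordinal ik))//= rootM root_XsubC eqxx//.
  set a := (pd v n k.+2).[_]; set b := (pd v (n + 1) k).[_] => ab a0.
  rewrite mul0r sub0r in ab.
  have a00 : a != 0 by apply: contraTneq a0 => ->; rewrite mulr0 ltxx.
  have -> : - b = a^-1 by apply: (mulfI a00); rewrite mulrN ab divff.
  have -> : (-1) ^+ (k - i) * (a + a^-1) =
     (-1) ^+ (k - i) * a + ((-1) ^+ (k - i) * a)^-1.
    by rewrite invfM mulrDr -exprVn invrN1.
  exact: two_le_addV.
exists z'; split => //; rewrite /= pz; apply: eq_bigr => i _.
by rewrite z'2.
Qed.

End Interlacing.

Section Lagrange.
Variable R : realType.

(** Both sides are the coefficient of degree [d] of the Lagrange interpolant of [f], which is [f]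
    itself. It serves to sum residues over the [q] roots of [D - x]. *)
Lemma lagrange_sum (d : nat) (t : nat -> R) (f : {poly R}) :
  uniq [seq t i | i <- iota 0 d.+1] -> (size f <= d.+1)%N ->
  \sum_(j < d.+1) f.[t j] / \prod_(i < d.+1 | i != j) (t j - t i) = f`_d.
Proof.
move=> ut sf.
have tij (i j : 'I_d.+1) : i != j -> t j - t i != 0.
  move=> ij; rewrite subr_eq0; apply: contra ij => /eqP e.
  have /uniqP := ut; move=> /(_ 0 i j); rewrite size_map size_iota !inE !ltn_ord.
  by rewrite !(nth_map 0%N) ?size_iota ?ltn_ord// !nth_iota// !add0n => /(_ isT isT (esym e)) /val_inj ->.
pose L (j : 'I_d.+1) := \prod_(i < d.+1 | i != j) ('X - (t i)%:P).
have sL j : size (L j) = d.+1.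
  have -> : L j = \prod_(i <- enum (predC1 j)) ('X - (t i)%:P).
    by rewrite big_enum; apply: eq_bigl => i; rewrite inE.
  by rewrite size_prod_XsubC -cardE cardC1 card_ord.
have LE (x : R) j : (L j).[x] = \prod_(i < d.+1 | i != j) (x - t i).
  by rewrite horner_prod; apply: eq_bigr => i _; rewrite hornerXsubC.
have mL j : L j \is monic by apply: monic_prod_XsubC.
pose g := \sum_(j < d.+1) (f.[t j] / \prod_(i < d.+1 | i != j) (t j - t i)) *: L j.
have sg : (size g <= d.+1)%N.
  apply: (leq_trans (size_sum _ _ _)); apply/bigmax_leqP => j _.
  by rewrite (leq_trans (size_scale_leq _ _))// sL.
have fg : f = g.
  apply/eqP; rewrite -subr_eq0; apply/negPn/negP => fg0.
  have : all (root (f - g)) [seq t i | i <- iota 0 d.+1].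
    rewrite all_map; apply/allP => i; rewrite mem_iota add0n => /andP[_ id] /=.
    rewrite rootE hornerD hornerN subr_eq0 horner_sum.
    rewrite (bigD1 (Ordinal id))//= [X in _ + X]big1 ?addr0 => [|j ji].
      rewrite hornerZ LE divfK//; apply/prodf_neq0 => j ji; exact: (tij _ (Ordinal id)).
    by rewrite hornerZ LE [X in _ * X](bigD1 (Ordinal id)) 1?eq_sym//= subrr mul0r mulr0.
  move=> /(max_poly_roots fg0) /(_ ut); rewrite size_map size_iota ltnNge => /negP; apply.
  by rewrite (leq_trans (size_polyD _ _))// size_polyN geq_max sf.
rewrite [in RHS]fg coef_sum; apply: eq_bigr => j _.
rewrite coefZ; have := monicP (mL j); rewrite lead_coefE sL /= => ->.
by rewrite mulr1.
Qed.

End Lagrange.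

(** * Square-summable sequences *)

Section WindowSums.
Variable R : realType.
Implicit Types (f g : int -> R) (N : nat).

(** The partial sums whose limit is [zseries]. *)
Definition wsum N f : R := \sum_(i < N.*2.+1) f (i%:Z - N%:Z).

Lemma wsum0 f : wsum 0 f = f 0.
Proof. by rewrite /wsum big_ord_recl big_ord0 addr0. Qed.

Lemma wsumS N f : wsum N.+1 f = f (- N.+1%:Z) + wsum N f + f N.+1%:Z.
Proof.
rewrite /wsum doubleS big_ord_recl big_ord_recr /= addrA; congr (f _ + _ + f _).
- by rewrite sub0r.
- by apply: eq_bigr => i _; congr f; rewrite /bump /=; lia.
- by rewrite /bump /=; lia.
Qed.

Lemma eq_wsum N f g : f =1 g -> wsum N f = wsum N g.
Proof. by move=> fg; apply: eq_bigr => i _; rewrite fg. Qed.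

Lemma wsumD N f g : wsum N (fun n => f n + g n) = wsum N f + wsum N g.
Proof. exact: big_split. Qed.

Lemma wsumZ N (a : R) f : wsum N (fun n => a * f n) = a * wsum N f.
Proof. by rewrite /wsum mulr_sumr. Qed.

Lemma ler_wsum N f g : (forall n, f n <= g n) -> wsum N f <= wsum N g.
Proof. by move=> fg; apply: ler_sum. Qed.

Lemma wsum_ge0 N f : (forall n, 0 <= f n) -> 0 <= wsum N f.
Proof. by move=> fg; apply: sumr_ge0. Qed.

Lemma ler_norm_wsum N f : `|wsum N f| <= wsum N (fun n => `|f n|).
Proof. exact: ler_norm_sum. Qed.

Lemma wsum_homo f : (forall n, 0 <= f n) ->
  {homo (fun N => wsum N f) : m n / (m <= n)%N >-> m <= n}.
Proof.
move=> f0; apply: homo_leq => [//|y x z|N]; first exact: le_trans.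
by rewrite wsumS addrAC lerDr addr_ge0.
Qed.

Lemma wsum_ub_term f N n : (forall n, 0 <= f n) -> (`|n| <= N)%N ->
  f n <= wsum N f.
Proof.
move=> f0; elim: N => [|N IH].
  by rewrite leqn0 absz_eq0 => /eqP ->; rewrite wsum0.
rewrite wsumS; have w0 := wsum_ge0 N f0.
rewrite leq_eqVlt => /orP[/eqP nN|/IH]; last first.
  move=> h; apply: (le_trans h); rewrite addrAC lerDr addr_ge0//.
have [->|->] : n = - N.+1%:Z \/ n = N.+1%:Z by lia.
  by rewrite -addrA lerDl addr_ge0.
by rewrite lerDr addr_ge0.
Qed.

Definition zsummable f := exists B : R, forall N, wsum N (fun n => `|f n|) <= B.

Lemma zsummable_cvg f : zsummable f -> cvgn (fun N => wsum N f).
Proof.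
move=> [B fB].
have c1 : cvgn (fun N => wsum N (fun n => `|f n|)).
  apply: nondecreasing_is_cvgn; first by apply: wsum_homo => n.
  by exists B => _ [N _ <-]; exact: fB.
have c2 : cvgn (fun N => wsum N (fun n => `|f n| + f n)).
  apply: nondecreasing_is_cvgn.
    by apply: wsum_homo => n; rewrite -lerBlDr sub0r ler_normr lexx orbT.
  exists (B + B) => _ [N _ <-]; rewrite wsumD lerD// (le_trans (ler_norm _))//.
  exact: le_trans (ler_norm_wsum _ _) _.
have -> : (fun N => wsum N f) = (fun N => wsum N (fun n => `|f n| + f n)) \-
    (fun N => wsum N (fun n => `|f n|)).
  by apply/funext => N /=; rewrite wsumD addrC addKr.
exact: is_cvgB.
Qed.

Lemma zseries_cvg f : zsummable f -> (fun N => wsum N f) @ \oo --> zseries f.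
Proof. by move=> /zsummable_cvg. Qed.

Lemma zsummable_ge0 f B : (forall n, 0 <= f n) -> (forall N, wsum N f <= B) ->
  zsummable f.
Proof.
move=> f0 fB; exists B => N; rewrite (@eq_wsum _ _ f)// => n.
by rewrite ger0_norm.
Qed.

Lemma zsummableW f g : (forall n, `|f n| <= g n) -> zsummable g -> zsummable f.
Proof.
move=> fg [B gB]; exists B => N; apply: le_trans (gB N).
by apply: ler_wsum => n; apply: (le_trans (fg n)); rewrite ler_norm.
Qed.

Lemma zsummableD f g : zsummable f -> zsummable g ->
  zsummable (fun n => f n + g n).
Proof.
move=> [B fB] [C gC]; exists (B + C) => N.
apply: le_trans (lerD (fB N) (gC N)); rewrite -wsumD.
by apply: ler_wsum => n; exact: ler_normD.
Qed.

Lemma zsummableZ (a : R) f : zsummable f -> zsummable (fun n => a * f n).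
Proof.
move=> [B fB]; exists (`|a| * B) => N.
rewrite (@eq_wsum _ _ (fun n => `|a| * `|f n|)) => [|n]; last by rewrite normrM.
by rewrite wsumZ ler_wpM2l.
Qed.

Lemma zseriesD f g : zsummable f -> zsummable g ->
  zseries (fun n => f n + g n) = zseries f + zseries g.
Proof.
move=> sf sg; apply: cvg_lim => //.
under eq_fun do rewrite -/(wsum _ (fun n => f n + g n)) wsumD.
by apply: cvgD; exact: zseries_cvg.
Qed.

Lemma zseriesZ (a : R) f : zsummable f -> zseries (fun n => a * f n) = a * zseries f.
Proof.
move=> sf; apply: cvg_lim => //.
under eq_fun do rewrite -/(wsum _ (fun n => a * f n)) wsumZ.
by apply: cvgMr; exact: zseries_cvg.
Qed.

Lemma zseries_ub f B : zsummable f -> (forall N, wsum N f <= B) -> zseries f <= B.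
Proof.
move=> sf fB; rewrite /zseries; apply: limr_le.
  exact: zsummable_cvg.
by apply: nearW.
Qed.

Lemma wsum_le_zseries f N : zsummable f -> (forall n, 0 <= f n) ->
  wsum N f <= zseries f.
Proof.
move=> sf f0; rewrite /zseries; apply: limr_ge.
  exact: zsummable_cvg.
by exists N => // n /= Nn; exact: wsum_homo.
Qed.

Lemma zseries_ge0 f : zsummable f -> (forall n, 0 <= f n) -> 0 <= zseries f.
Proof.
by move=> sf f0; apply: le_trans (wsum_le_zseries 0 sf f0); exact: wsum_ge0.
Qed.

Lemma ler_zseries f g : zsummable f -> zsummable g -> (forall n, f n <= g n) ->
  zseries f <= zseries g.
Proof.
move=> sf sg fg; apply: ler_lim; try exact: zsummable_cvg.
by apply: nearW => N; apply: ler_wsum.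
Qed.

Lemma ler_norm_zseries f g : zsummable g -> (forall n, `|f n| <= g n) ->
  `|zseries f| <= zseries g.
Proof.
move=> sg fg; have sf := zsummableW fg sg.
rewrite ler_norml; apply/andP; split; last first.
  by apply: ler_zseries => // n; apply: le_trans (fg n); exact: ler_norm.
rewrite -[leLHS]mulN1r -zseriesZ//; apply: ler_zseries => //; first exact: zsummableZ.
move=> n; rewrite mulN1r lerNl; apply: le_trans (fg n).
by rewrite ler_normr lexx orbT.
Qed.

Lemma wsum_shift1 N f : wsum N (fun n => f (n + 1)) = wsum N f + f N.+1%:Z - f (- N%:Z).
Proof.
rewrite /wsum big_ord_recr big_ord_recl /= sub0r.
have -> : N.*2%:Z - N%:Z + 1 = N.+1%:Z by lia.
rewrite (eq_bigr (fun i : 'I_N.*2 => f (Posz (bump 0 i) - N%:Z))) => [|i _]; last first.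
  by congr f; rewrite /bump /=; lia.
by ring.
Qed.

Lemma zsummable_shift1 f : zsummable f <-> zsummable (fun n => f (n + 1)).
Proof.
split=> -[B fB].
  exists (B + B) => N; rewrite (wsum_shift1 N (fun n => `|f n|)).
  rewrite -addrA lerD//; apply: le_trans (fB N.+1).
  apply: le_trans (@wsum_ub_term (fun n => `|f n|) N.+1 N.+1%:Z _ _) => //.
  by rewrite gerBl.
exists (B + B) => N.
have := wsum_shift1 N (fun n => `|f n|); move/eqP; rewrite eq_sym subr_eq => /eqP h.
apply: (@le_trans _ _ (wsum N (fun n => `|f n|) + `|f N.+1%:Z|)); first by rewrite lerDl.
rewrite h lerD//; apply: le_trans (fB N.+1).
apply: le_trans (@wsum_ub_term (fun n => `|f (n + 1)|) N.+1 (- N.+1%:Z) _ _) => //.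
by have -> : - N.+1%:Z + 1 = - N%:Z by lia.
Qed.

Lemma zsummable_cvg0 f : zsummable f ->
  (f (- N%:Z) @[N --> \oo] --> (0 : R)) /\ (f N.+1%:Z @[N --> \oo] --> (0 : R)).
Proof.
move=> [B fB].
have c : cvgn (fun N => wsum N (fun n => `|f n|)).
  apply: nondecreasing_is_cvgn; first by apply: wsum_homo => n.
  by exists B => _ [N _ <-]; exact: fB.
have h : (wsum N.+1 (fun n => `|f n|) - wsum N (fun n => `|f n|)) @[N --> \oo] --> (0 : R).
  rewrite -(subrr (lim (wsum N (fun n => `|f n|) @[N --> \oo]))).
  apply: cvgB => //.
  by have := c; rewrite -(cvg_shiftS (fun N => wsum N (fun n => `|f n|))).
have e N : wsum N.+1 (fun n => `|f n|) - wsum N (fun n => `|f n|) =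
    `|f (- N.+1%:Z)| + `|f N.+1%:Z|.
  by rewrite wsumS addrAC addrK.
split.
  rewrite -(cvg_shiftS (fun N => f (- N%:Z))) /=; apply/cvgr0Pnorm_lt => e0 e00.
  move/cvgr0Pnorm_lt: h => /(_ e0 e00); apply: filterS => N; rewrite e => h'.
  by apply: le_lt_trans h'; rewrite [leRHS]ger0_norm ?addr_ge0// lerDl.
apply/cvgr0Pnorm_lt => e0 e00.
move/cvgr0Pnorm_lt: h => /(_ e0 e00); apply: filterS => N; rewrite e => h'.
by apply: le_lt_trans h'; rewrite [leRHS]ger0_norm ?addr_ge0// lerDr.
Qed.

Lemma zseries_shift1 f : zsummable f -> zseries (fun n => f (n + 1)) = zseries f.
Proof.
move=> sf; apply: cvg_lim => //.
under eq_fun do rewrite -/(wsum _ (fun n => f (n + 1))) wsum_shift1.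
have [h1 h2] := zsummable_cvg0 sf.
rewrite -[zseries f]subr0 -[zseries f]addr0; apply: cvgB => //.
by apply: cvgD => //; exact: zseries_cvg.
Qed.

Lemma zseries_shift f k : zsummable f ->
  zsummable (fun n => f (n + k)) /\ zseries (fun n => f (n + k)) = zseries f.
Proof.
move=> sf; elim/int_rec: k => [|k [IH1 IH2]|k [IH1 IH2]].
- by have -> : (fun n => f (n + 0)) = f by apply/funext => n; rewrite addr0.
- have -> : (fun n => f (n + k.+1%:Z)) = (fun n => (fun m => f (m + k%:Z)) (n + 1)).
    by apply/funext => n; congr f; lia.
  by split; [apply/(zsummable_shift1 (fun m => f (m + k%:Z)))|
    rewrite (zseries_shift1 (f := fun m => f (m + k%:Z)))].
- have E : (fun n => f (n + - k%:Z)) = (fun n => (fun m => f (m + - k.+1%:Z)) (n + 1)).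
    by apply/funext => n; congr f; lia.
  have s : zsummable (fun m => f (m + - k.+1%:Z)) by apply/zsummable_shift1; rewrite -E.
  by split => //; rewrite -IH2 E (zseries_shift1 (f := fun m => f (m + - k.+1%:Z))).
Qed.

End WindowSums.

Section RealL2.
Variable R : realType.
Implicit Types (x y z : int -> R) (n : int) (N : nat).

(** The potential is real, so the operator acts separately on real and imaginary parts and the whole
    analysis can be done on real sequences. *)
Definition rl2 x := exists B : R, forall N, wsum N (fun n => x n ^+ 2) <= B.

Definition rip x y : R := zseries (fun n => x n * y n).

Lemma rl2_sq x : rl2 x -> zsummable (fun n => x n * x n).
Proof.
move=> [B xB]; apply: (@zsummable_ge0 _ _ B) => [n|N]; first by rewrite -expr2 sqr_ge0.
exact: xB.
Qed.

Lemma rip_summable x y : rl2 x -> rl2 y -> zsummable (fun n => x n * y n).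
Proof.
move=> /rl2_sq sx /rl2_sq sy; apply: zsummableW (zsummableD sx sy) => n.
rewrite normrM -[x n * x n]expr2 -[y n * y n]expr2 -(real_normK (num_real (x n))).
rewrite -(real_normK (num_real (y n))).
set a := `|x n|; set b := `|y n|; have a0 : 0 <= a := normr_ge0 _.
have b0 : 0 <= b := normr_ge0 _.
have := sqr_ge0 (a - b); nra.
Qed.

Lemma rip_ge0 x : rl2 x -> 0 <= rip x x.
Proof. by move=> /rl2_sq sx; apply: zseries_ge0 => // n; rewrite -expr2 sqr_ge0. Qed.

Lemma ripC x y : rip x y = rip y x.
Proof. by rewrite /rip; congr zseries; apply/funext => n; rewrite mulrC. Qed.

Lemma rl2_dom x y z (a b : R) : rl2 y -> rl2 z ->
  (forall n, x n ^+ 2 <= a * y n ^+ 2 + b * z n ^+ 2) ->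
  rl2 x /\ rip x x <= a * rip y y + b * rip z z.
Proof.
move=> ly lz xyz; have [sy sz] := (rl2_sq ly, rl2_sq lz).
have s2 := zsummableD (zsummableZ a sy) (zsummableZ b sz).
have lx : rl2 x.
  have [B sB] := s2; exists B => N; apply: le_trans (sB N).
  apply: ler_wsum => n; apply: le_trans (ler_norm _).
  by rewrite -[y n * y n]expr2 -[z n * z n]expr2.
split=> //; rewrite /rip -!zseriesZ// -zseriesD//; try exact: zsummableZ.
apply: ler_zseries => [||n]; [exact: rl2_sq|exact: s2|by rewrite -!expr2].
Qed.

Lemma rl2D x y : rl2 x -> rl2 y -> rl2 (fun n => x n + y n).
Proof.
move=> lx ly; have [] // := @rl2_dom (fun n => x n + y n) x y 2 2 lx ly.
by move=> n; have := sqr_ge0 (x n - y n); nra.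
Qed.

Lemma rl2Z (a : R) x : rl2 x -> rl2 (fun n => a * x n).
Proof.
move=> lx; have [] // := @rl2_dom (fun n => a * x n) x x (a ^+ 2) 0 lx lx.
by move=> n; rewrite exprMn mul0r addr0.
Qed.

Lemma rl20 : rl2 (fun=> 0 : R).
Proof. by exists 0 => N; rewrite /wsum big1// => i _; rewrite expr0n. Qed.

Lemma ripDr x y z : rl2 x -> rl2 y -> rl2 z ->
  rip x (fun n => y n + z n) = rip x y + rip x z.
Proof.
move=> lx ly lz; rewrite /rip -zseriesD; [|exact: rip_summable..].
by congr zseries; apply/funext => n; rewrite mulrDr.
Qed.

Lemma ripZr (a : R) x y : rl2 x -> rl2 y ->
  rip x (fun n => a * y n) = a * rip x y.
Proof.
move=> lx ly; rewrite /rip -zseriesZ; last exact: rip_summable.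
by congr zseries; apply/funext => n; rewrite mulrCA.
Qed.

Lemma rip0r x : rip x (fun=> 0) = 0.
Proof.
rewrite /rip; apply: cvg_lim => //; apply: cvg_near_cst; apply: nearW => N.
by rewrite big1// => i _; rewrite mulr0.
Qed.

Lemma rl2_shift k x : rl2 x -> rl2 (fun n => x (n + k)).
Proof.
move=> /rl2_sq /(zseries_shift k) [s _].
have [B sB] := s; exists B => N; apply: le_trans (sB N).
by apply: ler_wsum => n; rewrite expr2 ler_norm.
Qed.

Lemma rip_shift k x y : rl2 x -> rl2 y ->
  rip (fun n => x (n + k)) (fun n => y (n + k)) = rip x y.
Proof.
move=> lx ly; rewrite /rip.
by have [_] := zseries_shift k (rip_summable lx ly).
Qed.

(** A weighted form of the Cauchy-Schwarz inequality that avoids square roots; the weight [e] is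
    adapted to each use. *)
Lemma rip_bound (e : R) x y : 0 < e -> rl2 x -> rl2 y ->
  `|rip x y| <= e * rip x x + e^-1 * rip y y.
Proof.
move=> e0 lx ly; have [sx sy] := (rl2_sq lx, rl2_sq ly).
rewrite /rip -!zseriesZ// -zseriesD; try exact: zsummableZ.
apply: ler_norm_zseries => [|n]; first by apply: zsummableD; exact: zsummableZ.
rewrite normrM -[x n * x n]expr2 -[y n * y n]expr2 -(real_normK (num_real (x n))).
rewrite -(real_normK (num_real (y n))).
set a := `|x n|; set b := `|y n|; have a0 : 0 <= a := normr_ge0 _.
have b0 : 0 <= b := normr_ge0 _; rewrite -subr_ge0.
have -> : e * a ^+ 2 + e^-1 * b ^+ 2 - a * b =
    e^-1 * ((e * a - b) ^+ 2 + e * (a * b)) by field; rewrite gt_eqF.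
by rewrite mulr_ge0 ?invr_ge0 ?addr_ge0 ?sqr_ge0 ?mulr_ge0 ?(ltW e0).
Qed.

Lemma rl2_fatou (u : nat -> int -> R) x (B : R) :
  (forall n, u m n @[m --> \oo] --> x n) ->
  (forall m, rl2 (u m) /\ rip (u m) (u m) <= B) -> rl2 x /\ rip x x <= B.
Proof.
move=> ux uB.
have H N : wsum N (fun n => x n ^+ 2) <= B.
  have c : (fun m => wsum N (fun n => u m n ^+ 2)) @ \oo --> wsum N (fun n => x n ^+ 2).
    rewrite /wsum; apply: cvg_big => [|i _]; first exact: add_continuous.
    under eq_fun do rewrite expr2.
    by rewrite expr2; apply: cvgM; exact: ux.
  rewrite -(cvg_lim _ c)//; apply: limr_le; first by apply/cvg_ex; eexists; exact: c.
  apply: nearW => m; have [lm rm] := uB m; apply: le_trans rm.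
  rewrite (@eq_wsum _ N _ (fun n => u m n * u m n)) => [|n]; last by rewrite expr2.
  apply: wsum_le_zseries; first exact: rl2_sq.
  by move=> n; rewrite -expr2 sqr_ge0.
have lx : rl2 x by exists B.
split => //; rewrite /rip; apply: zseries_ub; first exact: rl2_sq.
by move=> N; apply: le_trans (H N); apply: ler_wsum => n; rewrite expr2.
Qed.

(** The Neumann series of [1 - r S^k], [S] the shift. Its partial sums [u m] converge at each site,
    and a uniform bound on their norms passes to the limit by [rl2_fatou]. *)
Lemma neumann_shift (r : R) k x : `|r| < 1 -> rl2 x ->
  exists y, rl2 y /\ forall n, y n - r * y (n + k) = x n.
Proof.
move=> r1 lx.
pose u := fix u m := if m is m'.+1 then (fun n => x n + r * u m' (n + k))
  else (fun _ : int => (0 : R)).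
have xb n : `|x n| <= 1 + rip x x.
  have : x n * x n <= rip x x.
    apply: le_trans (wsum_le_zseries `|n|%N (rl2_sq lx) _) => [|m]; last by rewrite -expr2 sqr_ge0.
    by apply: (@wsum_ub_term _ (fun n => x n * x n)) => // m; rewrite -expr2 sqr_ge0.
  rewrite -expr2 -(real_normK (num_real (x n))).
  set a := `|x n| => h; have := sqr_ge0 (a - 1); have := normr_ge0 (x n); rewrite -/a; nra.
have uE m n : u m n = \sum_(i < m) r ^+ i * x (n + i%:Z * k).
  elim: m n => [|m IH] n; first by rewrite big_ord0.
  rewrite big_ord_recl /= mul1r mul0r addr0 IH mulr_sumr; congr (_ + _).
  apply: eq_bigr => i _; rewrite mulrA exprS; congr (_ * x _).
  by rewrite /bump /= add1n intS mulrDl mul1r addrA.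
have cu n : cvgn (u^~ n).
  have -> : u^~ n = series (fun i : nat => r ^+ i * x (n + i%:Z * k)).
    by apply/funext => m; rewrite uE /series /= big_mkord.
  apply: normed_cvg.
  apply: (@series_le_cvg _ _ (fun i => (1 + rip x x) * `|r| ^+ i)) => [i|i|i|].
  - exact: normr_ge0.
  - by rewrite mulr_ge0 ?exprn_ge0// addr_ge0 ?rip_ge0.
  - by rewrite /= normrM normrX mulrC ler_wpM2r ?exprn_ge0.
  - by apply: is_cvg_geometric_series; rewrite normr_id.
pose y n := lim (u m n @[m --> \oo]).
(* With this [h] one has [(1 + h) r^2 <= 1 - h], so the recursion for [u] bounds the next squared
   norm by [(1 + h^-1) rip x x + (1 - h) B] if the current one is at most [B]; [C] is the fixed
   point of that map. *)
pose h := (1 - r ^+ 2) / 2.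
have r2 : r ^+ 2 < 1 by rewrite -(real_normK (num_real r)) expr_lt1.
have h0 : 0 < h by rewrite divr_gt0// subr_gt0.
pose C := rip x x * ((1 + h^-1) / h) .
have rho : (1 + h) * r ^+ 2 <= 1 - h.
  rewrite /h; have := sqr_ge0 r; nra.
have uB m : rl2 (u m) /\ rip (u m) (u m) <= C.
  elim: m => [|m [lm rm]].
    have -> : u 0%N = fun=> 0 by [].
    split; first exact: rl20.
    by rewrite rip0r /C mulr_ge0 ?rip_ge0// divr_ge0 ?(ltW h0)// addr_ge0// invr_ge0 ltW.
  have [] := @rl2_dom (u m.+1) x (fun n => u m (n + k)) (1 + h^-1) ((1 + h) * r ^+ 2) lx (rl2_shift k lm).
    move=> n /=; rewrite -subr_ge0; set a := x n; set b := u m _.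
    have -> : (1 + h^-1) * a ^+ 2 + (1 + h) * r ^+ 2 * b ^+ 2 - (a + r * b) ^+ 2
      = h^-1 * (a - h * (r * b)) ^+ 2 by field; rewrite gt_eqF.
    by rewrite mulr_ge0 ?sqr_ge0 ?invr_ge0 ?ltW.
  move=> l1; rewrite (rip_shift k lm lm) => h1; split => //; apply: (le_trans h1).
  apply: (@le_trans _ _ ((1 + h^-1) * rip x x + (1 - h) * C)).
    rewrite lerD2l; apply: (@le_trans _ _ ((1 - h) * rip (u m) (u m))).
      by rewrite ler_wpM2r ?rip_ge0.
    by rewrite ler_wpM2l// /h; have := sqr_ge0 r; lra.
  rewrite /C le_eqVlt; apply/orP; left; apply/eqP; field; rewrite gt_eqF//.
exists y; split.
  by have [] := @rl2_fatou u y C cu uB.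
move=> n; apply/eqP; rewrite subr_eq; apply/eqP.
have c1 : u m.+1 n @[m --> \oo] --> y n.
  by rewrite (cvg_shiftS (u^~ n)); exact: cu.
apply: (cvg_unique _ c1) => //=.
by apply: cvgD; [exact: cvg_cst|apply: cvgMr; exact: cu].
Qed.

End RealL2.

(** * Polynomials in a Jacobi operator *)

Section Jacobi.
Variable R : realType.
Variable v : int -> R.
Implicit Types (x y : int -> R) (n : int) (p : {poly R}).

Definition jac x : int -> R := fun n => x (n - 1) + x (n + 1) + v n * x n.

Definition opP p x : int -> R := fun n => \sum_(i < size p) p`_i * iter i jac x n.

Lemma opP_le m p x n : (size p <= m)%N ->
  opP p x n = \sum_(i < m) p`_i * iter i jac x n.
Proof.
move=> pm; rewrite /opP (big_ord_widen_cond m predT (fun i => p`_i * iter i jac x n))//.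
rewrite big_mkcond /=; apply: eq_bigr => i _; case: ifPn => //.
by rewrite -leqNgt => pi; rewrite nth_default ?mul0r.
Qed.

Lemma opPD p1 p2 x n : opP (p1 + p2) x n = opP p1 x n + opP p2 x n.
Proof.
pose m := maxn (size p1) (size p2).
rewrite !(@opP_le m) ?leq_maxl ?leq_maxr ?size_polyD// -big_split /=.
by apply: eq_bigr => i _; rewrite coefD mulrDl.
Qed.

Lemma opPZ (a : R) p x n : opP (a *: p) x n = a * opP p x n.
Proof.
rewrite !(@opP_le (size p)) ?size_scale_leq// mulr_sumr.
by apply: eq_bigr => i _; rewrite coefZ mulrA.
Qed.

Lemma opPN p x n : opP (- p) x n = - opP p x n.
Proof. by rewrite -scaleN1r opPZ mulN1r. Qed.

Lemma opPB p1 p2 x n : opP (p1 - p2) x n = opP p1 x n - opP p2 x n.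
Proof. by rewrite opPD opPN. Qed.

Lemma opPC (a : R) x n : opP a%:P x n = a * x n.
Proof. by rewrite (@opP_le 1) ?size_polyC_leq1// big_ord1 coefC. Qed.

Lemma opP1 x n : opP 1 x n = x n.
Proof. by rewrite opPC mul1r. Qed.

Lemma opP0 x n : opP 0 x n = 0.
Proof. by rewrite opPC mul0r. Qed.

Lemma opP_mulX p x n : opP (p * 'X) x n = opP p (jac x) n.
Proof.
rewrite (@opP_le (size p).+1) ?(leq_trans (size_polyMleq _ _))//; last first.
  by rewrite size_polyX addn2.
rewrite big_ord_recl coefMX mul0r add0r; apply: eq_bigr => i _.
by rewrite lift0 coefMX iterSr.
Qed.

Lemma jac_sum (I : Type) (r : seq I) (F : I -> int -> R) n :
  jac (fun m => \sum_(i <- r) F i m) n = \sum_(i <- r) jac (F i) n.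
Proof. by rewrite /jac mulr_sumr -!big_split. Qed.

Lemma jacZ (a : R) x n : jac (fun m => a * x m) n = a * jac x n.
Proof. by rewrite /jac; ring. Qed.

Lemma jac_opP p x : jac (opP p x) = opP p (jac x).
Proof.
apply/funext => n; rewrite /opP jac_sum; apply: eq_bigr => i _.
by rewrite jacZ -iterS iterSr.
Qed.

Lemma opPM p1 p2 x : opP (p1 * p2) x = opP p1 (opP p2 x).
Proof.
apply/funext => n.
elim/poly_ind: p1 x n => [|p1 c IH] x n; first by rewrite mul0r !opP0.
rewrite mulrDl !opPD -mulrA -commr_polyX mulrA opP_mulX IH mul_polyC opPZ opPC.
by rewrite opP_mulX jac_opP.
Qed.

Lemma opPXn k x : opP 'X^k x = iter k jac x.
Proof.
elim: k x => [|k IH] x; first by apply/funext => n; rewrite expr0 opP1.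
by rewrite iterSr -IH; apply/funext => n; rewrite exprSr opP_mulX.
Qed.

Lemma opPX x : opP 'X x = jac x.
Proof. by rewrite -(expr1 'X) opPXn. Qed.

Lemma opPXsubC (a : R) x n : opP ('X - a%:P) x n = jac x n - a * x n.
Proof. by rewrite opPB opPX opPC. Qed.

(** The transfer-matrix recursion with the operator [jac] in the role of the spectral parameter: any
    sequence is a formal eigenfunction in this sense, since polynomials in [jac] commute. *)
Lemma jac_forward x n k :
  x (n + k.+1%:Z) = opP (pd v n k.+1) x (n + 1) - opP (pd v (n + 1) k) x n.
Proof.
elim/ltn_ind: k x => -[|[|k]] IH x.
- by rewrite pd1 pd0 opP1 opP0 subr0.
- rewrite pdSS pd0 subr0 !pd1 mulr1 opP1 opPXsubC /jac -[n + 1 + 1]addrA.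
  have -> : n + 1 - 1 = n by lia.
  have -> : n + (1 + 1) = n + 2 by lia.
  by ring.
- have e1 : x (n + k.+3%:Z) = jac x (n + k.+2%:Z) - v (n + k.+2%:Z) * x (n + k.+2%:Z) - x (n + k.+1%:Z).
    rewrite /jac.
    have -> : n + k.+2%:Z + 1 = n + k.+3%:Z by lia.
    have -> : n + k.+2%:Z - 1 = n + k.+1%:Z by lia.
    by ring.
  have E1 := IH k.+1 (ltnSn _) (jac x); have E2 := IH k.+1 (ltnSn _) x.
  rewrite e1 E1 E2 (IH k (ltnW (ltnSn _)) x).
  rewrite (pdSS v n k.+1) (pdSS v (n + 1) k).
  have -> : n + 1 + k.+1%:Z = n + k.+2%:Z by lia.
  rewrite !opPB !mulrBl ![_%:P * _]mul_polyC !opPB !opPZ -!commr_polyX !opP_mulX.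
  by ring.
Qed.

Lemma jac_backward x n k :
  x (n - k.+1%:Z) = opP (pd v (n - k.+1%:Z) k.+1) x (n - 1) - opP (pd v (n - k.+1%:Z) k) x n.
Proof.
elim/ltn_ind: k x => -[|[|k]] IH x.
- by rewrite pd1 pd0 opP1 opP0 subr0.
- rewrite pdSS pd0 subr0 !pd1 mulr1 opP1 opPXsubC /jac.
  have -> : n - 2 + 1%:Z = n - 1 by lia.
  have -> : n - 1 - 1 = n - 2 by lia.
  have -> : n - 1 + 1 = n by lia.
  by ring.
- set m := n - k.+3%:Z.
  have e1 : x m = jac x (m + 1) - v (m + 1) * x (m + 1) - x (m + 2).
    rewrite /jac; have -> : m + 1 + 1 = m + 2 by lia.
    have -> : m + 1 - 1 = m by lia.
    by ring.
  have m1 : m + 1 = n - k.+2%:Z by lia.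
  have m2 : m + 2 = n - k.+1%:Z by lia.
  have E1 := IH k.+1 (ltnSn _) (jac x); have E2 := IH k.+1 (ltnSn _) x.
  have E3 := IH k (ltnW (ltnSn _)) x.
  rewrite -m1 in E1 E2; rewrite -m2 in E3.
  rewrite e1 E1 E2 E3 (pdSSl v m k.+1) (pdSSl v m k).
  rewrite !opPB !mulrBl ![_%:P * _]mul_polyC !opPB !opPZ -!commr_polyX !opP_mulX.
  by ring.
Qed.

(** The base point of the discriminant is moved to the site [m]; there [jac_forward] and
    [jac_backward], made comparable by periodicity, add up to the trace. This is a pointwise
    identity, valid for arbitrary sequences. *)
Lemma magic_formula q : (0 < q)%N -> (forall m, v (m + q%:Z) = v m) ->
  forall n x m, opP (disc v n q) x m = x (m + q%:Z) + x (m - q%:Z).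
Proof.
move=> q0 vq n x m; rewrite (disc_base n m q0 vq).
case: q q0 vq => // k _ vq.
rewrite jac_forward jac_backward.
have sh a j : pd v (a - k.+1%:Z) j = pd v a j.
  apply: pd_shift => i; rewrite -[LHS]vq; congr v; ring.
rewrite !sh /disc /= pdSS vq !opPB mulrBl mul_polyC opPB opPZ.
rewrite -commr_polyX opP_mulX -jac_opP {1}/jac; ring.
Qed.

Hypothesis v_bdd : exists V : R, forall n, `|v n| <= V.

Lemma rl2_jac x : rl2 x -> rl2 (jac x).
Proof.
move=> lx; apply: rl2D; first by apply: rl2D; exact: rl2_shift.
have [V vV] := v_bdd.
have [] // := @rl2_dom _ (fun n => v n * x n) x x (V ^+ 2) 0 lx lx.
move=> n; rewrite exprMn mul0r addr0 ler_wpM2r ?sqr_ge0//.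
by rewrite -(real_normK (num_real (v n))) lerXn2r ?nnegrE// (le_trans _ (vV n)).
Qed.

Lemma rl2_iter_jac k x : rl2 x -> rl2 (iter k jac x).
Proof. by move=> lx; elim: k => //= k; exact: rl2_jac. Qed.

Lemma rl2_opP p x : rl2 x -> rl2 (opP p x).
Proof.
move=> lx; elim/poly_ind: p x lx => [|p c IH] x lx.
  have -> : opP 0 x = fun=> 0 by apply/funext => n; rewrite opP0.
  exact: rl20.
have -> : opP (p * 'X + c%:P) x = fun n => opP p (jac x) n + c * x n.
  by apply/funext => n; rewrite opPD opP_mulX opPC.
by apply: rl2D; [exact/IH/rl2_jac|exact: rl2Z].
Qed.

Lemma rip_jac x y : rl2 x -> rl2 y -> rip x (jac y) = rip (jac x) y.
Proof.
move=> lx ly; rewrite [RHS]ripC.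
have vl z : rl2 z -> rl2 (fun n => v n * z n).
  move=> lz; have [V vV] := v_bdd.
  have [] // := @rl2_dom _ (fun n => v n * z n) z z (V ^+ 2) 0 lz lz.
  move=> n; rewrite exprMn mul0r addr0 ler_wpM2r ?sqr_ge0//.
  by rewrite -(real_normK (num_real (v n))) lerXn2r ?nnegrE// (le_trans _ (vV n)).
have H a b : rl2 a -> rl2 b -> rip a (jac b) =
    rip a (fun n => b (n - 1)) + rip a (fun n => b (n + 1)) + rip a (fun n => v n * b n).
  move=> la lb; have l1 := rl2_shift (- 1) lb; have l2 := rl2_shift 1 lb.
  by rewrite -(ripDr la l1 l2) -(ripDr la (rl2D l1 l2) (vl _ lb)).
have S (a b : int -> R) : rl2 a -> rl2 b -> rip a (fun n => b (n + 1)) = rip b (fun n => a (n - 1)).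
  move=> la lb; rewrite -(rip_shift 1 lb (rl2_shift (- 1) la)) ripC.
  by congr rip; apply/funext => n; rewrite addrK.
rewrite !H// (S x y)// (S y x)//.
have -> : rip x (fun n => v n * y n) = rip y (fun n => v n * x n).
  by rewrite /rip; congr zseries; apply/funext => n; ring.
by ring.
Qed.

Lemma rip_opP p x y : rl2 x -> rl2 y -> rip x (opP p y) = rip (opP p x) y.
Proof.
move=> lx ly; elim/poly_ind: p x y lx ly => [|p c IH] x y lx ly.
  have h z : opP 0 z = fun=> 0 by apply/funext => n; rewrite opP0.
  by rewrite !h rip0r ripC rip0r.
have h z : opP (p * 'X + c%:P) z = fun n => opP p (jac z) n + c * z n.
  by apply/funext => n; rewrite opPD opP_mulX opPC.
rewrite !h [RHS]ripC !ripDr//; try exact: rl2Z; try exact/rl2_opP/rl2_jac.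
rewrite !ripZr// (ripC y x) (IH x _ lx (rl2_jac ly)); congr (_ + _).
by rewrite -jac_opP (ripC y) rip_jac//; last exact/rl2_opP.
Qed.

Lemma opP_bound p : exists2 C, 0 <= C &
  forall x, rl2 x -> rip (opP p x) (opP p x) <= C * rip x x.
Proof.
have [V vV] := v_bdd.
have V0 : 0 <= V := le_trans (normr_ge0 _) (vV 0).
have jb x : rl2 x -> rip (jac x) (jac x) <= (8 + 2 * V ^+ 2) * rip x x.
  move=> lx; have l1 := rl2_shift (- 1) lx; have l2 := rl2_shift 1 lx.
  have [l3 h3] := @rl2_dom _ (fun n => x (n - 1) + x (n + 1)) _ _ 2 2 l1 l2
    ltac:(by move=> n; have := sqr_ge0 (x (n - 1) - x (n + 1)); nra).
  have [_] := @rl2_dom _ (jac x) _ _ 2 (2 * V ^+ 2) l3 lx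
    ltac:(by move=> n; rewrite /jac; set a := x (n - 1) + _;
      apply: (@le_trans _ _ (2 * a ^+ 2 + 2 * (v n * x n) ^+ 2));
      [have := sqr_ge0 (a - v n * x n); nra|
       rewrite lerD2l -mulrA ler_wpM2l// exprMn ler_wpM2r ?sqr_ge0//
        -(real_normK (num_real (v n))) lerXn2r ?nnegrE]).
  by rewrite !(rip_shift _ lx lx) in h3; move=> h4; apply: (le_trans h4); rewrite mulrDl; lra.
elim/poly_ind: p => [|p c [C C0 pC]].
  exists 0 => // x lx; have -> : opP 0 x = fun=> 0 by apply/funext => n; rewrite opP0.
  by rewrite rip0r mul0r.
exists (2 * (C * (8 + 2 * V ^+ 2)) + 2 * c ^+ 2).
  by have := sqr_ge0 V; have := sqr_ge0 c; nra.
move=> x lx; have lj := rl2_jac lx.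
have [_] := @rl2_dom _ (opP (p * 'X + c%:P) x) _ _ 2 (2 * c ^+ 2) (rl2_opP p lj) lx
  ltac:(by move=> n; rewrite opPD opP_mulX opPC;
    have := sqr_ge0 (opP p (jac x) n - c * x n); nra).
move=> h; apply: (le_trans h); rewrite [leRHS]mulrDl; apply: lerD => //.
rewrite -mulrA ler_wpM2l// -mulrA.
by apply: (le_trans (pC _ lj)); rewrite ler_wpM2l// jb.
Qed.

End Jacobi.

(** * Spectral measures *)

Section ComplexL2.
Variable R : realType.
Implicit Types (psi : int -> R[i]) (v : int -> R).

Definition re_seq psi : int -> R := fun n => complex.Re (psi n).
Definition im_seq psi : int -> R := fun n => complex.Im (psi n).

Lemma normc_sqr (w : R[i]) : Normc.normc w ^+ 2 = complex.Re w ^+ 2 + complex.Im w ^+ 2.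
Proof. by case: w => a b /=; rewrite sqr_sqrtr// addr_ge0 ?sqr_ge0. Qed.

Lemma wsum_esum (f : int -> R) N : (forall n, 0 <= f n) ->
  ((wsum N f)%:E <= \esum_(n in [set: int]) (f n)%:E)%E.
Proof.
move=> f0; apply: esum_ge.
pose s := [seq (i%:Z - N%:Z)%R | i <- iota 0 N.*2.+1].
have us : uniq s.
  by rewrite map_inj_uniq ?iota_uniq// => i j /(congr1 (fun k => k + N%:Z)%R); rewrite !subrK => -[].
exists [set` s]; first by split => //; exact: finite_seq.
rewrite -fsbig_seq// /s big_map sumEFin lee_fin /wsum.
by rewrite -[X in iota 0 X]subn0 -/(index_iota 0 _) big_mkord.
Qed.

Lemma esum_wsum (f : int -> R) (B : R) : (forall n, 0 <= f n) ->
  (forall N, wsum N f <= B) -> (\esum_(n in [set: int]) (f n)%:E <= B%:E)%E.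
Proof.
move=> f0 fB; apply: ge_ereal_sup => _ [A [finA _] <-].
have [s0 As0] := (finite_seqP A).1 finA.
pose s := undup s0.
have As : A = [set` s] by rewrite As0; apply/seteqP; split => n /=; rewrite mem_undup.
have [N NP] : exists N, forall n, n \in s -> (`|n| <= N)%N.
  exists (\max_(n <- s) `|n|%N) => n ns.
  by rewrite (big_rem n)//= leq_maxl.
rewrite As -fsbig_seq ?undup_uniq// sumEFin lee_fin; apply: le_trans (fB N).
pose t := [seq (i%:Z - N%:Z)%R | i <- iota 0 N.*2.+1].
have ut : uniq t.
  by rewrite map_inj_uniq ?iota_uniq// => i j /(congr1 (fun k => k + N%:Z)%R); rewrite !subrK => -[].
have -> : wsum N f = \sum_(n <- t) f n.
  by rewrite big_map /wsum -[X in iota 0 X]subn0 -/(index_iota 0 _) big_mkord.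
have st n : n \in s -> n \in t.
  move=> /NP nN; apply/mapP; exists (absz (n + N%:Z)); first by rewrite mem_iota; lia.
  lia.
have -> : \sum_(n <- s) f n = \sum_(n <- t | n \in s) f n.
  rewrite -[RHS]big_filter; apply: perm_big; apply: uniq_perm.
  - exact: undup_uniq.
  - exact: filter_uniq.
  - by move=> n; rewrite mem_filter; case: (boolP (n \in s)) => //= /st ->.
by rewrite [leRHS](bigID (mem s))/= lerDl sumr_ge0.
Qed.

Lemma l2P psi : l2 psi <-> rl2 (re_seq psi) /\ rl2 (im_seq psi).
Proof.
have f0 n : 0 <= Normc.normc (psi n) ^+ 2 by rewrite sqr_ge0.
split=> [h|[lx ly]].
  have fin : l2sqnorm psi \is a fin_num.
    by rewrite ge0_fin_numE//; apply: esum_ge0 => n _; rewrite lee_fin.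
  have H N : wsum N (fun n => Normc.normc (psi n) ^+ 2) <= fine (l2sqnorm psi).
    by rewrite -lee_fin fineK//; exact: wsum_esum.
  by split; exists (fine (l2sqnorm psi)) => N; apply: le_trans (H N);
    apply: ler_wsum => n; rewrite normc_sqr ?lerDl ?lerDr ?sqr_ge0.
have [[B xB] [C yC]] := (lx, ly).
rewrite /l2 /=; apply: (@le_lt_trans _ _ (B + C)%:E); last exact: ltry.
apply: esum_wsum => // N.
rewrite (@eq_wsum _ _ _ (fun n => re_seq psi n ^+ 2 + im_seq psi n ^+ 2)) => [|n].
  by rewrite wsumD lerD.
by rewrite normc_sqr.
Qed.

Lemma l2normE psi : l2 psi -> l2norm psi =
  Num.sqrt (rip (re_seq psi) (re_seq psi) + rip (im_seq psi) (im_seq psi)).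
Proof.
move=> /l2P[lx ly]; rewrite /l2norm; congr Num.sqrt.
have [sx sy] := (rl2_sq lx, rl2_sq ly).
have E n : Normc.normc (psi n) ^+ 2 =
    re_seq psi n * re_seq psi n + im_seq psi n * im_seq psi n.
  by rewrite normc_sqr !expr2.
have f0 n : 0 <= Normc.normc (psi n) ^+ 2 by rewrite sqr_ge0.
have s2 := zsummableD sx sy.
suff -> : l2sqnorm psi =
    (rip (re_seq psi) (re_seq psi) + rip (im_seq psi) (im_seq psi))%:E by [].
apply/eqP; rewrite eq_le; apply/andP; split.
  apply: esum_wsum => // N; rewrite (eq_wsum N E) /rip -zseriesD//.
  by apply: wsum_le_zseries => // n; rewrite -E.
have fin : l2sqnorm psi \is a fin_num.
  rewrite ge0_fin_numE; last by apply: esum_ge0 => n _; rewrite lee_fin.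
  by apply/l2P.
rewrite -(fineK fin) lee_fin /rip -zseriesD//; apply: zseries_ub => // N.
by rewrite -lee_fin fineK// -(eq_wsum N E); exact: wsum_esum.
Qed.

Variables (V : R -> R) (alpha theta : R).
Let v : int -> R := fun n => V (alpha * n%:~R + theta).
Let A := schrodinger V alpha theta.

Lemma re_schrodinger psi : re_seq (A psi) = jac v (re_seq psi).
Proof.
apply/funext => n; rewrite /re_seq /A /schrodinger /jac -/(v n).
by case: (psi (n - 1)) => a b; case: (psi (n + 1)) => c d; case: (psi n) => e f /=; ring.
Qed.

Lemma im_schrodinger psi : im_seq (A psi) = jac v (im_seq psi).
Proof.
apply/funext => n; rewrite /im_seq /A /schrodinger /jac -/(v n).
by case: (psi (n - 1)) => a b; case: (psi (n + 1)) => c d; case: (psi n) => e f /=; ring.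
Qed.

Lemma re_iter_schrodinger k psi : re_seq (iter k A psi) = iter k (jac v) (re_seq psi).
Proof. by elim: k => //= k <-; rewrite re_schrodinger. Qed.

Lemma im_iter_schrodinger k psi : im_seq (iter k A psi) = iter k (jac v) (im_seq psi).
Proof. by elim: k => //= k <-; rewrite im_schrodinger. Qed.

Lemma re_shift_op E psi : re_seq (shift_op A E psi) = opP v ('X - E%:P) (re_seq psi).
Proof.
apply/funext => n; rewrite opPXsubC -re_schrodinger /re_seq /shift_op.
by case: (A psi n) => a b; case: (psi n) => c d /=; ring.
Qed.

Lemma im_shift_op E psi : im_seq (shift_op A E psi) = opP v ('X - E%:P) (im_seq psi).
Proof.
apply/funext => n; rewrite opPXsubC -im_schrodinger /im_seq /shift_op.
by case: (A psi n) => a b; case: (psi n) => c d /=; ring.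
Qed.

Lemma complex_seqE psi : psi = fun n => (re_seq psi n +i* im_seq psi n)%C.
Proof. by apply/funext => n; rewrite /re_seq /im_seq; case: (psi n). Qed.

Hypothesis v_bdd : exists B : R, forall n, `|v n| <= B.

(** The number [<psi, p(A) psi>] for [psi = x + i y]; the cross terms cancel because [p(A)] is
    symmetric with real coefficients. *)
Definition rspec x y (p : {poly R}) : R := rip x (opP v p x) + rip y (opP v p y).

Lemma spectral_measureP psi (mu : {finite_measure set (measurableTypeR R) -> \bar R}) :
  l2 psi -> spectral_measure A psi mu <->
  (exists M : R, mu (~` `[- M, M]) = 0%E) /\
  forall k, rspec (re_seq psi) (im_seq psi) 'X^k =
    Rintegral mu setT (fun t : R => t ^+ k).
Proof.
move=> /l2P[lx ly].
suff E k : l2inner psi (iter k A psi) =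
    (rspec (re_seq psi) (im_seq psi) 'X^k)%:C%C.
  split=> -[H1 H2]; split => // k; have := H2 k; rewrite E; first by case.
  by move=> <-.
have lkx := rl2_iter_jac v_bdd k lx; have lky := rl2_iter_jac v_bdd k ly.
rewrite /l2inner /rspec !opPXn; congr (_ +i* _)%C.
  rewrite /rip -zseriesD; [|exact: rip_summable..].
  congr zseries; apply/funext => n.
  rewrite -re_iter_schrodinger -im_iter_schrodinger /re_seq /im_seq.
  by case: (psi n) => a b; case: (iter k A psi n) => c d /=; ring.
have <- : rip (re_seq psi) (iter k (jac v) (im_seq psi)) -
   rip (im_seq psi) (iter k (jac v) (re_seq psi)) = 0.
  by rewrite -!opPXn rip_opP// ripC subrr.
rewrite /rip -[X in _ = _ + X]mulN1r -zseriesZ; last exact: rip_summable.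
rewrite -zseriesD; [|exact: rip_summable|exact/zsummableZ/rip_summable].
congr zseries; apply/funext => n.
rewrite -re_iter_schrodinger -im_iter_schrodinger /re_seq /im_seq.
by case: (psi n) => a b; case: (iter k A psi n) => c d /=; ring.
Qed.

End ComplexL2.

(** * Finite measures given by a density *)

Section DensityMeasure.
Context d (T : measurableType d) (R : realType).
Variable mu : {sigma_finite_measure set T -> \bar R}.
Variable f : T -> R.
Hypotheses (f0 : forall x, 0 <= f x) (intf : mu.-integrable setT (EFin \o f)).

Let mf := measurable_int mu intf.

(** The anonymous arguments record the hypotheses, so that a measure structure can be attached to
    [density_fun f0 intf]. *)
Definition density_fun (_ : forall x, 0 <= f x) (_ : mu.-integrable setT (EFin \o f)) :
  set T -> \bar R := fun U => (\int[mu]_(x in U) (f x)%:E)%E.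

Local Notation nu := (density_fun f0 intf).

Let nu0 : nu set0 = 0%E.
Proof. by rewrite /density_fun integral_set0. Qed.

Let nu_ge0 U : (0 <= nu U)%E.
Proof. by apply: integral_ge0 => x _; rewrite lee_fin. Qed.

Let nu_sigma : semi_sigma_additive nu.
Proof.
move=> F mF tF mUF; rewrite /density_fun; apply: cvg_toP.
  apply: ereal_nondecreasing_is_cvgn => m n mn.
  apply: lee_sum_nneg_natr => // k _ _.
  by apply: integral_ge0 => /= x _; rewrite lee_fin.
rewrite ge0_integral_bigcup//=; first by apply: measurable_funS mf.
by move=> x _; rewrite lee_fin.
Qed.

HB.instance Definition _ := isMeasure.Build _ _ _ nu nu0 nu_ge0 nu_sigma.

Let nu_fin : fin_num_fun nu.
Proof.
move=> U mU; rewrite ge0_fin_numE//; case/integrableP : intf => _; apply: le_lt_trans.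
rewrite -(setTI U); apply: (@le_trans _ _ (\int[mu]_(x in setT) (f x)%:E)%E).
  rewrite setTI; apply: ge0_subset_integral => //.
  by move=> x _; rewrite lee_fin.
rewrite le_eqVlt; apply/orP; left; apply/eqP; apply: eq_integral => x _.
by rewrite gee0_abs ?lee_fin.
Qed.

HB.instance Definition _ := Measure_isFinite.Build _ _ _ nu nu_fin.

(** The integration formula is the Radon-Nikodym change of variables: [nu] is dominated by [mu], and
    its derivative agrees almost everywhere with [f] because both have the same integrals over
    measurable sets. *)
Lemma density_measure : exists nu : {finite_measure set T -> \bar R},
  (forall U, measurable U -> nu U = (\int[mu]_(x in U) (f x)%:E)%E) /\
  forall g, nu.-integrable setT g ->
    (\int[nu]_x g x = \int[mu]_x (g x * (f x)%:E))%E.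
Proof.
exists nu; split => // g intg.
have dom : nu `<< mu.
  apply/null_content_dominatesP => U mU U0; rewrite /= /density_fun.
  by apply: null_set_integral => //; apply: measurable_funS mf.
rewrite -(Radon_Nikodym_change_of_variables dom)//.
apply: ae_eq_integral => //.
- apply: emeasurable_funM; first exact: measurable_int _ intg.
  apply: (measurable_int mu); exact: Radon_Nikodym_integrable.
- by apply: emeasurable_funM => //; first exact: measurable_int _ intg.
apply: ae_eqe_mul2l.
apply: integral_ae_eq => //; first exact: Radon_Nikodym_integrable.
by move=> E _ mE; rewrite -Radon_Nikodym_integral.
Qed.

End DensityMeasure.

(** * The spectral measure of a point mass *)

Section Bands.
Variable R : realType.
Implicit Types (F : nat -> R) (x y : R).

Lemma sign_prodF k i F : (i <= k)%N -> (forall l, (l < i)%N -> 0 < F l) ->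
  (forall l, (i <= l < k)%N -> F l < 0) -> 0 < (-1) ^+ (k - i) * \prod_(l < k) F l.
Proof.
move=> ik h1 h2.
have -> : \prod_(l < k) F l = \prod_(l < k) (0 - (fun l => - F l) l).
  by apply: eq_bigr => l _; rewrite sub0r opprK.
apply: (sign_prod (y := fun l => - F l)) => // l; first by move=> /h1; rewrite oppr_lt0.
by move=> /h2; rewrite oppr_gt0.
Qed.

Lemma sign_prodD1 k (j : 'I_k.+1) F : (forall l, (l < j)%N -> 0 < F l) ->
  (forall l, (j < l < k.+1)%N -> F l < 0) ->
  0 < (-1) ^+ (k - j) * \prod_(l < k.+1 | l != j) F l.
Proof.
move=> h1 h2.
(* The missing factor is replaced by [-1], which turns the statement into one about a full product
   at the cost of one sign. *)
pose G l := if l == j :> nat then - 1 else F l.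
have jk : (j <= k)%N by have := ltn_ord j; lia.
have : 0 < (-1) ^+ (k.+1 - j) * \prod_(l < k.+1) G l.
  apply: sign_prodF => [|l lj|l lj]; first exact: leqW.
    by rewrite /G ifF ?h1//; apply/eqP; lia.
  by rewrite /G; case: eqP => e; [lra|apply: h2; lia].
rewrite (bigD1 j)//= {1}/G eqxx subSn// exprS.
rewrite !mulN1r mulrNN (eq_bigr (fun l : 'I_k.+1 => F l)) => [//|l lj].
by rewrite /G; case: eqP => // e; move: lj; rewrite -(inj_eq val_inj) /= e eqxx.
Qed.

Variables (D : {poly R}) (q : nat) (z : nat -> R).
Hypotheses (mD : D \is monic) (sD : size D = q.+1) (Dz : alternating 2 D q z).

(** [t j] is the inverse branch of [D] on its band number [j], constrained only on the open interval
    of values where all the roots of [D - x] are known to be separated by the points [z]. *)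
Definition band_roots (t : nat -> R -> R) := forall x, `|x| < 2 ->
  (forall j, (j < q)%N -> z j < t j x < z j.+1) /\
  D - x%:P = \prod_(j < q) ('X - (t j x)%:P).

Lemma band_rootsP : exists t, band_roots t.
Proof.
have H x : exists y : nat -> R, `|x| < 2 -> (forall j, (j < q)%N -> z j < y j < z j.+1) /\
    D - x%:P = \prod_(j < q) ('X - (y j)%:P).
  have [x2|_] := boolP (`|x| < 2); last by exists (fun=> 0).
  have q0 : (0 < q)%N.
    rewrite lt0n; apply/eqP => q0; have [_ /(_ 0%N isT)] := Dz.
    have DE : D = (D`_0)%:P by apply: size1_polyC; rewrite sD q0.
    have := monicP mD; rewrite q0 DE lead_coefC hornerC subnn mul1r => -> h; lra.
  have [y yP] : exists y : nat -> R, (forall i, (i < q)%N -> z i < y i < z i.+1) /\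
    D - x%:P = \prod_(i < q) ('X - (y i)%:P); last by exists y.
  apply: alternating_roots.
  - by rewrite monicE lead_coefDl ?(monicP mD)// size_polyN sD (leq_ltn_trans (size_polyC_leq1 _)).
  - by rewrite size_polyDl// size_polyN sD (leq_ltn_trans (size_polyC_leq1 _)).
  - by have [] := Dz.
  - move=> i iq; have [_ /(_ i iq)] := Dz; rewrite !hornerE mulrBr subr_gt0; apply: lt_le_trans.
    apply: le_lt_trans x2; have <- : `|(-1) ^+ (q - i) * x| = `|x| by rewrite normrM normrX normrN1 expr1n mul1r.
    exact: ler_norm.
have [y yP] := boolp.choice H.
by exists (fun j x => y x j) => x /yP.
Qed.

Variable t : nat -> R -> R.
Hypothesis tP : band_roots t.

Lemma band_horner x y : `|x| < 2 -> D.[y] - x = \prod_(j < q) (y - t j x).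
Proof.
move=> /tP[_] /(congr1 (horner^~ y)); rewrite !hornerE => ->.
by rewrite horner_prod; apply: eq_bigr => j _; rewrite hornerXsubC.
Qed.

Let zi : forall i, (i < q)%N -> z i < z i.+1.
Proof. by case: Dz. Qed.

Lemma band_incr x i j : `|x| < 2 -> (i < j < q)%N -> t i x < t j x.
Proof.
move=> /tP[tx _] /andP[ij jq].
have /andP[_ h1] := tx i (ltn_trans ij jq); have /andP[h2 _] := tx j jq.
by apply: (lt_trans h1); apply: le_lt_trans h2; apply: (incr_chainW zi); lia.
Qed.

Lemma band_sign j x y : `|x| < 2 -> (j < q)%N -> z j <= y <= z j.+1 ->
  (t j x < y -> 0 < (-1) ^+ (q - j.+1) * (D.[y] - x)) /\
  (y < t j x -> 0 < (-1) ^+ (q - j) * (D.[y] - x)).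
Proof.
move=> x2 jq /andP[y1 y2]; rewrite band_horner//; have [tx _] := tP x2.
have lo l : (l < j)%N -> t l x < y.
  move=> lj; have /andP[_ h] := tx l (ltn_trans lj jq).
  by apply: (lt_le_trans h); apply: le_trans y1; apply: (incr_chainW zi); lia.
have hi l : (j < l < q)%N -> y < t l x.
  move=> /andP[jl lq]; have /andP[h _] := tx l lq.
  by apply: le_lt_trans h; apply: (le_trans y2); apply: (incr_chainW zi); lia.
split=> ty.
  apply: (sign_prod (y := fun l => t l x)) => // l.
  by rewrite ltnS leq_eqVlt => /orP[/eqP->//|]; exact: lo.
apply: (sign_prod (y := fun l => t l x)) => // [|l]; first exact: ltnW.
by move=> /andP[]; rewrite leq_eqVlt => /orP[/eqP<-//|jl lq]; apply: hi; rewrite jl.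
Qed.

Lemma band_root j x : `|x| < 2 -> (j < q)%N -> D.[t j x] = x.
Proof.
move=> x2 jq; apply/eqP; rewrite -subr_eq0 band_horner//.
by rewrite (bigD1 (Ordinal jq))//= subrr mul0r.
Qed.

Lemma band_cover y : `|D.[y]| < 2 -> exists2 j, (j < q)%N & y = t j D.[y].
Proof.
move=> y2; have /esym/eqP := band_horner y y2; rewrite subrr prodf_seq_eq0.
by move=> /hasP[j _ /=]; rewrite subr_eq0 => /eqP; exists j.
Qed.

(** The root is enclosed between [y1] and [y2], within [e] of it and inside the band. At these
    points [D - x] has strict opposite signs, which persist for nearby [x'] and enclose [t j x'] as
    well. *)
Lemma band_continuous j x : `|x| < 2 -> (j < q)%N -> {for x, continuous (t j)}.
Proof.
move=> x2 jq; apply/cvgrPdist_lt => e e0.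
have [tx _] := tP x2; have /andP[t1 t2] := tx j jq.
pose y1 := Num.max ((z j + t j x) / 2) (t j x - e / 2).
pose y2 := Num.min ((z j.+1 + t j x) / 2) (t j x + e / 2).
have [y1z y1t y1e] : [/\ z j < y1, y1 < t j x & t j x - e < y1].
  by rewrite /y1 !lt_max gt_max; split; apply/orP || apply/andP; (try by split; lra);
     (try by left; lra); right; lra.
have [y2z y2t y2e] : [/\ y2 < z j.+1, t j x < y2 & y2 < t j x + e].
  by rewrite /y2 !gt_min lt_min; split; apply/orP || apply/andP; (try by split; lra);
     (try by left; lra); right; lra.
have I1 : z j <= y1 <= z j.+1 by apply/andP; split; apply/ltW => //; exact: lt_trans t2.
have I2 : z j <= y2 <= z j.+1 by apply/andP; split; apply/ltW => //; exact: lt_trans t1 _.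
have a1 := (band_sign x2 jq I1).2 y1t.
have a2 := (band_sign x2 jq I2).1 y2t.
set b1 := _ * _ in a1; set b2 := _ * _ in a2.
have x20 : 0 < 2 - `|x| by lra.
near=> x'.
have x'1 : `|x - x'| < b1 by near: x'; exact: cvgr_dist_lt.
have x'2 : `|x - x'| < b2 by near: x'; exact: cvgr_dist_lt.
have x'3 : `|x'| < 2.
  have : `|x - x'| < 2 - `|x| by near: x'; exact: cvgr_dist_lt.
  by rewrite ltrBrDl; apply: le_lt_trans; rewrite -[in leLHS](subKr x x') ler_normB.
have sgn k : `|(-1) ^+ k * (x - x')| = `|x - x'| by rewrite normrM normrX normrN1 expr1n mul1r.
have c1 : 0 < (-1) ^+ (q - j) * (D.[y1] - x').
  have -> : D.[y1] - x' = (D.[y1] - x) + (x - x') by rewrite addrA subrK.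
  rewrite mulrDr -/b1; move: x'1; rewrite -(sgn (q - j)%N) ltr_norml => /andP[h _]; lra.
have c2 : 0 < (-1) ^+ (q - j.+1) * (D.[y2] - x').
  have -> : D.[y2] - x' = (D.[y2] - x) + (x - x') by rewrite addrA subrK.
  rewrite mulrDr -/b2; move: x'2; rewrite -(sgn (q - j.+1)%N) ltr_norml => /andP[h _]; lra.
have qj : (q - j = (q - j.+1).+1)%N by rewrite subnSK.
have d1 : y1 < t j x'.
  have [h _] := band_sign x'3 jq I1.
  case: (ltrgtP y1 (t j x')) => // [/h|e1].
    by move: c1; rewrite qj exprS mulN1r mulNr oppr_gt0 => h1 h2; have := lt_trans h1 h2; rewrite ltxx.
  by move: c1; rewrite e1 band_root// subrr mulr0 ltxx.
have d2 : t j x' < y2.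
  have [_ h] := band_sign x'3 jq I2.
  case: (ltrgtP (t j x') y2) => // [/h|e1].
    by rewrite qj exprS mulN1r mulNr oppr_gt0 => h1; have := lt_trans h1 c2; rewrite ltxx.
  by move: c2; rewrite -e1 band_root// subrr mulr0 ltxx.
by rewrite ltr_norml; apply/andP; split; lra.
Unshelve. all: by end_near.
Qed.

End Bands.

(** * The uniform law on the unit interval *)

Section UnitInterval.
Variable R : realType.

Definition unitP : probability (measurableTypeR R) R := uniform_prob (@ltr01 R).

Lemma unitPE (U : set R) : measurable U ->
  unitP U = lebesgue_measure (U `&` `]0, 1[).
Proof.
move=> mU; rewrite /unitP /= /uniform_prob integral_uniform_pdf.
rewrite (eq_integral (cst 1%E)) => [|x]; last first.
  by rewrite inE /= => -[_]; rewrite in_itv/= /uniform_pdf => ->; rewrite subr0 invr1.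
rewrite integral_cst ?mul1e//=; last exact: measurableI.
apply/eqP; rewrite eq_le; apply/andP; split; last first.
  apply: le_measure; rewrite ?inE//; [exact: measurableI|exact: measurableI|].
  by apply: setIS; exact: subset_itv_oo_cc.
have -> : `[(0:R), 1]%classic = `]0, 1[%classic `|` [set 0; 1].
  apply/seteqP; split => x /=; rewrite !in_itv /=.
    rewrite le_eqVlt => /andP[/orP[/eqP <-|->]]; first by move=> _; right; left.
    by rewrite le_eqVlt => /orP[/eqP->|->]; [right; right|left].
  by case=> [/andP[/ltW -> /ltW ->//]|[->|->]]; rewrite lexx ler01.
rewrite setIUr; apply: le_trans (measureU2 _ _ _) _ => //.
- exact: measurableI.
- by apply: measurableI => //; exact: measurableU.
rewrite -[leRHS]adde0 leeD2l//.
apply: (@le_trans _ _ (lebesgue_measure [set (0:R); 1])).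
  by apply: le_measure; rewrite ?inE//; [apply: measurableI => //|]; exact: measurableU.
apply: le_trans (measureU2 _ _ _) _ => //.
by rewrite le_eqVlt; apply/orP; left; apply/eqP; rewrite -[RHS]adde0; congr (_ + _)%E;
  exact: lebesgue_measure_set1.
Qed.

Lemma unitP_itv01 : unitP (~` `]0, 1[) = 0%E.
Proof. by rewrite unitPE ?setICl ?measure0//; exact: measurableC. Qed.

(** At [s = 0] and [s = 1] the value [2 cos (pi s)] is a band edge, where the inverse branches are
    unspecified. Replacing them by 0 outside the open interval gives measurable and bounded
    functions, and the set changed is null for [unitP]. *)
Definition patch01 (f : R -> R) (s : R) := if (0 < s) && (s < 1) then f s else 0.

Lemma patch01E f s : 0 < s < 1 -> patch01 f s = f s.
Proof. by rewrite /patch01 => ->. Qed.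

Lemma measurable_patch01 (f : R -> R) : (forall s : R, 0 < s < 1 -> {for s, continuous f}) ->
  measurable_fun setT (patch01 f).
Proof.
move=> cf; have -> : patch01 f = f \_ `]0, 1[.
  by apply/funext => s; rewrite /patch01 patchE mem_setE in_itv.
apply: (measurable_restrictT f (measurable_itv _)).1.
apply: open_continuous_measurable_fun => //.
by move=> s; rewrite inE/= in_itv/= => s01; exact: cf.
Qed.

Lemma bounded_integrable d (T : measurableType d) (mu : {finite_measure set T -> \bar R})
  (f : T -> R) (B : R) :
  measurable_fun setT f -> (forall s, `|f s| <= B) -> mu.-integrable setT (EFin \o f).
Proof.
move=> mf fB; apply: measurable_bounded_integrable => //.
  by have := @fin_num_measure _ _ _ mu _ measurableT; rewrite ge0_fin_numE.
exists B; split; first exact: num_real.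
by move=> M BM s _ /=; apply: le_trans (fB s) (ltW BM).
Qed.

Lemma integral_unitP (f : R -> R) (B : R) : measurable_fun setT f ->
  (forall s, `|f s| <= B) ->
  (\int[unitP]_s (f s)%:E = \int[lebesgue_measure]_(s in `[0%R, 1%R]) (f s)%:E)%E.
Proof.
move=> mf fB.
have B0 : 0 <= B := le_trans (normr_ge0 _) (fB 0).
have intB (mu : {finite_measure set (measurableTypeR R) -> \bar R}) :
    mu.-integrable setT (EFin \o f) by exact: (@bounded_integrable _ _ mu f B mf fB).
have := @integral_uniform R 0 1 ltr01 (fun s => (f s + B)%:E)
  ltac:(by apply/measurable_EFinP; apply: measurable_funD)
  ltac:(by move=> s; rewrite lee_fin -lerBlDr sub0r; have := fB s; rewrite ler_norml => /andP[]).
rewrite subr0 invr1 mul1e.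
under eq_integral do rewrite EFinD.
rewrite integralD//; [|exact: (intB unitP)|exact: finite_measure_integrable_cst].
under [X in _ = X]eq_integral do rewrite EFinD.
have i2 : lebesgue_measure.-integrable (`[0%R, 1%R]%classic : set R) (EFin \o f).
  apply: measurable_bounded_integrable => //.
  - by rewrite /= lebesgue_measure_itv /= lte01 oppr0 adde0 ltry.
  - exact: measurable_funTS.
  - exists B; split; first exact: num_real.
    by move=> M BM s _ /=; apply: le_trans (fB s) (ltW BM).
have i3 : lebesgue_measure.-integrable (`[0%R, 1%R]%classic : set R) (cst B%:E).
  apply: (@measurable_bounded_integrable _ _ _ _ (cst B)) => //.
  - by rewrite /= lebesgue_measure_itv /= lte01 oppr0 adde0 ltry.
  - exists B; split; first exact: num_real.
    by move=> M BM s _ /=; rewrite ger0_norm// ltW.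
rewrite [in RHS]integralD//.
rewrite !integral_cst// /= lebesgue_measure_itv /= lte01 oppr0 adde0 mule1.
rewrite [X in (_ + _ * X)%E](_ : _ = 1%E) ?mule1; last exact: probability_setT.
by move/(congr1 (fun x => (x - B%:E)%E)); rewrite !addeK.
Qed.

Lemma integral_cos_pi (m : int) :
  (\int[unitP]_s (cos (m%:~R * (pi * s)))%:E = ((m == 0)%:R : R)%:E)%E.
Proof.
have cc : continuous (fun s : R => cos (m%:~R * (pi * s))).
  move=> s; apply: (@continuous_comp _ _ _ (fun s => m%:~R * (pi * s)) cos).
    by apply: continuousM; [exact: cst_continuous|apply: continuousM; [exact: cst_continuous|exact: cvg_id]].
  exact: continuous_cos.
rewrite (@integral_unitP _ 1); last 2 first.
- exact: continuous_measurable_fun.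
- by move=> s; exact: cos_max.
have [->|m0] := eqVneq m 0.
  under eq_integral do rewrite mul0r cos0.
  by rewrite integral_cst//= lebesgue_measure_itv /= lte01 oppr0 adde0 mule1.
have mp0 : m%:~R * pi != 0 :> R by rewrite mulf_neq0 ?intr_eq0// gt_eqF// pi_gt0.
pose G s : R := (m%:~R * pi)^-1 * sin (m%:~R * pi * s).
have dG (s : R) : is_derive s (1 : R) G (cos (m%:~R * (pi * s))).
  rewrite /G; apply: is_derive_eq.
  by rewrite /GRing.scale /= mulr1 mulrCA mulVf// mulr1 mulrA.
rewrite (@continuous_FTC2 R (fun s : R => cos (m%:~R * (pi * s))) G 0 1 ltr01); last 3 first.
- exact: continuous_subspaceT.
- split => [s _||]; [exact: ex_derive| |].
  + by apply: cvg_at_right_filter; apply: differentiable_continuous; exact/derivable1_diffP/ex_derive.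
  + by apply: cvg_at_left_filter; apply: differentiable_continuous; exact/derivable1_diffP/ex_derive.
- by move=> s _; rewrite derive1E derive_val.
rewrite -EFinD /G mulr0 sin0 mulr0 mulr1 subr0.
suff -> : sin (m%:~R * pi) = 0 :> R by rewrite mulr0.
have H (k : nat) : sin (k%:R * pi) = 0 :> R.
  elim: k => [|k IH]; first by rewrite mul0r sin0.
  by rewrite -addn1 natrD mulrDl mul1r sinDpi IH oppr0.
case: m {m0 mp0 G dG cc} => k; first exact: H.
by rewrite NegzE mulrNz mulNr sinN H oppr0.
Qed.

End UnitInterval.

(** * Sums of image measures *)

Section Mixture.
Context d1 d2 (S : measurableType d1) (T : measurableType d2) (R : realType).
Variables (N : nat) (m : nat -> {finite_measure set S -> \bar R}) (phi : nat -> S -> T).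
Hypothesis mphi : forall j, measurable_fun setT (phi j).

Let push j : {measure set T -> \bar R} :=
  @measure_function_pushforward__canonical__measure_function_Measure _ _ _ _ R (m j) (phi j) (mphi j).

Definition mixture_fun (_ : forall j, measurable_fun setT (phi j)) : set T -> \bar R := msum push N.

Local Notation nu := (mixture_fun mphi).

HB.instance Definition _ := Measure.copy nu (msum push N).

Let nu_fin : fin_num_fun nu.
Proof.
move=> B mB; rewrite /nu /mixture_fun /msum; apply/sum_fin_numP => j _ _.
apply: fin_num_measure; rewrite -[X in measurable X]setTI; exact: mphi.
Qed.

HB.instance Definition _ := Measure_isFinite.Build _ _ _ nu nu_fin.

Let ge0_integral_mixture (g : T -> \bar R) : measurable_fun setT g ->
  (forall y, 0 <= g y)%E ->
  (\int[nu]_y g y = \sum_(j < N) \int[m j]_s g (phi j s))%E.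
Proof.
move=> mg g0; rewrite (@ge0_integral_measure_sum _ _ _ push setT)//.
apply: eq_bigr => j _; rewrite ge0_integral_pushforward//.
Qed.

Lemma mixture_measure : exists nu : {finite_measure set T -> \bar R},
  [/\ forall B, nu B = (\sum_(j < N) m j (phi j @^-1` B))%E,
    forall g, measurable_fun setT g -> (forall y, 0 <= g y)%E ->
      (\int[nu]_y g y = \sum_(j < N) \int[m j]_s g (phi j s))%E &
    forall g : T -> R, measurable_fun setT g ->
      (forall j, (j < N)%N -> (m j).-integrable setT (fun s => (g (phi j s))%:E)) ->
      nu.-integrable setT (fun y => (g y)%:E) /\
      (\int[nu]_y (g y)%:E = \sum_(j < N) \int[m j]_s (g (phi j s))%:E)%E].
Proof.
exists nu; split => // g mg ig; have mg' : measurable_fun setT (EFin \o g) by apply/measurable_EFinP.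
have i1 : nu.-integrable setT (fun y => (g y)%:E).
  apply/integrableP; split; first exact: mg'.
  rewrite ge0_integral_mixture//; last exact: measurableT_comp.
  by apply: lte_sum_pinfty => j _; have /integrableP[] := ig j (ltn_ord j).
split => //; rewrite integralE.
rewrite !ge0_integral_mixture//; [|exact: measurable_funeneg|exact: measurable_funepos].
have fn (j : 'I_N) : (\int[m j]_s (fun x => (g x)%:E)^\- (phi j s))%E \is a fin_num.
  apply: (integrable_fin_num measurableT).
  have := integrable_funeneg measurableT (ig j (ltn_ord j)).
  apply: eq_integrable => // s _; rewrite funenegE/= funenegE//.
rewrite -fin_num_sumeN => [|j _]; last exact: fn.
rewrite -big_split /=; apply: eq_bigr => j _.
rewrite [RHS]integralE; congr (_ - _)%E; apply: eq_integral => s _.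
  by rewrite !funeposE.
by rewrite !funenegE.
Qed.

End Mixture.

Section LipschitzNull.
Variable R : realType.
Local Notation mu := (@lebesgue_measure R).

Lemma lebesgue_null_cover (B : set R) (e : R) : 0 < e -> mu B = 0%E ->
  exists a b : nat -> R, B `<=` \bigcup_k `]a k, b k]%classic /\
    (\sum_(k <oo) mu `]a k, b k]%classic <= e%:E)%E.
Proof.
move=> e0 B0; have : (mu B < e%:E)%E by rewrite B0 lte_fin.
move=> /ereal_inf_lt[_ [F [mF BF] <-] Fe].
have H k : exists ab : R * R, F k = `]ab.1, ab.2]%classic.
  by have [ab _ <-] := mF k; exists ab.
have [ab abP] := boolp.choice H.
exists (fun k => (ab k).1), (fun k => (ab k).2); split.
  by move=> x /BF[k _ Fx]; exists k => //; rewrite -abP.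
apply: le_trans (ltW Fe); rewrite le_eqVlt; apply/orP; left; apply/eqP.
apply: eq_eseriesr => k _; rewrite -abP.
exact: measurable_mu_extE.
Qed.

(** If an interval of length [l] contains [f s0], the points of [A] sent into it lie within [C l] of
    [s0]. A cover of [B] of total length [e] thus yields a cover of [A] of total length at most
    [2 C e]. *)
Lemma expanding_null (A B : set R) (f : R -> R) (C : R) : measurable A -> 0 <= C ->
  (forall s s', A s -> A s' -> `|s - s'| <= C * `|f s - f s'|) ->
  (forall s, A s -> B (f s)) -> mu B = 0%E -> mu A = 0%E.
Proof.
move=> mA C0 fC fB B0.
suff H (e : R) : 0 < e -> (mu A <= (2 * C * e)%:E)%E.
  apply/eqP; rewrite eq_le measure_ge0 andbT; apply/lee_addgt0Pr => e e0.
  rewrite add0e; have C1 : 0 < 2 * C + 1 by lra.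
  apply: le_trans (H (e / (2 * C + 1)) _) _; first by rewrite divr_gt0.
  by rewrite lee_fin mulrA ler_pdivrMr//; nra.
move=> e0; have [a [b [Bab abe]]] := lebesgue_null_cover e0 B0.
have K k : exists J : set R, [/\ measurable J, A `&` f @^-1` `]a k, b k] `<=` J &
    (mu J <= (2 * C)%:E * mu `]a k, b k]%classic)%E].
  have [[s0 [As0 fs0]]|ne] := pselect (A `&` f @^-1` `]a k, b k] !=set0); last first.
    exists set0; split => //; first by move=> s ?; exfalso; apply: ne; exists s.
    by rewrite measure0 mule_ge0 ?measure_ge0// lee_fin mulr_ge0.
  move: (fs0); rewrite /= in_itv /= => /andP[f1 f2].
  have ab : a k < b k := lt_le_trans f1 f2.
  exists `[s0 - C * (b k - a k), s0 + C * (b k - a k)]%classic; split => //.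
    move=> s [As]; rewrite /= !in_itv /= => /andP[h1 h2].
    have := fC _ _ As As0 => h; rewrite -ler_distl (le_trans h)// ler_wpM2l//.
    by rewrite ler_norml; apply/andP; split; lra.
  rewrite !lebesgue_measure_itv /= !lte_fin ab; case: ifPn => _.
    by rewrite -!EFinD -EFinM lee_fin; lra.
  by rewrite -EFinD -EFinM lee_fin mulr_ge0 ?mulr_ge0// subr_ge0 ltW.
have [J JP] := boolp.choice K.
have mJ k : measurable (J k) by have [] := JP k.
apply: (@le_trans _ _ (\sum_(k <oo) mu (J k))%E).
  apply: measure_sigma_subadditive => // s As.
  have [k _ hk] := Bab _ (fB _ As); exists k => //.
  by have [_ h _] := JP k; apply: h.
apply: (@le_trans _ _ (\sum_(k <oo) (2 * C)%:E * mu `]a k, b k]%classic)%E).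
  by apply: lee_nneseries => // k _; have [_ _ h] := JP k.
by rewrite nneseriesZl// [leRHS]EFinM lee_wpmul2l// lee_fin mulr_ge0.
Qed.

End LipschitzNull.

(** * Green function and spectral measure of the point mass at the origin *)

Section Delta0.
Variable R : realType.
Variables (v : int -> R) (q1 : nat).
Local Notation q := q1.+1.
Hypothesis vq : forall m, v (m + q%:Z) = v m.

Let D := disc v 0 q.
Let p := pd v 0 q.

Definition delta0 : int -> R := fun n => (n == 0)%:R.

Lemma periodic_mul m r : v (m * q%:Z + r) = v r.
Proof.
elim/int_rec: m => [|m IH|m IH]; first by rewrite mul0r add0r.
  by rewrite intS mulrDl mul1r addrAC addrC addrA [_ + q%:Z]addrC -IH -[RHS]vq; congr v; ring.
by rewrite -[RHS]IH -[LHS]vq; congr v; rewrite intS; ring.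
Qed.

Lemma periodic_bdd : exists B : R, forall n, `|v n| <= B.
Proof.
exists (\sum_(i < q) `|v i|) => n.
rewrite (divz_eq n q%:Z) periodic_mul.
have r0 : (0 <= n %% q%:Z)%Z by rewrite modz_ge0.
have rq : (n %% q%:Z < q%:Z)%Z by rewrite ltz_pmod.
case: (n %% q%:Z)%Z r0 rq => // r _ rq.
have rq' : (r < q)%N by [].
by rewrite (bigD1 (Ordinal rq'))//= lerDl sumr_ge0.
Qed.

(* The numerators of the Green function [G(0, n)] at a point of the spectrum
   with quasi-momentum [k]: for [0 <= r <= q] the value at [n = m q + r] is a
   combination of the Dirichlet polynomials of the intervals (r, q) and (0, r). *)
Definition green_mr (k t : R) (m : int) (r : nat) : R :=
  cos (m%:~R * k) * (pd v r%:Z (q - r)).[t] + cos ((m + 1)%:~R * k) * (pd v 0 r).[t].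

Definition green (k t : R) (n : int) : R :=
  green_mr k t (n %/ q%:Z)%Z (absz (n %% q%:Z)%Z).

(** The value [r = q] is allowed: as [pd _ _ 0 = 0], the formula at the end of one period agrees
    with the one at the beginning of the next. This lets [green_jac] use neighbours across the
    junction. *)
Lemma greenE k t m r : (r <= q)%N -> green k t (m * q%:Z + r%:Z) = green_mr k t m r.
Proof.
have H r' m' : (r' < q)%N -> green k t (m' * q%:Z + r'%:Z) = green_mr k t m' r'.
  move=> rq; rewrite /green divzMDl// divz_small ?addr0; last by rewrite /= ltz_nat.
  by rewrite modzMDl modz_small//= ltz_nat.
rewrite leq_eqVlt => /orP[/eqP->|]; last exact: H.
have -> : m * q%:Z + q%:Z = (m + 1) * q%:Z + 0%:Z by rewrite mulrDl mul1r addr0.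
by rewrite H// /green_mr subn0 subnn !pd0 horner0 !mulr0 add0r addr0.
Qed.

Lemma cos_sum3 (a k : R) : cos (a - k) + cos (a + k) = (2 * cos k) * cos a.
Proof. by rewrite cosB cosD; ring. Qed.

(** Inside a period this is the recurrence of the continuants. Only at the junction of two periods
    does the relation between [t] and the quasi-momentum [k] enter. *)
Lemma green_jac k t n : D.[t] = 2 * cos k -> jac v (green k t) n = t * green k t n.
Proof.
move=> Dt; have r0 : (0 <= n %% q%:Z)%Z by rewrite modz_ge0.
have rq : (n %% q%:Z < q%:Z)%Z by rewrite ltz_pmod.
have := divz_eq n q%:Z; move: r0 rq; set m := (n %/ q%:Z)%Z.
case: (n %% q%:Z)%Z => // -[|r] _; rewrite ltz_nat => rq ->.
  rewrite /jac periodic_mul.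
  have -> : m * q%:Z + 0%:Z - 1 = (m - 1) * q%:Z + q1%:Z by rewrite intS; ring.
  have -> : m * q%:Z + 0%:Z + 1 = m * q%:Z + 1%:Z by ring.
  rewrite !greenE// /green_mr subn0 subSnn pd0 !pd1 horner0 mulr0 addr0 hornerC.
  rewrite subn1 /= subrK.
  have -> : ((m - 1)%:~R : R) * k = m%:~R * k - k by rewrite rmorphB /= mulrBl mul1r.
  have -> : ((m + 1)%:~R : R) * k = m%:~R * k + k by rewrite rmorphD /= mulrDl mul1r.
  have h := cos_sum3 (m%:~R * k) k; rewrite -Dt in h.
  have {}h : cos (m%:~R * k - k) = D.[t] * cos (m%:~R * k) - cos (m%:~R * k + k).
    by rewrite -h addrK.
  rewrite !mulr1 h /D /disc pdSS add0r /= hornerD hornerD hornerM hornerN hornerN.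
  by rewrite hornerXsubC -[in v q](add0r q%:Z) vq; ring.
rewrite /jac periodic_mul.
have -> : m * q%:Z + r.+1%:Z - 1 = m * q%:Z + r%:Z by rewrite intS; ring.
have -> : m * q%:Z + r.+1%:Z + 1 = m * q%:Z + r.+2%:Z by rewrite [r.+2%:Z]intS; ring.
rewrite !greenE ?(ltnW rq)//; last by rewrite (leq_trans _ rq)// ltnW.
rewrite /green_mr.
have e1 : (pd v 0 r.+2).[t] = (t - v r.+1) * (pd v 0 r.+1).[t] - (pd v 0 r).[t].
  by rewrite pdSS add0r hornerD hornerM hornerN hornerXsubC.
have e2 : (pd v r%:Z (q - r)).[t] =
    (t - v r.+1) * (pd v r.+1%:Z (q - r.+1)).[t] - (pd v r.+2%:Z (q - r.+2)).[t].
  have -> : (q - r = (q - r.+2).+2)%N by lia.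
  have -> : (q - r.+1 = (q - r.+2).+1)%N by lia.
  rewrite pdSSl hornerD hornerM hornerN hornerXsubC.
  have -> : r%:Z + 1 = r.+1%:Z by rewrite addrC.
  by have -> : r%:Z + 2 = r.+2%:Z by rewrite addrC.
by rewrite e1 e2; ring.
Qed.

Variables (z : nat -> R) (t : nat -> R -> R).
Hypotheses (Dz : alternating 2 D q z)
  (pz : p = \prod_(i < q1) ('X - (z i.+1)%:P)) (tP : band_roots D q z t).

Let mD : D \is monic. Proof. by case: (@disc_monic_size _ v 0 q). Qed.
Let sD : size D = q.+1. Proof. by case: (@disc_monic_size _ v 0 q). Qed.

Let xs (s : R) : R := 2 * cos (pi * s).

Lemma cos_pi_lt2 (s : R) : 0 < s < 1 -> `|2 * cos (pi * s)| < 2.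
Proof.
move=> /andP[s0 s1]; rewrite normrM ger0_norm// gtr_pMr// lt_neqAle cos_max andbT.
rewrite norm_cos_eq1 gt_eqF// sin_gt0_pi//.
by rewrite mulr_gt0 ?pi_gt0//= gtr_pMr// pi_gt0.
Qed.

Lemma cos_pi_param (x : R) : `|x| < 2 -> exists2 s, 0 < s < 1 & 2 * cos (pi * s) = x.
Proof.
rewrite ltr_norml => /andP[x1 x2]; have pi0 := pi_gt0 R.
have y1 : -1 < x / 2 by rewrite ltr_pdivlMr// mulN1r.
have y2 : x / 2 < 1 by rewrite ltr_pdivrMr// mul1r.
exists (acos (x / 2) / pi).
  rewrite divr_gt0 ?acos_gt0 ?y2 ?(ltW y1)// ltr_pdivrMr// mul1r.
  by apply: acos_ltpi; rewrite y1 ltW.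
rewrite mulrCA mulfV ?gt_eqF// mulr1 acosK; first by rewrite mulrCA mulfV ?mulr1.
by rewrite in_itv /=; apply/andP; split; apply: ltW.
Qed.

(** The derivative of [D] at the root [t j x], in product form. *)
Definition den (j : 'I_q) (x : R) : R := \prod_(l < q | l != j) (t j x - t l x).

Lemma den_neq0 j x : `|x| < 2 -> den j x != 0.
Proof.
move=> x2; apply/prodf_neq0 => l lj; rewrite subr_eq0; apply: contra lj => /eqP e.
apply/eqP/val_inj => /=; have inc := band_incr mD sD Dz tP x2.
case: (ltngtP l j) => // h; [have := inc l j|have := inc j l]; rewrite h ltn_ord e ltxx => /(_ isT)//.
Qed.

(** The points [z] that separate the bands include the roots of [p], so numerator and denominator
    both have the sign of [(-1)^(q1 - j)]. *)
Lemma weight_gt0 (j : 'I_q) x : `|x| < 2 -> 0 < p.[t j x] / den j x.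
Proof.
move=> x2; have [tx _] := tP x2; have /andP[t1 t2] := tx j (ltn_ord j).
have zi : forall i, (i < q)%N -> z i < z i.+1 by case: Dz.
have jq : (j <= q1)%N by have := ltn_ord j.
have a : 0 < (-1) ^+ (q1 - j) * p.[t j x].
  rewrite pz horner_prod; under eq_bigr do rewrite hornerXsubC.
  apply: (sign_prod (y := fun l => z l.+1)) => // l lj.
    by apply: le_lt_trans t1; apply: (incr_chainW zi); lia.
  by apply: (lt_le_trans t2); apply: (incr_chainW zi); lia.
have b : 0 < (-1) ^+ (q1 - j) * den j x.
  apply: (sign_prodD1 (F := fun l => t j x - t l x)) => l lj.
    rewrite subr_gt0; apply: (band_incr mD sD Dz tP x2); rewrite lj /=; exact: ltn_ord.
  by rewrite subr_lt0; apply: (band_incr mD sD Dz tP x2).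
have -> : p.[t j x] / den j x = ((-1) ^+ (q1 - j) * p.[t j x]) / ((-1) ^+ (q1 - j) * den j x).
  by rewrite invfM mulrACA divff ?mul1r// signr_eq0.
exact: divr_gt0.
Qed.

Lemma lagrange_den (f : {poly R}) x : `|x| < 2 -> (size f <= q)%N ->
  \sum_(j < q) f.[t j x] / den j x = f`_q1.
Proof.
move=> x2 sf; apply: (@lagrange_sum R q1 (fun j => t j x)) => //.
have [tx _] := tP x2; apply: (interlace_uniq _ tx); by case: Dz.
Qed.

Definition qcos (s : R) : int -> R := fun n =>
  if (q%:Z %| n)%Z then cos ((n %/ q%:Z)%Z%:~R * (pi * s)) else 0.

(** For fixed [n] the numerator is a polynomial of degree less than [q] in the root, so Lagrange
    summation keeps only its coefficient of degree [q - 1]; this is nonzero only if the residue of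
    [n] modulo [q] is 0, where it is a cosine. *)
Lemma green_sum0 s n : 0 < s < 1 ->
  \sum_(j < q) green (pi * s) (t j (xs s)) n / den j (xs s) = qcos s n.
Proof.
move=> s01; have x2 := cos_pi_lt2 s01.
have r0 : (0 <= n %% q%:Z)%Z by rewrite modz_ge0.
have rq : (n %% q%:Z < q%:Z)%Z by rewrite ltz_pmod.
rewrite /qcos (sameP dvdz_mod0P eqP).
have := divz_eq n q%:Z; move: r0 rq; set m := (n %/ q%:Z)%Z.
case: (n %% q%:Z)%Z => // r _; rewrite ltz_nat => rq ->.
pose f := cos (m%:~R * (pi * s)) *: pd v r%:Z (q - r) + cos ((m + 1)%:~R * (pi * s)) *: pd v 0 r.
have sf : (size f <= q)%N.
  rewrite (leq_trans (size_polyD _ _))// geq_max.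
  by rewrite !(leq_trans (size_scale_leq _ _)) ?size_pd ?leq_subr// ltnW.
under eq_bigr => j _ do rewrite (greenE _ _ _ (ltnW rq)) /green_mr -!hornerZ -hornerD -/f.
rewrite lagrange_den// /f coefD !coefZ.
rewrite [(pd v 0 r)`_q1]nth_default ?size_pd// mulr0 addr0.
case: r rq {f sf} => [|r] rq.
  have := monicP (pd_monic v 0%:Z q1); rewrite lead_coefE size_pd /= subn0 => ->.
  by rewrite mulr1.
by rewrite nth_default ?mulr0// size_pd; lia.
Qed.

Lemma green_sum s k n : 0 < s < 1 ->
  \sum_(j < q) t j (xs s) ^+ k * (green (pi * s) (t j (xs s)) n / den j (xs s)) =
  iter k (jac v) (qcos s) n.
Proof.
move=> s01; have x2 := cos_pi_lt2 s01; elim: k n => [|k IH] n.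
  by rewrite /= -green_sum0//; apply: eq_bigr => j _; rewrite mul1r.
rewrite iterS /jac -!IH mulr_sumr -!big_split /=; apply: eq_bigr => j _.
have Dt : D.[t j (xs s)] = 2 * cos (pi * s) by rewrite (band_root tP).
rewrite exprSr -[_ * _ * (_ / _)]mulrA [t j (xs s) * (_ / _)]mulrA -(green_jac n Dt) /jac.
by ring.
Qed.

Lemma green_0 s x : green (pi * s) x 0 = p.[x].
Proof.
have := @greenE (pi * s) x 0 0 isT; rewrite mul0r add0r => ->.
by rewrite /green_mr subn0 mul0r cos0 mul1r pd0 horner0 mulr0 addr0.
Qed.

Let P := unitP R.

(** Averaging over [s] kills every nontrivial cosine, which turns [qcos] into the point mass;
    applying [jac] repeatedly is a finite linear operation at each site and commutes with the
    average. *)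
Lemma integral_qcos k n :
  P.-integrable setT (fun s => (iter k (jac v) (qcos s) n)%:E) /\
  (\int[P]_s (iter k (jac v) (qcos s) n)%:E = (iter k (jac v) delta0 n)%:E)%E.
Proof.
pose Q (f : R -> R) a := P.-integrable setT (fun s => (f s)%:E) /\ (\int[P]_s (f s)%:E = a%:E)%E.
have QD f g a b : Q f a -> Q g b -> Q (fun s => f s + g s) (a + b).
  move=> [f1 f2] [g1 g2]; split; first by under eq_fun do rewrite EFinD; exact: integrableD.
  by under eq_integral do rewrite EFinD; rewrite integralD// f2 g2.
have QZ c f a : Q f a -> Q (fun s => c * f s) (c * a).
  move=> [f1 f2]; split; first by under eq_fun do rewrite EFinM; exact: integrableZl.
  by under eq_integral do rewrite EFinM; rewrite integralZl// f2.
change (Q (fun s => iter k (jac v) (qcos s) n) (iter k (jac v) delta0 n)).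
elim: k n => [|k IH] n; last first.
  by rewrite iterS /jac; apply: (QD _ _ _ _ (QD _ _ _ _ (IH _) (IH _))); apply: QZ; exact: IH.
rewrite /Q /= /qcos /delta0; have [qn|qn] := boolP (q%:Z %| n)%Z.
  split.
    apply: (@bounded_integrable _ _ _ P _ 1); last by move=> s; exact: cos_max.
    apply: continuous_measurable_fun => s.
    apply: (@continuous_comp _ _ _ (fun s => _ * (pi * s)) cos); last exact: continuous_cos.
    apply: continuousM; [exact: cst_continuous|apply: continuousM; [exact: cst_continuous|exact: cvg_id]].
  rewrite integral_cos_pi; congr (_%:R%:E).
  move: qn => /divzK {2}<-; by rewrite mulf_eq0 orbF.
split; first exact: integrable0.
rewrite integral0; have -> : (n == 0) = false by apply: contraNF qn => /eqP ->; exact: dvdz0.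
by [].
Qed.

(** For [s] uniform, [2 cos (pi s)] follows the arcsine law on [[-2, 2]]. [T j] carries it to one
    band, and [W j] is the weight [p / D'] there. *)
Let T (j : nat) : R -> R := patch01 (fun s => t j (xs s)).
Let W (j : nat) : R -> R :=
  patch01 (fun s => p.[t j (xs s)] / \prod_(l < q | l != j :> nat) (t j (xs s) - t l (xs s))).

Lemma continuous_cos_pi c : continuous (fun s : R => c * cos (pi * s)).
Proof.
move=> s; apply: continuousM; first exact: cst_continuous.
apply: (@continuous_comp _ _ _ (fun s => pi * s) cos); last exact: continuous_cos.
by apply: continuousM; [exact: cst_continuous|exact: cvg_id].
Qed.

Lemma band_continuous_cos j c s : (j < q)%N -> `|c * cos (pi * s)| < 2 ->
  {for s, continuous (fun s => t j (c * cos (pi * s)))}.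
Proof.
move=> jq x2; apply: (@continuous_comp _ _ _ (fun s => c * cos (pi * s)) (t j)).
  exact: continuous_cos_pi.
exact: (band_continuous mD sD Dz tP).
Qed.

Lemma measurable_bandT j : (j < q)%N -> measurable_fun setT (T j).
Proof.
by move=> jq; apply: measurable_patch01 => s /cos_pi_lt2 x2; exact: band_continuous_cos.
Qed.

Lemma measurable_bandW j : (j < q)%N -> measurable_fun setT (W j).
Proof.
move=> jq; apply: measurable_patch01 => s /cos_pi_lt2 x2.
have ct l : (l < q)%N -> {for s, continuous (fun s => t l (xs s))}.
  by move=> lq; exact: band_continuous_cos.
apply: continuousM.
  apply: (@continuous_comp _ _ _ (fun s => t j (xs s)) (horner p)); first exact: ct.
  exact: continuous_horner.
apply: continuousV; first exact: (@den_neq0 (Ordinal jq)).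
rewrite /continuous_at; apply: cvg_big => [|l lj]; first exact: mul_continuous.
by apply: cvgB; [exact: ct|exact: ct].
Qed.


(** Mean value theorem: the derivative of the cosine vanishes at the two ends, so a lower bound
    needs the distance [d] from them, and the sine is smallest at [d] and [1 - d]. *)
Lemma cos_expanding (d s s' : R) : 0 < d -> d <= s <= 1 - d -> d <= s' <= 1 - d ->
  sin (pi * d) * pi * `|s - s'| <= `|cos (pi * s) - cos (pi * s')|.
Proof.
move=> d0; wlog ss : s s' / s < s'.
  move=> h s1 s2; have [ss|ss|->] := ltgtP s s'; first exact: (h s s' ss s1 s2).
    by rewrite distrC [leRHS]distrC; exact: (h s' s ss s2 s1).
  by rewrite !subrr normr0 mulr0.
move=> /andP[s1 s2] /andP[s3 s4].
have pi0 := pi_gt0 R.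
have cc : {within `[s, s'], continuous (fun s : R => cos (pi * s))}.
  apply: continuous_subspaceT => x.
  have := @continuous_cos_pi 1 x; rewrite (_ : (fun s : R => 1 * cos (pi * s)) = (fun s : R => cos (pi * s)))//.
  by apply/funext => y; rewrite mul1r.
have dc (x : R) : x \in `]s, s'[ -> is_derive x (1 : R) (fun s : R => cos (pi * s)) (- sin (pi * x) * pi).
  move=> _; apply: is_derive_eq.
  by rewrite /GRing.scale /= mulr1.
have [c] := MVT ss dc cc; rewrite in_itv /= => /andP[c1 c2] e.
rewrite -(distrC (cos (pi * s'))) e -(distrC s') normrM ler_wpM2r//.
rewrite normrM normrN (ger0_norm (ltW pi0)) ler_wpM2r ?(ltW pi0)//.
apply: le_trans (ler_norm _).
have dh : d <= 1 / 2 by lra.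
have sd : 0 < sin (pi * d) by apply: sin_gt0_pi; rewrite mulr_gt0//= gtr_pMr//; lra.
have h1 : 0 <= pi * d <= pi / 2 by apply/andP; split; nra.
have [c3|c3] := leP c (1 / 2).
  have : pi * d \in `[- (pi / 2), pi / 2] by rewrite in_itv /=; apply/andP; split; nra.
  have : pi * c \in `[- (pi / 2), pi / 2] by rewrite in_itv /=; apply/andP; split; nra.
  move=> i1 i2; rewrite leNgt (ltr_sin i1 i2) -leNgt ler_pM2l//; lra.
have -> : sin (pi * c) = sin (pi * (1 - c)).
  by rewrite mulrBr mulr1 sinB sinpi cospi mul0r sub0r mulN1r opprK.
have : pi * d \in `[- (pi / 2), pi / 2] by rewrite in_itv /=; apply/andP; split; nra.
have : pi * (1 - c) \in `[- (pi / 2), pi / 2] by rewrite in_itv /=; apply/andP; split; nra.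
move=> i1 i2; rewrite leNgt (ltr_sin i1 i2) -leNgt ler_pM2l//; lra.
Qed.

(** Absolute continuity of the image law without differentiating the inverse branch: [D] composed
    with [T j] is [2 cos (pi s)], which expands distances away from the ends, and [D] is Lipschitz
    on the band, so [T j] expands too. *)
Lemma band_null j (B : set R) : (j < q)%N -> measurable B -> lebesgue_measure B = 0%E ->
  P (T j @^-1` B) = 0%E.
Proof.
move=> jq mB B0.
have mTB : measurable (T j @^-1` B).
  by rewrite -[X in measurable X]setTI; exact: measurable_bandT.
rewrite /P unitPE//.
pose A (n : nat) := (T j @^-1` B) `&` `[n.+2%:R^-1, 1 - n.+2%:R^-1]%classic.
have mA n : measurable (A n) by exact: measurableI.
have A01 n s : A n s -> 0 < s < 1.
  move=> [_]; rewrite /= in_itv /= => /andP[h1 h2].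
  have n0 : 0 < n.+2%:R^-1 :> R by rewrite invr_gt0.
  by rewrite (lt_le_trans n0 h1) (le_lt_trans h2)// gtrBl.
have A0 n : lebesgue_measure (A n) = 0%E.
  have [k k1 kP] := poly_lipshitz D (z j) (z j.+1).
  pose d : R := n.+2%:R^-1.
  have d0 : 0 < d by rewrite invr_gt0.
  have d2 : d <= 1 / 2 by rewrite /d div1r lef_pV2 ?posrE// ler_nat.
  have pi0 := pi_gt0 R.
  have sd : 0 < sin (pi * d) by apply: sin_gt0_pi; rewrite mulr_gt0//= gtr_pMr//; lra.
  have sdp : 0 < sin (pi * d) * pi by rewrite mulr_gt0.
  have [K [K0 KP]] : exists K : R, 0 <= K /\ forall x y, x \in `[z j, z j.+1] ->
      y \in `[z j, z j.+1] -> `|D.[x] - D.[y]| <= K * `|x - y|.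
    exists k; split; first exact: le_trans k1.
    by move=> x y xI yI; apply: kP.
  (* [K] is the Lipschitz constant of [D] on the band, and [2 sin (pi d) pi] is the expansion factor
     of [2 cos (pi s)]. *)
  apply: (@expanding_null R (A n) B (T j) (K / (sin (pi * d) * pi) / 2)) => //.
  - by rewrite !divr_ge0// ltW.
  - move=> s s' As As'; have [s01 s01'] := (A01 _ _ As, A01 _ _ As').
    rewrite /T !patch01E//.
    have [x2 x2'] := (cos_pi_lt2 s01, cos_pi_lt2 s01').
    have := KP (t j (xs s)) (t j (xs s')); rewrite !(band_root tP)//.
    have [[tx _] [tx' _]] := (tP x2, tP x2').
    rewrite !in_itv /=; have /andP[/ltW -> /ltW ->] := tx j jq.
    have /andP[/ltW -> /ltW ->] := tx' j jq => /(_ isT isT) h.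
    have := @cos_expanding d s s' d0.
    have [_ hs] := As; have [_ hs'] := As'; move: hs hs'; rewrite /= !in_itv /= -/d => -> ->.
    move=> /(_ isT isT) h2.
    move: h; rewrite /xs -mulrBr normrM ger0_norm// => h3.
    rewrite mulrAC ler_pdivlMr// mulrAC ler_pdivlMr//.
    by apply: le_trans h3; lra.
  - by move=> s [].
apply/eqP; rewrite eq_le measure_ge0 andbT.
apply: (@le_trans _ _ (lebesgue_measure (\bigcup_n A n))).
  apply: le_measure; rewrite ?inE; [exact: measurableI|by apply: bigcup_measurable => k _; exact: mA|].
  move=> s [Ts]; rewrite /= in_itv /= => /andP[s0 s1].
  have [m sm] : exists m : nat, m.+2%:R^-1 <= Num.min s (1 - s).
    have ms : 0 < Num.min s (1 - s) by rewrite lt_min s0 subr_gt0.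
    exists (Num.truncn (Num.min s (1 - s))^-1).
    rewrite -[leRHS]invrK lef_pV2 ?posrE ?invr_gt0//.
    apply/ltW; apply: lt_le_trans (truncnS_gt _) _; first by rewrite ler_nat.
  exists m => //; split => //=; rewrite in_itv /=.
  by move: sm; rewrite le_min => /andP[-> h] /=; rewrite lerBrDr addrC -lerBrDr.
apply: (@le_trans _ _ (\sum_(n <oo) lebesgue_measure (A n))%E).
  apply: measure_sigma_subadditive => //; first by apply: bigcup_measurable => n _; exact: mA.
by rewrite eseries0.
Qed.


Lemma weight_sum s : 0 < s < 1 -> \sum_(j < q) W j s = 1.
Proof.
move=> s01; have := green_sum 0 0 s01.
rewrite /= /qcos dvdz0 div0z mul0r cos0 => <-; apply: eq_bigr => j _.
by rewrite /W patch01E// mul1r green_0.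
Qed.

Lemma weight_ge0 j s : (j < q)%N -> 0 <= W j s.
Proof.
move=> jq; rewrite /W /patch01; case: ifPn => // s01.
exact/ltW/(weight_gt0 (Ordinal jq))/cos_pi_lt2.
Qed.

Lemma weight_le1 j s : (j < q)%N -> `|W j s| <= 1.
Proof.
move=> jq; rewrite ger0_norm ?weight_ge0//.
have [s01|s01] := boolP ((0 < s) && (s < 1)); last by rewrite /W /patch01 (negbTE s01).
rewrite -(weight_sum s01) (bigD1 (Ordinal jq))//= lerDl sumr_ge0// => l _.
exact: weight_ge0.
Qed.

(** The measure is the sum over the bands of the images under [T j] of the uniform law weighted by
    [W j]. Its moments come from [green_sum] at the origin, where [green] equals [p], followed by
    [integral_qcos]. *)
Lemma delta0_spectral : exists mu : {finite_measure set (measurableTypeR R) -> \bar R},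
  [/\ mu `<< (@lebesgue_measure R),
    exists M : R, mu (~` `[- M, M]) = 0%E,
    forall k, Rintegral mu setT (fun x : R => x ^+ k) = iter k (jac v) delta0 0 &
    forall E e : R, `|D.[E]| < 2 -> 0 < e -> (0 < mu `](E - e)%R, (E + e)%R[%classic)%E].
Proof.
(* The mixture takes a family indexed by all naturals; clamping the index keeps every member a
   genuine band. *)
pose J j := minn j q1.
have Jq j : (J j < q)%N by rewrite ltnS geq_minr.
have JE j : (j < q)%N -> J j = j by rewrite ltnS => /minn_idPl.
have iW j : P.-integrable setT (EFin \o W (J j)).
  by apply: (@bounded_integrable _ _ _ P _ 1) => [|s]; [exact: measurable_bandW|exact: weight_le1].
have [nu nuP] := boolp.choice (fun j => @density_measure _ (measurableTypeR R) R P (W (J j)) (fun s => weight_ge0 s (Jq j)) (iW j)).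
have [mu [muE mu0 muI]] := @mixture_measure _ _ (measurableTypeR R) (measurableTypeR R) R q nu (fun j => T (J j)) (fun j => measurable_bandT (Jq j)).
have mT j (B : set R) : measurable B -> measurable (T (J j) @^-1` B).
  by move=> mB; rewrite -[X in measurable X]setTI; exact: measurable_bandT.
have nu_dom j U : measurable U -> P U = 0%E -> nu j U = 0%E.
  move=> mU U0; rewrite (nuP j).1//; apply: null_set_integral => //.
  apply: measurable_funS (measurable_int _ (iW j)) => //.
have nu01 j : nu j (~` `]0, 1[) = 0%E.
  by apply: nu_dom; [exact: measurableC|exact: unitP_itv01].
pose M := `|z 0%N| + `|z q|.
have zi : forall i, (i < q)%N -> z i < z i.+1 by case: Dz.
have TM j s : (j < q)%N -> `|T j s| <= M.
  move=> jq; rewrite /T /patch01; case: ifPn => [/cos_pi_lt2 x2|_]; last by rewrite normr0 addr_ge0.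
  have [tx _] := tP x2; have /andP[h1 h2] := tx j jq.
  have h3 : z 0 <= z j by apply: (incr_chainW zi); lia.
  have h4 : z j.+1 <= z q by apply: (incr_chainW zi); lia.
  have h5 := ler_norm (z q); have := ler_norm (- z 0); rewrite normrN => h6.
  have h7 := normr_ge0 (z 0); have h8 := normr_ge0 (z q).
  by rewrite ler_norml /M; apply/andP; split; lra.
exists mu; split.
- apply/null_content_dominatesP => B mB B0; rewrite muE big1// => j _.
  apply: nu_dom; first exact: mT.
  exact: band_null.
- exists M; rewrite muE big1// => j _; rewrite (_ : _ @^-1` _ = set0) ?measure0//.
  apply/seteqP; split => // s /=; apply; rewrite in_itv /= -ler_norml; exact: TM.
- move=> k.
  have mk : measurable_fun setT (fun x : R => x ^+ k) by exact: measurable_funX.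
  have bT j s : `|T (J j) s ^+ k| <= M ^+ k.
    by rewrite normrX lerXn2r ?nnegrE ?addr_ge0//; exact: TM.
  have mTk j : measurable_fun setT (fun s => T (J j) s ^+ k).
    by apply: measurable_funX; exact: measurable_bandT.
  have iT j : (nu j).-integrable setT (fun s => (T (J j) s ^+ k)%:E).
    exact: (@bounded_integrable _ _ _ (nu j) (fun s => T (J j) s ^+ k) (M ^+ k) (mTk j) (bT j)).
  have [_ e] := muI (fun x => x ^+ k) mk (fun j _ => iT j).
  rewrite /Rintegral e.
  have iTW j : P.-integrable setT (fun s => (T (J j) s ^+ k)%:E * (W (J j) s)%:E)%E.
    rewrite (_ : (fun s => _) = EFin \o (fun s => T (J j) s ^+ k * W (J j) s))//.
    apply: (@bounded_integrable _ _ _ P _ (M ^+ k)) => [|s].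
      exact: (measurable_funM (mTk j) (measurable_bandW (Jq j))).
    by rewrite normrM -[leRHS]mulr1 ler_pM// weight_le1.
  under eq_bigr do rewrite (nuP _).2//.
  rewrite -integral_sum//.
  rewrite -[RHS]/(fine (iter k (jac v) delta0 0)%:E) -(integral_qcos k 0).2.
  congr fine; rewrite (@negligible_integral _ _ _ P _ (~` `]0, 1[))//; last 3 first.
  + exact: measurableC.
  + by apply: integrable_sum.
  + exact: unitP_itv01.
  rewrite [RHS](@negligible_integral _ _ _ P _ (~` `]0, 1[))//; last 3 first.
  + exact: measurableC.
  + exact: (integral_qcos k 0).1.
  + exact: unitP_itv01.
  apply: eq_integral => s; rewrite inE => -[_ /contrapT]; rewrite /= in_itv /= => s01.
  rewrite -green_sum// -sumEFin; apply: eq_bigr => j _.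
  by rewrite JE// -EFinM /T /W !patch01E// green_0.
- move=> E e E2 e0; have [j jq Ej] := band_cover tP E2.
  have [s0 s01 xs0] := cos_pi_param E2.
  have Es0 : t j (xs s0) = E by rewrite /xs xs0 -Ej.
  have cT : {for s0, continuous (fun s => t j (xs s))}.
    by apply: band_continuous_cos => //; exact: cos_pi_lt2.
  have : \forall s \near s0, 0 < s < 1 /\ `|E - t j (xs s)| < e.
    near=> s; split; last first.
      near: s; move/cvgrPdist_lt: cT => /(_ e e0); rewrite Es0.
      by [].
    near: s; have := @near_in_itvoo R 0 1 s0; rewrite in_itv /= s01 => /(_ isT).
    by apply: filterS => x; rewrite in_itv.
  move=> /nbhs_ballP[r r0 rP].
  have r0' : 0 < r by exact: r0.
  pose I := `]s0 - r, s0 + r[%classic : set R.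
  have IP s : I s -> 0 < s < 1 /\ `|E - t j (xs s)| < e.
    rewrite /I /= in_itv /= => /andP[h1 h2]; apply: rP.
    by rewrite /ball /= ltr_norml; apply/andP; split; lra.
  have mI : measurable I by exact: measurable_itv.
  have PI : (0 < P I)%E.
    rewrite /P unitPE// (_ : I `&` _ = I); last first.
      by apply/setIidPl => s /IP[h _]; rewrite /= in_itv.
    by rewrite /I lebesgue_measure_itv /= lte_fin ifT ?lte_fin -?EFinD ?lte_fin; lra.
  have IT : I `<=` T (J j) @^-1` `]E - e, E + e[%classic.
    move=> s /IP[h1 h2]; rewrite /= in_itv /= JE// /T patch01E// -ltr_distl distrC//.
  rewrite muE (bigD1 (Ordinal jq))//=.
  apply: (@lt_le_trans _ _ (nu j (T (J j) @^-1` `](E - e)%R, (E + e)%R[%classic))); last first.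
    by rewrite leeDl// sume_ge0.
  apply: (@lt_le_trans _ _ (nu j I)); last by apply: le_measure; rewrite ?inE//; exact: mT.
  (* If the weighted mass of [I] were zero, [W j] would vanish almost everywhere on an interval of
     positive length, while it is positive throughout. *)
  rewrite lt0e measure_ge0 andbT; apply/eqP; rewrite (nuP j).1// => nuI.
  have := @ae_eq_integral_abs _ _ _ P I mI (EFin \o W (J j)).
  have mW : measurable_fun I (EFin \o W (J j)).
    by apply: measurable_funS (measurable_int _ (iW j)).
  move=> /(_ mW)[+ _].
  have -> : (\int[P]_(x in I) `|(EFin \o W (J j)) x| = \int[P]_(x in I) (W (J j) x)%:E)%E.
    by apply: eq_integral => s _; rewrite gee0_abs// lee_fin weight_ge0.
  move=> /(_ nuI)[N [mN N0 IN]].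
  suff IsubN : I `<=` N.
    by move: PI; rewrite ltNge -N0 => /negP; apply; apply: le_measure; rewrite ?inE.
  move=> s Is; apply: IN => /= /(_ Is) []; have [s1 _] := IP _ Is.
  rewrite JE// /W patch01E//; apply/eqP; rewrite gt_eqF//.
  exact/(weight_gt0 (Ordinal jq))/cos_pi_lt2.
Unshelve. all: by end_near.
Qed.

End Delta0.

(** * The absolutely continuous spectrum of a periodic operator *)

Section CompactSupport.
Variable R : realType.
Variable mu : {finite_measure set (measurableTypeR R) -> \bar R}.
Variable M : R.
Hypothesis supp : mu (~` `[- M, M]) = 0%E.

Let I : set (measurableTypeR R) := `[- M, M]%classic.
Let mI : measurable I. Proof. exact: measurable_itv. Qed.

(** Boundedness is asked only on the support of the measure, so that polynomials qualify. *)
Definition admissible (f : R -> R) :=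
  measurable_fun (setT : set (measurableTypeR R)) f /\
  exists B, forall t, - M <= t <= M -> `|f t| <= B.

Definition suppint (f : R -> R) : R := Rintegral mu I f.

Lemma admissible_integrable f : admissible f -> mu.-integrable I (EFin \o f).
Proof.
move=> [mf [B fB]]; apply: measurable_bounded_integrable => //.
- by apply: (le_lt_trans (le_measure mu _ _ (@subsetT _ I))); rewrite ?inE//;
    have := @fin_num_measure _ _ _ mu _ measurableT; rewrite ge0_fin_numE.
- exact: measurable_funTS.
- exists B; split; first exact: num_real.
  move=> K BK t; rewrite /I /= in_itv /= => /fB tB; exact: le_trans tB (ltW BK).
Qed.

Lemma admissible_integrableT f : admissible f -> mu.-integrable setT (EFin \o f).
Proof.
move=> af; have mf : measurable_fun setT (EFin \o f).
  by apply/measurable_EFinP; case: af.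
apply: (negligible_integrable (measurableC mI) measurableT mf supp).2.
by rewrite setTD setCK; exact: admissible_integrable.
Qed.

Lemma suppintE f : admissible f -> Rintegral mu setT f = suppint f.
Proof.
move=> af; rewrite /suppint /Rintegral; congr fine.
rewrite (negligible_integral (measurableC mI) measurableT _ supp) ?setTD ?setCK//.
exact: admissible_integrableT.
Qed.

Lemma eq_suppint f g : (forall t, - M <= t <= M -> f t = g t) -> suppint f = suppint g.
Proof.
move=> fg; apply: eq_Rintegral => t; rewrite inE /I /= in_itv /=; exact: fg.
Qed.

Lemma suppintD f g : admissible f -> admissible g ->
  suppint (fun t => f t + g t) = suppint f + suppint g.
Proof. by move=> af ag; rewrite /suppint RintegralD//; exact: admissible_integrable. Qed.

Lemma suppintZ c f : admissible f -> suppint (fun t => c * f t) = c * suppint f.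
Proof. by move=> af; rewrite /suppint RintegralZl//; exact: admissible_integrable. Qed.

Lemma ler_suppint f g : admissible f -> admissible g ->
  (forall t, - M <= t <= M -> f t <= g t) -> suppint f <= suppint g.
Proof.
move=> af ag fg; apply: le_Rintegral => //; exact: admissible_integrable.
Qed.

Lemma ler_norm_suppint f B : admissible f -> 0 <= B ->
  (forall t, - M <= t <= M -> `|f t| <= B) -> `|suppint f| <= B * fine (mu I).
Proof.
move=> af B0 fB; apply: (le_trans (le_normr_Rintegral mI (admissible_integrable af))).
rewrite -(Rintegral_cst mu mI B).
have an : admissible (fun t => `|f t|).
  have [mf _] := af; split; first exact: measurableT_comp.
  by exists B => t tI; rewrite normr_id; exact: fB.
have ac : admissible (fun=> B) by split => //; exists `|B|.
by apply: ler_suppint.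
Qed.

Lemma admissibleD f g : admissible f -> admissible g -> admissible (fun t => f t + g t).
Proof.
move=> [mf [B fB]] [mg [C gC]]; split; first exact: measurable_funD.
by exists (B + C) => t tI; rewrite (le_trans (ler_normD _ _))// lerD ?fB ?gC.
Qed.

Lemma admissibleM f g : admissible f -> admissible g -> admissible (fun t => f t * g t).
Proof.
move=> [mf [B fB]] [mg [C gC]]; split; first exact: measurable_funM.
by exists (B * C) => t tI; rewrite normrM ler_pM ?fB ?gC.
Qed.

Lemma admissible_cst c : admissible (fun=> c).
Proof. by split => //; exists `|c|. Qed.

Lemma admissible_horner (p : {poly R}) : admissible (horner p).
Proof.
elim/poly_ind: p => [|p c IH].
  have -> : horner (0 : {poly R}) = fun=> 0 by apply/funext => t; rewrite horner0.
  exact: admissible_cst.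
have -> : horner (p * 'X + c%:P) = fun t => p.[t] * t + c.
  by apply/funext => t; rewrite !hornerE.
apply: admissibleD; last exact: admissible_cst.
apply: admissibleM => //; split; first exact: measurable_id.
by exists M => t; rewrite -ler_norml.
Qed.

Lemma admissible_mulb (f : R -> R) (P : set R) :
  measurable (P : set (measurableTypeR R)) -> admissible f -> admissible (fun t => f t * \1_P t).
Proof.
move=> mP af; apply: admissibleM => //; split; first exact: measurable_indic.
by exists 1 => t _; rewrite indicE; case: (_ \in _); rewrite ?normr1 ?normr0.
Qed.

End CompactSupport.

Lemma poly_functional0 (R : realType) (L : {poly R} -> R) :
  (forall g h, L (g + h) = L g + L h) -> (forall c g, L (c *: g) = c * L g) ->
  (forall k, L 'X^k = 0) -> forall g, L g = 0.
Proof.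
move=> LD LZ LX g; rewrite -(coefK g) poly_def; apply: (big_ind (fun h => L h = 0)).
- by rewrite -(scale0r 'X) LZ mul0r.
- by move=> g1 g2 e1 e2; rewrite LD e1 e2 addr0.
- by move=> i _; rewrite LZ LX mulr0.
Qed.

Lemma zseries_single (R : realType) (f : int -> R) :
  (forall n, n != 0 -> f n = 0) -> zseries f = f 0.
Proof.
move=> f0; have E N : wsum N f = f 0.
  elim: N => [|N IH]; first exact: wsum0.
  have f1 := f0 N.+1%:Z isT; have f2 := f0 (- N.+1%:Z) isT.
  by rewrite wsumS IH f1 f2 add0r addr0.
apply: cvg_lim => //; rewrite (_ : (fun N => _) = fun=> f 0); first exact: cvg_cst.
by apply/funext => N; exact: E.
Qed.

Lemma rip_delta0 (R : realType) (x : int -> R) : rip (delta0 R) x = x 0.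
Proof.
rewrite /rip zseries_single /delta0 ?eqxx ?mul1r// => n n0.
by rewrite (negbTE n0) mul0r.
Qed.

Lemma rl2_delta0 (R : realType) : rl2 (delta0 R).
Proof.
exists 1 => N; elim: N => [|N IH]; first by rewrite wsum0 /delta0 eqxx expr1n.
by rewrite wsumS /delta0 oppr_eq0 /= expr0n /= add0r addr0.
Qed.

(** The recurring contradiction: a positive quantity multiplied by a larger geometric rate cannot
    stay below a smaller rate. It serves the spectral estimates as well as the sign of the arcsine
    potential. *)
Lemma geometric_squeeze (R : realType) (m C a b : R) : 0 < m -> 0 <= a < b ->
  ~ (forall N, m * b ^+ N <= C * a ^+ N).
Proof.
move=> m0 /andP[a0 ab] H; have b0 := le_lt_trans a0 ab.
have r1 : `|a / b| < 1 by rewrite ger0_norm ?divr_ge0 ?(ltW b0)// ltr_pdivrMr// mul1r.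
have : (fun N => C * (a / b) ^+ N) @ \oo --> C * 0.
  by apply: cvgM; [exact: cvg_cst|exact: cvg_expr].
rewrite mulr0 => cv; have : m <= 0.
  rewrite -(cvg_lim _ cv)//; apply: limr_ge; first by apply/cvg_ex; exists 0.
  by near=> N; rewrite expr_div_n mulrA ler_pdivlMr ?exprn_gt0.
by rewrite leNgt m0.
Unshelve. all: by end_near. Qed.

Lemma rip_sqrD (R : realType) (x y : int -> R) : rl2 x -> rl2 y ->
  rip (fun n => x n + y n) (fun n => x n + y n) = rip x x + 2 * rip x y + rip y y.
Proof.
move=> lx ly; have lxy := rl2D lx ly.
rewrite ripDr// (ripC _ x) (ripC _ y) !ripDr// (ripC y x); ring.
Qed.

Lemma rip_sqrZ (R : realType) (a : R) (x : int -> R) : rl2 x ->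
  rip (fun n => a * x n) (fun n => a * x n) = a ^+ 2 * rip x x.
Proof.
by move=> lx; have lax := rl2Z a lx; rewrite ripZr// ripC ripZr// mulrA expr2.
Qed.

(** * Absolutely continuous vectors and resolvents of a periodic operator *)

Section ACSubspace.
Variable R : realType.
Variables (V : R -> R) (alpha theta : R) (q1 : nat).
Local Notation q := q1.+1.
Let v : int -> R := fun n => V (alpha * n%:~R + theta).
Let A := schrodinger V alpha theta.
Hypothesis vq : forall m, v (m + q%:Z) = v m.

Let v_bdd := periodic_bdd vq.
Let D := disc v 0 q.

Implicit Types (psi phi : int -> R[i]) (g : {poly R}).

Lemma rspecD x y g1 g2 : rl2 x -> rl2 y ->
  rspec V alpha theta x y (g1 + g2) = rspec V alpha theta x y g1 + rspec V alpha theta x y g2.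
Proof.
move=> lx ly; rewrite /rspec -/v.
have E z : opP v (g1 + g2) z = fun n => opP v g1 z n + opP v g2 z n.
  by apply/funext => n; rewrite opPD.
rewrite !E !ripDr//; try exact: (rl2_opP v_bdd); ring.
Qed.

Lemma rspecZ x y c g : rl2 x -> rl2 y ->
  rspec V alpha theta x y (c *: g) = c * rspec V alpha theta x y g.
Proof.
move=> lx ly; rewrite /rspec -/v.
have E z : opP v (c *: g) z = fun n => c * opP v g z n.
  by apply/funext => n; rewrite opPZ.
by rewrite !E !ripZr//; try exact: (rl2_opP v_bdd); rewrite mulrDr.
Qed.

Lemma rspec_mul x y g h : rl2 x -> rl2 y ->
  rspec V alpha theta x y (h * (g * h)) = rspec V alpha theta (opP v h x) (opP v h y) g.
Proof.
move=> lx ly; rewrite /rspec -/v !opPM.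
by rewrite !(rip_opP v_bdd) //; do ?apply: (rl2_opP v_bdd); rewrite // -!(rip_opP v_bdd) //; do ?apply: (rl2_opP v_bdd).
Qed.

(** Bundles what is used of an absolutely continuous vector; the moment identity is extended to all
    polynomials and written over the support interval, where they are bounded. *)
Variant ac_with psi (mu : {finite_measure set (measurableTypeR R) -> \bar R}) (M : R) : Prop :=
  ACWith of l2 psi & mu (~` `[- M, M]) = 0%E & mu `<< (@lebesgue_measure R) &
    (forall g, rspec V alpha theta (re_seq psi) (im_seq psi) g = suppint mu M (horner g)).

Lemma ac_withP psi (mu : {finite_measure set (measurableTypeR R) -> \bar R}) M : l2 psi -> mu (~` `[- M, M]) = 0%E -> mu `<< (@lebesgue_measure R) ->
  (forall k, rspec V alpha theta (re_seq psi) (im_seq psi) 'X^k =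
    Rintegral mu setT (fun t : R => t ^+ k)) -> ac_with psi mu M.
Proof.
move=> lpsi supp dom mom; have [lx ly] := (l2P psi).1 lpsi.
split => // g; apply/eqP; rewrite -subr_eq0; apply/eqP.
pose L h := rspec V alpha theta (re_seq psi) (im_seq psi) h - suppint mu M (horner h).
rewrite -/(L g); apply: poly_functional0.
- move=> g1 g2; rewrite /L rspecD//.
  have -> : horner (g1 + g2) = fun t => g1.[t] + g2.[t] by apply/funext => t; rewrite hornerD.
  rewrite suppintD; [ring|exact: admissible_horner|exact: admissible_horner].
- move=> c h; rewrite /L rspecZ//.
  have -> : horner (c *: h) = fun t => c * h.[t] by apply/funext => t; rewrite hornerZ.
  rewrite suppintZ; [ring|exact: admissible_horner].
move=> k; rewrite /L mom -(suppintE supp); last exact: admissible_horner.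
have -> : horner 'X^k = fun t : R => t ^+ k by apply/funext => t; rewrite hornerXn.
exact: subrr.
Qed.

Lemma ac_subspaceP psi : ac_subspace A psi <-> exists mu M, ac_with psi mu M.
Proof.
split=> [[lpsi [mu smu dom]]|[mu [M [lpsi supp dom gE]]]]; last first.
  split=> //; exists mu => //; apply/(spectral_measureP v_bdd) => //.
  split; first by exists M.
  move=> k; rewrite gE -(suppintE supp).
    by congr Rintegral; apply/funext => t; rewrite hornerXn.
  exact: admissible_horner.
have [[M supp] mom] := (spectral_measureP v_bdd mu lpsi).1 smu.
by exists mu, M; exact: ac_withP.
Qed.

Lemma ac_density psi mu M phi f : ac_with psi mu M -> admissible M f ->
  (forall t, - M <= t <= M -> 0 <= f t) -> l2 phi ->
  (forall g, rspec V alpha theta (re_seq phi) (im_seq phi) g = suppint mu M (fun t => g.[t] * f t)) ->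
  ac_subspace A phi.
Proof.
move=> [lpsi supp dom gE] af f0 lphi phiE.
have mI : measurable (`[- M, M]%classic : set (measurableTypeR R)) by exact: measurable_itv.
pose F (t : measurableTypeR R) : R := f t * \1_`[- M, M]%classic t.
have F0 t : 0 <= F t.
  rewrite /F indicE; have [|_] := boolP (_ \in _); last by rewrite mulr0.
  by rewrite inE /= in_itv /= mulr1 => /f0.
have aF : admissible M F by exact: admissible_mulb.
have [nu [nuU nuI]] := @density_measure _ (measurableTypeR R) R mu F F0
  (admissible_integrableT supp aF).
have supn : nu (~` `[- M, M]) = 0%E.
  rewrite nuU; last exact: measurableC.
  by apply: null_set_integral => //; [exact: measurableC|
    apply/measurable_EFinP/measurable_funTS; case: aF].
apply/ac_subspaceP; exists nu, M; split => //.
  apply/null_content_dominatesP => U mU U0; rewrite nuU//.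
  apply: null_set_integral => //; last exact: ((null_content_dominatesP _ _).1 dom).
  by apply/measurable_EFinP/measurable_funTS; case: aF.
move=> g; rewrite phiE -(suppintE supn); last exact: admissible_horner.
rewrite (@eq_suppint _ mu M _ (fun t => g.[t] * F t)) => [|t tI]; last first.
  by rewrite /F indicE mem_set ?mulr1//= in_itv.
rewrite -(suppintE supp); last by apply: admissibleM => //; exact: admissible_horner.
rewrite /Rintegral; congr fine.
rewrite -[RHS]/((\int[nu]_x (EFin \o horner g) x)%E) nuI//.
apply: (admissible_integrableT supn); exact: admissible_horner.
Qed.

Lemma ac_opP psi mu M phi h : ac_with psi mu M ->
  re_seq phi = opP v h (re_seq psi) -> im_seq phi = opP v h (im_seq psi) ->
  ac_subspace A phi.
Proof.
move=> ac rE iE; have [lpsi supp dom gE] := ac.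
have [lx ly] := (l2P psi).1 lpsi.
have gh g : rspec V alpha theta (re_seq phi) (im_seq phi) g =
    rspec V alpha theta (re_seq psi) (im_seq psi) (h * (g * h)).
  by rewrite rE iE rspec_mul.
apply: (@ac_density psi mu M phi (fun t => h.[t] ^+ 2)) => //.
- have -> : (fun t => h.[t] ^+ 2) = horner (h ^+ 2) by apply/funext => t; rewrite horner_exp.
  exact: admissible_horner.
- by move=> t _; exact: sqr_ge0.
- by apply/l2P; rewrite rE iE; split; exact: (rl2_opP v_bdd).
- by move=> g; rewrite gh gE; apply: eq_suppint => t _; rewrite !hornerM expr2; ring.
Qed.

Definition cdelta0 : int -> R[i] := fun n => (delta0 R n)%:C%C.

Lemma cdelta0_ac : exists mu M, ac_with cdelta0 mu M /\
  forall E e, `|D.[E]| < 2 -> 0 < e -> (0 < mu `](E - e)%R, (E + e)%R[%classic)%E.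
Proof.
have [z [Dz pz]] := disc_alternating v 0 (ltn0Sn q1).
have [mD sD] := disc_monic_size v 0 (ltn0Sn q1).
have [t tP] := band_rootsP mD sD Dz.
have [mu [dom [M supp] mom pos]] := delta0_spectral vq Dz pz tP.
exists mu, M; split => //; apply: ac_withP supp dom _.
  apply/l2P; split; first exact: rl2_delta0.
  exact: rl20.
move=> k; rewrite mom /rspec opPXn.
have -> : im_seq cdelta0 = fun=> 0 by [].
have -> : re_seq cdelta0 = delta0 R by [].
by rewrite rip_delta0 ripC rip0r addr0.
Qed.


Lemma l2norm_mono psi phi (C : R) : l2 psi -> l2 phi -> l2norm psi <= C * l2norm phi ->
  rip (re_seq psi) (re_seq psi) + rip (im_seq psi) (im_seq psi) <=
  C ^+ 2 * (rip (re_seq phi) (re_seq phi) + rip (im_seq phi) (im_seq phi)).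
Proof.
move=> lpsi lphi; have [[lx ly] [lx' ly']] := ((l2P psi).1 lpsi, (l2P phi).1 lphi).
rewrite !l2normE//; set a := (X in Num.sqrt X <= _); set b := (X in _ * Num.sqrt X).
have a0 : 0 <= a by rewrite addr_ge0 ?rip_ge0.
have b0 : 0 <= b by rewrite addr_ge0 ?rip_ge0.
move=> h; rewrite -[leLHS](sqr_sqrtr a0) -[X in _ * X](sqr_sqrtr b0) -exprMn.
by rewrite lerXn2r ?nnegrE ?sqrtr_ge0// (le_trans _ h)// sqrtr_ge0.
Qed.

Lemma suppint_indic (mu : {finite_measure set (measurableTypeR R) -> \bar R}) M (P : set (measurableTypeR R)) :
  measurable P -> suppint mu M \1_P = fine (mu (P `&` `[- M, M])).
Proof.
move=> mP; rewrite /suppint /Rintegral integral_indic//; exact: measurable_itv.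
Qed.

(** A resolvent bound, tested on [g(A)] applied to the point mass, reads
    [\int g^2 <= C^2 \int (t - E)^2 g^2]. With [g = h^N] peaked at [E] this fails for large [N],
    because the measure charges every neighbourhood of [E]. *)
Lemma ac_spectrum_inner E : `|D.[E]| < 2 -> ac_spectrum A E.
Proof.
move=> DE [_ [C HC]].
have [mu [M [ac pos]]] := cdelta0_ac; have [lpsi supp dom gE] := ac.
have [lx ly] := (l2P cdelta0).1 lpsi.
pose T (g : {poly R}) : int -> R[i] := fun n => (opP v g (delta0 R) n)%:C%C.
have reT g : re_seq (T g) = opP v g (re_seq cdelta0) by [].
have imT g : im_seq (T g) = opP v g (im_seq cdelta0).
  apply/funext => n; rewrite /im_seq /=.
  have z0 : (fun _ : int => 0) = opP v 0 (delta0 R) by apply/funext => m; rewrite opP0.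
  by rewrite z0 -opPM mulr0 opP0.
have acT g : ac_subspace A (T g) by exact: (ac_opP ac).
have normT g : rip (re_seq (T g)) (re_seq (T g)) + rip (im_seq (T g)) (im_seq (T g)) =
    suppint mu M (fun t => g.[t] ^+ 2).
  rewrite reT imT -[LHS](_ : rspec V alpha theta (opP v g (re_seq cdelta0)) (opP v g (im_seq cdelta0)) 1 = _).
    rewrite -rspec_mul// gE; apply: eq_suppint => t _; rewrite !hornerM hornerC mul1r.
    by rewrite expr2.
  by rewrite /rspec; congr (rip _ _ + rip _ _); apply/funext => n; rewrite opP1.
have key g : suppint mu M (fun t => g.[t] ^+ 2) <=
    C ^+ 2 * suppint mu M (fun t => (t - E) ^+ 2 * g.[t] ^+ 2).
  have := HC _ (acT g); have [l1 _] := acT g.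
  have -> : shift_op A E (T g) = T (('X - E%:P) * g).
    rewrite [LHS]complex_seqE [RHS]complex_seqE re_shift_op im_shift_op.
    by apply/funext => n; rewrite !reT !imT -/v !opPM.
  have [l2' _] := acT (('X - E%:P) * g).
  move=> /(l2norm_mono l1 l2'); rewrite !normT => /le_trans; apply.
  rewrite le_eqVlt; apply/orP; left; apply/eqP; congr (_ * _); apply: eq_suppint => t _.
  by rewrite hornerM hornerXsubC exprMn.
(* [K] bounds [(t - E)^2] on the support, so the bump [h = 1 - (t - E)^2 / K] stays between 0 and 1
   there. *)
pose K := (`|M| + `|E| + 1) ^+ 2.
have K1 : 1 <= K by rewrite exprn_ege1// lerDr addr_ge0.
have K0 : 0 < K by lra.
have tK t : - M <= t <= M -> (t - E) ^+ 2 <= K.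
  rewrite -ler_norml => tM; rewrite -real_normK ?num_real// lerXn2r ?nnegrE ?addr_ge0//.
  have := ler_normB t E; have := ler_norm M; lra.
(* Chosen so that [C^2 e^2 <= 1/2]: points within [e] of [E] then contribute at most half of
   [\int g^2], which is absorbed on the left. *)
pose e := (2 * (C ^+ 2 + 1) + 2)^-1.
have C2 : 0 <= C ^+ 2 := sqr_ge0 C.
have e0 : 0 < e by rewrite invr_gt0; lra.
have eC : (2 * (C ^+ 2 + 1) + 2) * e = 1 by rewrite divff//; apply/eqP; lra.
have e1 : e <= 1 by rewrite invf_le1; lra.
have eC2 : C ^+ 2 * e ^+ 2 <= 2^-1 by nra.
have e2 : 0 < e ^+ 2 by rewrite exprn_gt0.
have e21 : e ^+ 2 <= 1 by nra.
pose iK := K^-1.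
have iK0 : 0 < iK by rewrite invr_gt0.
have KiK : K * iK = 1 by rewrite divff// gt_eqF.
pose h : {poly R} := 1 - iK *: ('X - E%:P) ^+ 2.
have hE t : h.[t] = 1 - iK * (t - E) ^+ 2 by rewrite /h !hornerE.
have h01 t : - M <= t <= M -> 0 <= h.[t] <= 1.
  move=> tI; rewrite hE; have := tK t tI; have := sqr_ge0 (t - E) => s0 sK.
  by apply/andP; split; nra.
have iK1 : iK <= 1 by rewrite invf_le1.
(* [a] and [b] are the values of [h^2] at distances [e] and [e / 2] from [E]: an upper bound beyond
   [e] and a lower bound within [e / 2]. *)
pose a := (1 - iK * e ^+ 2) ^+ 2.
pose b := (1 - iK * (e / 2) ^+ 2) ^+ 2.
have e2' : (e / 2) ^+ 2 = e ^+ 2 / 4 by field.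
have iKe : 0 < iK * e ^+ 2 by rewrite mulr_gt0.
have iKe1 : iK * e ^+ 2 <= 1 by nra.
have ab : 0 <= a < b.
  rewrite sqr_ge0 /a /b /= e2' ltrXn2r ?nnegrE//; nra.
set U := `](E - e / 2)%R, (E + e / 2)%R[%classic : set (measurableTypeR R).
have mU : measurable U by exact: measurable_itv.
have muU : 0 < suppint mu M \1_U.
  rewrite suppint_indic// -(_ : mu U = mu (U `&` `[- M, M])).
    have := @pos E (e / 2) DE (divr_gt0 e0 (ltr0Sn _ 1)); rewrite -/U => p0.
    rewrite fine_gt0// p0/=; have := @fin_num_measure _ _ _ mu U mU.
    by rewrite ge0_fin_numE.
  rewrite -[U in LHS](setIT U) -(setUv `[- M, M]) setIUr measureU.
  - rewrite [X in (_ + X)%E](_ : _ = 0%E) ?adde0//; apply: subset_measure0 supp => //.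
      by apply: measurableI => //; apply: measurableC; exact: measurable_itv.
    by apply: measurableC; exact: measurable_itv.
  - by apply: measurableI => //; exact: measurable_itv.
  - by apply: measurableI => //; apply: measurableC; exact: measurable_itv.
  - by rewrite setIACA setICr setI0.
apply: (geometric_squeeze muU ab (C := 2 * C ^+ 2 * K * fine (mu `[- M, M]%classic))) => N.
set g := h ^+ N; have gE2 t : g.[t] ^+ 2 = (h.[t] ^+ 2) ^+ N by rewrite /g horner_exp exprAC.
have ag2 : admissible M (fun t => g.[t] ^+ 2).
  have -> : (fun t => g.[t] ^+ 2) = horner (g ^+ 2) by apply/funext => t; rewrite [RHS]horner_exp.
  exact: admissible_horner.
have aXg : admissible M (fun t => (t - E) ^+ 2 * g.[t] ^+ 2).
  apply: admissibleM => //.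
  have -> : (fun t => (t - E) ^+ 2) = horner (('X - E%:P) ^+ 2) by apply/funext => t; rewrite !hornerE.
  exact: admissible_horner.
have a0 : 0 <= a by rewrite sqr_ge0.
have up : C ^+ 2 * suppint mu M (fun t => (t - E) ^+ 2 * g.[t] ^+ 2) <=
    2^-1 * suppint mu M (fun t => g.[t] ^+ 2) + C ^+ 2 * K * a ^+ N * fine (mu `[- M, M]%classic).
  rewrite -!suppintZ// -(Rintegral_cst mu (measurable_itv _)) -suppintD//; last first.
  - exact: admissible_cst.
  - by apply: admissibleM => //; exact: admissible_cst.
  apply: ler_suppint.
  - by apply: admissibleM => //; exact: admissible_cst.
  - by apply: admissibleD; [apply: admissibleM => //|]; exact: admissible_cst.
  move=> t tI; rewrite mulrA; have g0 : 0 <= g.[t] ^+ 2 by exact: sqr_ge0.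
  have [te|te] := lerP ((t - E) ^+ 2) (e ^+ 2).
    apply: (@le_trans _ _ (2^-1 * g.[t] ^+ 2)).
      by apply: ler_wpM2r => //; apply: le_trans eC2; apply: ler_wpM2l.
    by rewrite lerDl (mulr_ge0 _ (exprn_ge0 N a0))// (mulr_ge0 C2 (ltW K0)).
  apply: (@le_trans _ _ (C ^+ 2 * K * a ^+ N)); last by rewrite lerDr mulr_ge0// invr_ge0.
  apply: ler_pM => //; first by rewrite mulr_ge0 ?sqr_ge0.
    by apply: ler_wpM2l => //; exact: tK.
  rewrite gE2 lerXn2r ?nnegrE ?sqr_ge0// /a; have /andP[h0 _] := h01 t tI.
  rewrite lerXn2r ?nnegrE//; last by rewrite hE; nra.
  by rewrite subr_ge0.
have lo : suppint mu M \1_U * b ^+ N <= suppint mu M (fun t => g.[t] ^+ 2).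
  have aU : admissible M \1_U.
    have := admissible_mulb mU (admissible_cst M 1).
    by rewrite (_ : (fun t => _) = \1_U)//; apply/funext => t; rewrite mul1r.
  rewrite mulrC -suppintZ//; apply: ler_suppint => //.
    by apply: admissibleM => //; exact: admissible_cst.
  move=> t tI; rewrite indicE; have [|_] := boolP (t \in U); last by rewrite mulr0 sqr_ge0.
  rewrite inE /U /= in_itv /= mulr1 => /andP[t1 t2].
  rewrite gE2 lerXn2r ?nnegrE ?sqr_ge0// /b; have /andP[h0 _] := h01 t tI.
  rewrite lerXn2r ?nnegrE//; first by rewrite e2'; nra.
  rewrite hE lerD2l lerN2 ler_wpM2l ?(ltW iK0)//.
  by rewrite -real_normK ?num_real// lerXn2r ?nnegrE//; [lra|rewrite ler_norml; apply/andP; split; lra].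
have := key g; move: up lo.
set X1 := suppint _ _ _; set X2 := suppint _ _ _; set X3 := suppint _ _ _; move=> h1 h2 h3; lra.
Qed.


Lemma rip_disc_le x : rl2 x -> rip (opP v D x) (opP v D x) <= 4 * rip x x.
Proof.
move=> lx; pose u n := x (n + q%:Z); pose w n := x (n + - q%:Z).
have lu : rl2 u by exact: rl2_shift. have lw : rl2 w by exact: rl2_shift.
have -> : opP v D x = fun n => u n + w n by apply/funext => n; rewrite (magic_formula _ vq).
have uu : rip u u = rip x x by exact: rip_shift.
have ww : rip w w = rip x x by exact: rip_shift.
rewrite rip_sqrD// uu ww.
have lw' := rl2Z (-1) lw; have := rip_ge0 (rl2D lu lw').
rewrite rip_sqrD// rip_sqrZ// ripZr// uu ww; lra.
Qed.

Lemma disc_factor E : exists Q, D - (D.[E])%:P = Q * ('X - E%:P).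
Proof. by apply/factor_theorem; rewrite rootE !hornerE subrr. Qed.

Lemma resolvent_bound E : 2 < `|D.[E]| -> exists2 C, 0 <= C & forall x, rl2 x ->
  rip x x <= C * rip (opP v ('X - E%:P) x) (opP v ('X - E%:P) x).
Proof.
move=> dE; set d := D.[E] in dE; have [Q QE] := disc_factor E.
have d4 : 4 < d ^+ 2.
  rewrite -[d ^+ 2]real_normK ?num_real// (_ : 4 = 2 ^+ 2); last by ring.
  by rewrite ltrXn2r// ?nnegrE.
have [B B0 QB] := opP_bound v_bdd Q.
(* Writing [d x = D(A) x - Q(A) y] with [y = (A - E) x], the cross term costs [8 e] times the
   squared norm of [x], half of the gap [d^2 - 4] left by [rip_disc_le]; [c] is the other half. *)
pose e := (d ^+ 2 - 4) / 16; have e0 : 0 < e by rewrite /e; lra.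
pose c := (d ^+ 2 - 4) / 2; have c0 : 0 < c by rewrite /c; lra.
exists (c^-1 * ((1 + 2 * e^-1) * B)).
  by rewrite mulr_ge0 ?invr_ge0 ?(ltW c0)// mulr_ge0// addr_ge0// mulr_ge0// invr_ge0 ltW.
move=> x lx; set y := opP v _ x; have ly : rl2 y by exact: (rl2_opP v_bdd).
have lQy : rl2 (opP v Q y) by exact: (rl2_opP v_bdd).
have lDx : rl2 (opP v D x) by exact: (rl2_opP v_bdd).
have E1 : (fun n => d * x n) = fun n => opP v D x n + (- 1) * opP v Q y n.
  apply/funext => n; rewrite /y -opPM -QE opPB opPC -/d; ring.
have lQy' := rl2Z (-1) lQy.
have := rip_sqrZ d lx; rewrite E1 rip_sqrD// rip_sqrZ// ripZr//.
rewrite -(mulrA c^-1) ler_pdivlMl//.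
have h1 := rip_disc_le lx; have h2 := QB _ ly.
have := rip_bound e0 lDx lQy; rewrite ler_norml => /andP[h3 _] h4.
have h5 : 0 <= e^-1 by rewrite invr_ge0 ltW.
have h6 := rip_ge0 lQy.
have h7 : (1 + 2 * e^-1) * rip (opP v Q y) (opP v Q y) <= (1 + 2 * e^-1) * (B * rip y y).
  by apply: ler_wpM2l => //; lra.
have h8 : e * rip (opP v D x) (opP v D x) <= e * (4 * rip x x) by apply: ler_wpM2l => //; exact: ltW.
have h9 : e * (4 * rip x x) = (d ^+ 2 - 4) / 4 * rip x x by rewrite /e; field.
rewrite /c; nra.
Qed.

Lemma joukowski_inverse (d : R) : 2 < `|d| -> exists2 r, `|r| < 1 & r ^+ 2 + 1 = d * r.
Proof.
wlog d0 : d / 0 < d => [H|] dE.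
  have [/H/(_ dE)//|d0] := ltP 0 d.
  have [||r r1 rE] := H (- d); first by rewrite oppr_gt0 lt_neqAle d0 andbT; apply/eqP => d00; move: dE; rewrite d00 normr0; lra.
    by rewrite normrN.
  by exists (- r); rewrite ?normrN// sqrrN rE mulNr mulrN.
rewrite gtr0_norm// in dE; pose s := Num.sqrt (d ^+ 2 - 4).
have s2 : s ^+ 2 = d ^+ 2 - 4 by rewrite sqr_sqrtr//; nra.
have s0 : 0 <= s by exact: sqrtr_ge0.
have ds : s < d by rewrite ltNge; apply/negP => h; nra.
have ds2 : d - 2 < s by rewrite ltNge; apply/negP => h; nra.
exists ((d - s) / 2); first by rewrite ltr_norml; apply/andP; split; lra.
by rewrite expr_div_n sqrrB s2; field.
Qed.

(** With [r + 1/r = D(E)] and [|r| < 1], the operator [- r (S^q + S^-q - D(E))] factors as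
    [(1 - r S^q) (1 - r S^-q)], and each factor is inverted by a Neumann series. *)
Lemma resolvent_surj E : 2 < `|D.[E]| -> forall x, rl2 x ->
  exists2 y, rl2 y & opP v ('X - E%:P) y = x.
Proof.
move=> dE x lx; set d := D.[E] in dE; have [Q QE] := disc_factor E.
have [r r1 rE] := joukowski_inverse dE.
have [w1 [lw1 w1E]] := neumann_shift q%:Z r1 lx.
have [w [lw wE]] := neumann_shift (- q%:Z) r1 lw1.
exists (opP v Q (fun n => - r * w n)); first by apply: (rl2_opP v_bdd); exact: rl2Z.
rewrite -opPM mulrC -QE; apply/funext => n.
rewrite opPB opPC (magic_formula _ vq)// -w1E -!wE -!addrA subrr addr0.
rewrite -/d (_ : d * (- r * w n) = - (r ^+ 2 + 1) * w n); last by rewrite rE; ring.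
ring.
Qed.

(* L = e vanishes on the ideal of 'X - E, so e g = g(E) e 1; growth along powers
   of D forces e 1 = 0. *)
Lemma growth_functional0 (e : {poly R} -> R) E c K :
  (forall g h, e (g + h) = e g + e h) -> (forall a g, e (a *: g) = a * e g) ->
  (forall g, e (('X - E%:P) * g) = 0) -> 0 <= c < `|D.[E]| ->
  (forall N, `|e (D ^+ N)| <= K * c ^+ N) -> forall g, e g = 0.
Proof.
move=> eD eZ e0 cd eK.
have eE g : e g = g.[E] * e 1.
  have [h hE] : exists h, g - (g.[E])%:P = h * ('X - E%:P).
    by apply/factor_theorem; rewrite rootE !hornerE subrr.
  have -> : g = ('X - E%:P) * h + g.[E] *: 1.
    by rewrite mulrC -hE -mul_polyC mulr1 subrK.
  by rewrite eD e0 add0r eZ !hornerE subrr mul0r add0r.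
suff e1 : e 1 = 0 by move=> g; rewrite eE e1 mulr0.
apply/eqP; rewrite -normr_eq0; apply/negPn/negP => n0.
have p0 : 0 < `|e 1| by rewrite lt_neqAle eq_sym n0 normr_ge0.
apply: (geometric_squeeze p0 cd (C := K)) => N.
by rewrite mulrC -normrX -normrM -horner_exp -eE.
Qed.

Lemma rip_discX_le N g z : rl2 z ->
  rip (opP v (D ^+ N * g) z) (opP v (D ^+ N * g) z) <= 4 ^+ N * rip (opP v g z) (opP v g z).
Proof.
move=> lz; elim: N => [|N IH]; first by rewrite !expr0 !mul1r.
rewrite !exprS -!mulrA opPM; apply: le_trans (rip_disc_le _) _.
  exact: (rl2_opP v_bdd).
by rewrite ler_wpM2l.
Qed.

Lemma rspec_disc_growth x y g : rl2 x -> rl2 y -> exists K, forall N,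
  `|rspec V alpha theta x y (D ^+ N * g)| <= K * 2 ^+ N.
Proof.
move=> lx ly.
pose K z := rip z z + rip (opP v g z) (opP v g z).
have H z N : rl2 z -> `|rip z (opP v (D ^+ N * g) z)| <= K z * 2 ^+ N.
  move=> lz; have lg : rl2 (opP v g z) by exact: (rl2_opP v_bdd).
  (* The weight [2^N] in [rip_bound] balances the two terms, as the squared norm of [D^N g z] is of
     order [4^N]. *)
  have p2 : 0 < 2 ^+ N :> R by exact: exprn_gt0.
  have lD : rl2 (opP v (D ^+ N * g) z) by exact: (rl2_opP v_bdd).
  apply: le_trans (rip_bound p2 lz lD) _.
  rewrite /K mulrDl mulrC lerD2l ler_pdivrMl//; apply: le_trans (rip_discX_le N g lz) _.
  rewrite le_eqVlt; apply/orP; left; apply/eqP.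
  have -> : 4 = 2 * 2 :> R by ring.
  rewrite exprMn; ring.
exists (K x + K y) => N; rewrite mulrDl; apply: le_trans (ler_normD _ _) _.
by rewrite lerD ?H.
Qed.

Lemma measurable_disc_ge (c : R) : measurable ([set t | c <= `|D.[t]|] : set (measurableTypeR R)).
Proof.
have [mD _] := admissible_horner 0 D.
have mn : measurable_fun (setT : set (measurableTypeR R)) (fun t => `|D.[t]|) by exact: measurableT_comp.
have := mn measurableT `[c, +oo[%classic (measurable_itv _); rewrite setTI.
by congr measurable; apply/seteqP; split => t /=; rewrite in_itv /= andbT.
Qed.

(** The integral of [D^(2N)] is the squared norm of [D(A)^N psi], at most of order [4^N], whereas
    mass on [|D| >= c] would make it grow like [c^(2N)]. *)
Lemma ac_null_outer psi mu M c : ac_with psi mu M -> 2 < c ->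
  suppint mu M \1_[set t | c <= `|D.[t]|] = 0.
Proof.
move=> [lpsi supp dom gE] c2; have [lx ly] := (l2P psi).1 lpsi.
set P := [set t | _]; have mP : measurable (P : set (measurableTypeR R)) by exact: measurable_disc_ge.
have aP : admissible M \1_P.
  have := admissible_mulb mP (admissible_cst M 1).
  by rewrite (_ : (fun t => _) = \1_P)//; apply/funext => t; rewrite mul1r.
apply/eqP/negPn/negP => n0.
have s0 : 0 < suppint mu M \1_P.
  by rewrite lt_neqAle eq_sym n0 suppint_indic// fine_ge0.
have c4 : (0 : R) <= 4 < c ^+ 2.
  by apply/andP; split; nra.
pose L := rip (re_seq psi) (re_seq psi) + rip (im_seq psi) (im_seq psi).
apply: (geometric_squeeze s0 c4 (C := L)) => N.
apply: (@le_trans _ _ (suppint mu M (horner (D ^+ N * (1 * D ^+ N))))); last first.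
  rewrite -gE rspec_mul// /rspec /L mulrDl.
  have o1 z : opP v 1 z = z by apply/funext => n; rewrite opP1.
  rewrite !o1 lerD// mulrC.
    by have := rip_discX_le N 1 lx; rewrite mulr1 o1.
  by have := rip_discX_le N 1 ly; rewrite mulr1 o1.
rewrite mulrC -suppintZ//; apply: ler_suppint.
- by apply: admissibleM => //; exact: admissible_cst.
- exact: admissible_horner.
move=> t tI; have -> : (D ^+ N * (1 * D ^+ N)).[t] = (D.[t] ^+ 2) ^+ N.
  by rewrite mul1r -expr2 !horner_exp exprAC.
rewrite indicE; have [|_] := boolP (t \in P); last by rewrite mulr0 exprn_ge0// sqr_ge0.
rewrite inE /P /= mulr1 => ct; rewrite lerXn2r ?nnegrE ?sqr_ge0//.
rewrite -[D.[t] ^+ 2]real_normK ?num_real// lerXn2r ?nnegrE//; lra.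
Qed.

(** The error [e] between the moments of [phi] and those of the density [f] vanishes on multiples of
    [(X - E)^2], by the identity for [psi]. Two applications of [growth_functional0] remove the two
    factors. *)
Lemma resolvent_ac E psi phi : 2 < `|D.[E]| -> ac_subspace A psi -> l2 phi ->
  opP v ('X - E%:P) (re_seq phi) = re_seq psi ->
  opP v ('X - E%:P) (im_seq phi) = im_seq psi -> ac_subspace A phi.
Proof.
move=> dE /ac_subspaceP[mu [M ac]] lphi reE imE; have [lpsi supp dom gE] := ac.
have [lx ly] := (l2P phi).1 lphi.
set d := D.[E] in dE; have [Q QE] := disc_factor E.
have [_ [B0 QB0]] := admissible_horner M Q.
pose B := `|B0| + 1; have B1 : 0 < B by rewrite /B ltr_wpDl.
have QB t : - M <= t <= M -> `|Q.[t]| <= B.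
  by move=> /QB0 h; apply: (le_trans h); rewrite /B (le_trans (ler_norm _))// lerDl.
(* The midpoint of [2] and [|d|]: above 2, the measure ignores [|D| >= c]; below [|d|], the region
   [|D| < c] stays at distance at least [del / B] from [E] within the support, [B] bounding [Q]. *)
pose c := (2 + `|d|) / 2; pose del := `|d| - c.
have c2 : 2 < c by rewrite /c; lra.
have cd : 0 <= c < `|d| by apply/andP; rewrite /c; split; lra.
have del0 : 0 < del by rewrite /del /c; lra.
set P' := [set t | c <= `|D.[t]|]; pose P := ~` P'.
have null : suppint mu M \1_P' = 0 := ac_null_outer ac c2.
have mP' : measurable (P' : set (measurableTypeR R)) by exact: measurable_disc_ge.
have mP : measurable (P : set (measurableTypeR R)) by exact: measurableC.
have aind U : measurable (U : set (measurableTypeR R)) -> admissible M \1_U.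
  move=> mU; have := admissible_mulb mU (admissible_cst M 1).
  by rewrite (_ : (fun t => _) = \1_U)//; apply/funext => t; rewrite mul1r.
(* The inverse is written as a real power, whose measurability is at hand; the indicator keeps [f]
   away from the pole. *)
pose f t : R := ((t - E) ^+ 2) `^ (-1) * \1_P t.
have PE t : P t -> `|D.[t]| < c by move=> /negP; rewrite -ltNge.
have far t : - M <= t <= M -> P t -> del / B <= `|t - E|.
  move=> tI /PE tc; rewrite ler_pdivrMr//.
  have Et : D.[t] - d = Q.[t] * (t - E).
    by rewrite -(hornerC d t) -hornerN -hornerD QE hornerM hornerXsubC.
  apply: (@le_trans _ _ `|(t - E) * Q.[t]|); last by rewrite normrM ler_wpM2l// QB.
  rewrite mulrC -Et /del; have := lerB_dist d D.[t]; rewrite distrC; lra.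
have fE t : - M <= t <= M -> P t -> (t - E) ^+ 2 * f t = 1.
  move=> tI Pt; rewrite /f indicE mem_set// mulr1 powR_inv1 ?sqr_ge0// mulfV//.
  rewrite sqrf_eq0 -normr_gt0; apply: lt_le_trans (far t tI Pt); exact: divr_gt0.
have f0 t : ~ P t -> f t = 0 by move=> nP; rewrite /f indicE memNset// mulr0.
have f_ge0 t : 0 <= f t by rewrite mulr_ge0// powR_ge0.
have af : admissible M f.
  split.
    apply: measurable_funM; last by have [] := aind _ mP.
    apply: (measurableT_comp (measurable_powR _)).
    have [+ _] := admissible_horner M (('X - E%:P) ^+ 2).
    by congr measurable_fun; apply/funext => t; rewrite !hornerE.
  exists ((del / B) ^- 2) => t tI; rewrite ger0_norm//.
  have [Pt|nP] := pselect (P t); last by rewrite f0// invr_ge0 sqr_ge0.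
  rewrite -(ler_pM2l (exprn_gt0 2 (divr_gt0 del0 B1))) mulfV ?gt_eqF ?exprn_gt0 ?divr_gt0//.
  rewrite -(fE t tI Pt) ler_wpM2r// -[(t - E) ^+ 2]real_normK ?num_real//.
  by rewrite lerXn2r ?nnegrE ?(ltW (divr_gt0 _ _))// far.
have ahf g : admissible M (fun t => g.[t] * f t).
  by apply: admissibleM => //; exact: admissible_horner.
pose e g := rspec V alpha theta (re_seq phi) (im_seq phi) g - suppint mu M (fun t => g.[t] * f t).
have eD g h : e (g + h) = e g + e h.
  rewrite /e rspecD//.
  have -> : (fun t => (g + h).[t] * f t) = fun t => g.[t] * f t + h.[t] * f t.
    by apply/funext => t; rewrite hornerD mulrDl.
  by rewrite suppintD//; ring.
have eZ a g : e (a *: g) = a * e g.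
  rewrite /e rspecZ//.
  have -> : (fun t => (a *: g).[t] * f t) = fun t => a * (g.[t] * f t).
    by apply/funext => t; rewrite hornerZ mulrA.
  by rewrite suppintZ//; ring.
have eK g : exists K, forall N, `|e (D ^+ N * g)| <= K * c ^+ N.
  have [K HK] := rspec_disc_growth g lx ly.
  have K0 : 0 <= K by have := le_trans (normr_ge0 _) (HK 0%N); rewrite expr0 mulr1.
  have [_ [G0 HG]] := ahf g.
  pose G := `|G0|; have G_ge0 : 0 <= G by exact: normr_ge0.
  exists (K + G * fine (mu `[- M, M]%classic)) => N; apply: le_trans (ler_normB _ _) _.
  rewrite mulrDl lerD//.
    apply: le_trans (HK N) _; rewrite ler_wpM2l// lerXn2r ?nnegrE//; lra.
  have cN : 0 <= c ^+ N by rewrite exprn_ge0//; lra.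
  rewrite mulrAC; apply: ler_norm_suppint => //; first exact: mulr_ge0.
  move=> t tI; have [Pt|nP] := pselect (P t); last by rewrite f0// mulr0 normr0 mulr_ge0.
  rewrite hornerM horner_exp -mulrA normrM mulrC; apply: ler_pM => //.
    by apply: (le_trans (HG t tI)); exact: ler_norm.
  rewrite normrX lerXn2r ?nnegrE//; [lra|exact: ltW (PE _ Pt)].
have e2 g : e (('X - E%:P) * (('X - E%:P) * g)) = 0.
  rewrite /e [X in rspec _ _ _ _ _ (_ * X)]mulrC rspec_mul// -/v reE imE gE.
  rewrite [X in _ - X](@eq_suppint _ mu M _ (fun t => g.[t] * \1_P t)) => [|t tI]; last first.
    rewrite !hornerM hornerXsubC; have [Pt|nP] := pselect (P t).
      rewrite indicE mem_set// mulr1 mulrA -expr2 mulrAC fE// mul1r//.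
    by rewrite f0// indicE memNset// !mulr0.
  rewrite (@eq_suppint _ mu M (horner g) (fun t => g.[t] * \1_P t + g.[t] * \1_P' t)) => [|t tI]; last first.
    by rewrite -mulrDr !indicE /P in_setC; case: (t \in P') => /=; rewrite ?add0r ?addr0 mulr1.
  have a1 := admissible_mulb mP (admissible_horner M g).
  have a2 := admissible_mulb mP' (admissible_horner M g).
  rewrite suppintD// addrAC subrr add0r.
  have [_ [G HG]] := admissible_horner M g.
  have aG b : admissible M (fun t => b * \1_P' t) by apply: admissibleM; [exact: admissible_cst|exact: aind].
  have HG' t : - M <= t <= M -> `|g.[t] * \1_P' t| <= G * \1_P' t.
    move=> tI; rewrite normrM indicE; case: (t \in P'); last by rewrite normr0 !mulr0.
    by rewrite normr1 !mulr1 HG.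
  apply/eqP; rewrite eq_le; apply/andP; split.
    rewrite -(mulr0 G) -null -suppintZ; last exact: aind.
    by apply: ler_suppint => // t tI; apply: le_trans (HG' t tI); exact: ler_norm.
  rewrite -(mulr0 (- G)) -null -suppintZ; last exact: aind.
  apply: ler_suppint => // t tI; rewrite mulNr lerNl; apply: le_trans (HG' t tI).
  by rewrite -normrN; exact: ler_norm.
have [K1 HK1] := eK ('X - E%:P).
have e1 g : e (('X - E%:P) * g) = 0.
  apply: (@growth_functional0 (fun h => e (('X - E%:P) * h)) E c K1) => //.
  - by move=> g1 g2; rewrite mulrDr eD.
  - by move=> a h; rewrite -scalerAr eZ.
  - by move=> N; rewrite mulrC.
have [K0 HK0] := eK 1.
have e0 g : e g = 0.
  by apply: (@growth_functional0 e E c K0) => // N; rewrite -[D ^+ N]mulr1.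
apply: (ac_density ac af) => // g; apply/eqP; rewrite -subr_eq0; apply/eqP; exact: e0.
Qed.

Lemma ac_spectrum_outer E : 2 < `|D.[E]| -> ~ ac_spectrum A E.
Proof.
move=> dE; apply; have [C C0 HC] := resolvent_bound dE.
have bd psi : l2 psi -> ac_subspace A (shift_op A E psi) ->
    l2norm psi <= Num.sqrt C * l2norm (shift_op A E psi).
  move=> lpsi [lS _]; have [lx ly] := (l2P psi).1 lpsi.
  rewrite !l2normE// -sqrtrM// ler_wsqrtr// re_shift_op im_shift_op mulrDr lerD//; exact: HC.
have acS psi : ac_subspace A psi -> ac_subspace A (shift_op A E psi).
  move=> /ac_subspaceP[mu [M ac]]; apply: (ac_opP (h := 'X - E%:P) ac).
    exact: re_shift_op.
  exact: im_shift_op.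
split; last first.
  by exists (Num.sqrt C) => psi ac; apply: bd; [case: ac|exact: acS].
split.
- exact: acS.
- move=> psi1 psi2; rewrite !inE => -[l1 _] [l2 _] e12.
  have [[x1 y1] [x2 y2]] := ((l2P psi1).1 l1, (l2P psi2).1 l2).
  have inj x y : rl2 x -> rl2 y -> opP v ('X - E%:P) x = opP v ('X - E%:P) y -> x = y.
    move=> lx ly exy; have lN := rl2Z (-1) ly; have lz := rl2D lx lN.
    have z0 : opP v ('X - E%:P) (fun n => x n + -1 * y n) = fun=> 0.
      apply/funext => n; rewrite opPXsubC /jac.
      have := congr1 (fun h => h n) exy; rewrite !opPXsubC /jac => h; lra.
    have := HC _ lz; rewrite z0.
    rewrite rip0r mulr0 => h; apply/funext => n.
    have sq m : 0 <= (x m + -1 * y m) * (x m + -1 * y m) by rewrite -expr2 sqr_ge0.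
    have h2 := wsum_le_zseries `|n|%N (rl2_sq lz) sq.
    have h3 := wsum_ub_term sq (leqnn `|n|%N).
    have : (x n + -1 * y n) * (x n + -1 * y n) <= 0 by apply: le_trans h3 (le_trans h2 h).
    by rewrite -expr2 => h4; apply/eqP; rewrite -subr_eq0 -mulN1r -sqrf_eq0 eq_le h4 sqr_ge0.
  rewrite (complex_seqE psi1) (complex_seqE psi2).
  have e1 := congr1 (@re_seq R) e12; have e2 := congr1 (@im_seq R) e12.
  rewrite !re_shift_op in e1; rewrite !im_shift_op in e2.
  by rewrite (inj _ _ x1 x2 e1) (inj _ _ y1 y2 e2).
- move=> psi ac; have [lpsi _] := ac; have [lx ly] := (l2P psi).1 lpsi.
  have [x rx xE] := resolvent_surj dE lx; have [y ry yE] := resolvent_surj dE ly.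
  pose phi : int -> R[i] := fun n => (x n +i* y n)%C.
  have lphi : l2 phi by apply/l2P.
  exists phi; first exact: (resolvent_ac dE ac lphi).
  by rewrite [LHS]complex_seqE [RHS]complex_seqE re_shift_op im_shift_op -/v xE yE.
Qed.

End ACSubspace.

(** * Chambers' formula *)

Section TrigPolynomials.
Variable R : realType.
Implicit Types (f g : R -> R).

Lemma half_turns (m : int) : exists2 s : R, `|s| = 1 &
  forall x : R, cos (x + m%:~R * pi) = s * cos x /\ sin (x + m%:~R * pi) = s * sin x.
Proof.
elim/int_rec: m => [|m [s s1 sE]|m [s s1 sE]].
- by exists 1; rewrite ?normr1// => x; rewrite mul0r addr0 !mul1r.
- exists (- s); rewrite ?normrN// => x.
  have -> : x + m.+1%:~R * pi = x + m%:~R * pi + pi.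
    by rewrite -addn1 PoszD intrD; ring.
  by rewrite cosDpi sinDpi !(sE x).1 !(sE x).2 !mulNr.
exists (- s); rewrite ?normrN// => x.
have -> : x + (- m.+1%:Z)%:~R * pi = x + (- m%:Z)%:~R * pi - pi.
  by rewrite -addn1 PoszD !rmorphN /= intrD; ring.
have [c1 s2] := sE x; have c2 := cosDpi (x + (- m%:Z)%:~R * pi - pi).
have s3 := sinDpi (x + (- m%:Z)%:~R * pi - pi).
rewrite subrK in c2; rewrite subrK in s3.
by rewrite !mulNr -c1 -s2 c2 s3 !opprK.
Qed.

Lemma full_turns (m : int) (x : R) : cos (x + 2 * pi * m%:~R) = cos x.
Proof.
have [s s1 sE] := half_turns m.
have -> : x + 2 * pi * m%:~R = x + m%:~R * pi + m%:~R * pi by ring.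
have s2 : s ^+ 2 = 1 by rewrite -real_normK ?num_real// s1 expr1n.
by rewrite (sE _).1 (sE x).1 mulrA -expr2 s2 mul1r.
Qed.

(** Trigonometric polynomials of degree less than [d]; the phase [tau] takes the place of sine
    terms. *)
Inductive lowtrig (d : nat) : (R -> R) -> Prop :=
| Lowtrig0 : lowtrig d (fun=> 0)
| LowtrigD c k tau f : (k < d)%N -> lowtrig d f ->
    lowtrig d (fun x => c * cos (k%:R * x + tau) + f x).

Lemma lowtrig_eq d f g : lowtrig d f -> f =1 g -> lowtrig d g.
Proof. by move=> lf /funext <-. Qed.

Lemma lowtrigS d f : lowtrig d f -> lowtrig d.+1 f.
Proof. by elim=> [|c k tau g kd _ IH]; constructor => //; exact: ltnW. Qed.

Lemma lowtrig1 d c k tau : (k < d)%N -> lowtrig d (fun x => c * cos (k%:R * x + tau)).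
Proof.
move=> kd; apply: lowtrig_eq (LowtrigD c tau kd (Lowtrig0 d)) _ => x.
by rewrite addr0.
Qed.

Lemma lowtrig_add d f g : lowtrig d f -> lowtrig d g -> lowtrig d (fun x => f x + g x).
Proof.
move=> lf lg; elim: lf => [|c k tau h kd _ IH].
  by apply: lowtrig_eq lg _ => x; rewrite add0r.
by apply: lowtrig_eq (LowtrigD c tau kd IH) _ => x; rewrite addrA.
Qed.

Lemma lowtrigZ d a f : lowtrig d f -> lowtrig d (fun x => a * f x).
Proof.
elim=> [|c k tau h kd _ IH].
  by apply: lowtrig_eq (Lowtrig0 d) _ => x; rewrite mulr0.
by apply: lowtrig_eq (LowtrigD (a * c) tau kd IH) _ => x; rewrite mulrDr mulrA.
Qed.

Lemma cos_mul2 (x y : R) : 2 * cos x * cos y = cos (x + y) + cos (x - y).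
Proof. by rewrite cosB cosD; ring. Qed.

Lemma lowtrig_mulcos d s f : lowtrig d f -> lowtrig d.+1 (fun x => 2 * cos (x + s) * f x).
Proof.
elim=> [|c k tau h kd _ IH].
  by apply: lowtrig_eq (Lowtrig0 _) _ => x; rewrite mulr0.
have l1 : lowtrig d.+1 (fun x => c * cos (k.+1%:R * x + (tau + s))) by exact: lowtrig1.
have l2 : lowtrig d.+1 (fun x => c * cos (k%:R * x + tau - (x + s))).
  (* For [k = 0] the lower frequency [k - 1] would be negative; evenness of the cosine turns it into
     frequency 1. *)
  case: k kd {l1} => [|k] kd.
    apply: lowtrig_eq (@lowtrig1 d.+1 c 1 (s - tau) _) _ => [|x]; first by lia.
    by rewrite -[in RHS]cosN; congr (_ * cos _); ring.
  apply: lowtrig_eq (@lowtrig1 d.+1 c k (tau - s) _) _ => [|x]; first by lia.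
  by congr (_ * cos _); rewrite -[k.+1]addn1 natrD; ring.
apply: lowtrig_eq (lowtrig_add (lowtrig_add l1 l2) IH) _ => x.
have := cos_mul2 (k%:R * x + tau) (x + s).
have -> : k.+1%:R * x + (tau + s) = k%:R * x + tau + (x + s) by rewrite -addn1 natrD; ring.
set u := cos (_ + _ + (_ + _)); set w := cos (_ - _) => uw.
by rewrite -mulrDr -uw; ring.
Qed.

Lemma sin_rational_neq0 (p : int) (q k : nat) : coprime `|p|%N q -> (0 < k < q)%N ->
  sin (k%:R * (pi * p%:~R / q%:R)) != 0 :> R.
Proof.
move=> cpq /andP[k0 kq]; have q0 : (0 < q)%N := leq_trans k0 (ltnW kq).
have qz : q%:Z != 0 by rewrite eqz_nat -lt0n.
pose r := ((k%:Z * p) %% q%:Z)%Z.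
have r0 : 0 <= r by rewrite modz_ge0.
have rq : r < q%:Z by rewrite ltz_pmod.
have rn0 : r != 0.
  apply/negP => /eqP r_0.
  have : (q%:Z %| k%:Z * p)%Z by apply/dvdz_mod0P.
  rewrite dvdzE abszM /= mulnC Gauss_dvdr; last by rewrite coprime_sym.
  by move=> /dvdn_leq; rewrite k0 leqNgt kq => /(_ isT).
have E : k%:R * (pi * p%:~R / q%:R) = pi * (r%:~R / q%:R) + (k%:Z * p %/ q%:Z)%Z%:~R * pi :> R.
  have qR : q%:R != 0 :> R by rewrite pnatr_eq0 -lt0n.
  have H : k%:R * p%:~R = (k%:Z * p %/ q%:Z)%Z%:~R * q%:R + r%:~R :> R.
    have := congr1 (fun n : int => n%:~R : R) (divz_eq (k%:Z * p) q%:Z).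
    by rewrite intrD !intrM.
  have -> : k%:R * (pi * p%:~R / q%:R) = pi * (k%:R * p%:~R) / q%:R :> R by ring.
  by rewrite H; field.
have [s s1 sE] := half_turns (k%:Z * p %/ q%:Z)%Z.
rewrite E (sE _).2 mulf_neq0//; first by rewrite -normr_gt0 s1.
rewrite gt_eqF// sin_gt0_pi//.
have qR : 0 < q%:R :> R by rewrite ltr0n.
have r1 : 0 < r%:~R :> R by rewrite ltr0z lt_neqAle eq_sym rn0.
have r2 : r%:~R < q%:R :> R by rewrite -[q%:R]/(q%:Z%:~R) ltr_int.
by rewrite mulr_gt0 ?pi_gt0 ?divr_gt0//= gtr_pMr ?pi_gt0// ltr_pdivrMr// mul1r.
Qed.

(** Multiplied by [2 sin b] the sum telescopes to a difference of sines whose arguments differ by a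
    multiple of [2 pi]; coprimality ensures that [sin b] is nonzero. *)
Lemma sum_cos_rotations (p : int) (q k : nat) (x : R) : coprime `|p|%N q -> (0 < k < q)%N ->
  \sum_(j < q) cos (k%:R * (j%:R * (2 * pi * p%:~R / q%:R)) + x) = 0.
Proof.
move=> cpq kq; have n0 := sin_rational_neq0 cpq kq.
have q0 : (0 < q)%N by case/andP: kq => k0 kq; exact: leq_trans k0 (ltnW kq).
set b := k%:R * (pi * p%:~R / q%:R) in n0.
pose F j : R := sin (j%:R * (2 * b) - b + x).
have FE j : 2 * sin b * cos (k%:R * (j%:R * (2 * pi * p%:~R / q%:R)) + x) = F j.+1 - F j.
  have -> : k%:R * (j%:R * (2 * pi * p%:~R / q%:R)) + x = j%:R * (2 * b) + x by rewrite /b; ring.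
  rewrite /F.
  have -> : j.+1%:R * (2 * b) - b + x = j%:R * (2 * b) + x + b by rewrite -addn1 natrD; ring.
  have -> : j%:R * (2 * b) - b + x = j%:R * (2 * b) + x - b by ring.
  by rewrite sinB sinD; ring.
have s0 : 2 * sin b != 0 by rewrite mulf_neq0.
apply: (mulfI s0); rewrite mulr0 mulr_sumr (eq_bigr (fun j : 'I_q => F j.+1 - F j)) => [|j _]; last exact: FE.
rewrite -(big_mkord predT (fun j => F j.+1 - F j)) telescope_sumr// /F mul0r.
have -> : q%:R * (2 * b) - b + x = - b + x + 2 * pi * (k%:Z * p)%:~R.
  have qR : q%:R != 0 :> R by rewrite pnatr_eq0 -lt0n.
  by rewrite intrM /b -[k%:Z%:~R]/(k%:R); field.
have [s s1 sE] := half_turns (k%:Z * p).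
have -> : - b + x + 2 * pi * (k%:Z * p)%:~R = - b + x + (k%:Z * p)%:~R * pi + (k%:Z * p)%:~R * pi by ring.
have s2 : s ^+ 2 = 1 by rewrite -real_normK ?num_real// s1 expr1n.
by rewrite (sE _).2 (sE (- b + x)).2 mulrA -expr2 s2 mul1r sub0r addrN.
Qed.

Lemma lowtrig_sum_rotations (p : int) (q : nat) f : coprime `|p|%N q -> lowtrig q f ->
  exists c : R, forall x, \sum_(j < q) f (x + j%:R * (2 * pi * p%:~R / q%:R)) = c.
Proof.
move=> cpq; elim=> [|a k tau g kq _ [c gc]].
  by exists 0 => x; rewrite big1.
have [k0|k0] := posnP k.
  exists (q%:R * (a * cos tau) + c) => x; rewrite big_split /= gc k0.
  by rewrite (eq_bigr (fun=> a * cos tau)) ?sumr_const ?card_ord ?mulr_natl// => j _; rewrite mul0r add0r.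
exists c => x; rewrite big_split /= gc -mulr_sumr.
rewrite (eq_bigr (fun j : 'I_q => cos (k%:R * (j%:R * (2 * pi * p%:~R / q%:R)) + (k%:R * x + tau)))).
  by rewrite sum_cos_rotations ?k0// mulr0 add0r.
by move=> j _; congr cos; ring.
Qed.

Lemma lowtrig_invariant (p : int) (q : nat) f : (0 < q)%N -> coprime `|p|%N q -> lowtrig q f ->
  (forall x, f (x + 2 * pi * p%:~R / q%:R) = f x) -> forall x y, f x = f y.
Proof.
move=> q0 cpq lf fp x y; have [c fc] := lowtrig_sum_rotations cpq lf.
have fj j z : f (z + j%:R * (2 * pi * p%:~R / q%:R)) = f z.
  elim: j => [|j IH]; first by rewrite mul0r addr0.
  by rewrite -IH -[RHS]fp; congr f; rewrite -addn1 natrD; ring.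
have H z : q%:R * f z = c.
  rewrite -(fc z) (eq_bigr (fun=> f z)) => [|j _]; last exact: fj.
  by rewrite sumr_const card_ord mulr_natl.
apply: (mulfI (_ : q%:R != 0)); first by rewrite pnatr_eq0 -lt0n.
by rewrite !H.
Qed.

End TrigPolynomials.

Section Chambers.
Variable R : realType.
Variables (lambda b t : R).
Let w (x : R) : int -> R := fun n => 2 * lambda * cos (x + b * n%:~R).
Let G (n : int) k (x : R) : R := (pd (w x) n k.+1).[t].

Let GSS n k x : G n k.+2 x = (t - 2 * lambda * cos (x + b * (n + k.+2%:Z)%:~R)) * G n k.+1 x - G n k x.
Proof. by rewrite /G pdSS !hornerE. Qed.

Let G0 n x : G n 0 x = 1.
Proof. by rewrite /G pd1 hornerC. Qed.

Let G1 n x : G n 1 x = t - 2 * lambda * cos (x + b * (n + 1)%:~R).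
Proof. by rewrite /G pdSS pd1 pd0 mulr1 subr0 !hornerE. Qed.

Let sg n k : R := \sum_(i < k) b * (n + i.+1%:Z)%:~R.

(** The top harmonic is tracked exactly. Multiplication by [- 2 lambda cos (x + s)] raises the top
    frequency by one, multiplies its amplitude by [- lambda] and adds [s] to its phase; the
    companion frequency lies two lower and joins the remainder. *)
Lemma continuant_trig n k : lowtrig k.+1 (G n k) /\
  lowtrig k.+1 (fun x => G n k.+1 x - 2 * (- lambda) ^+ k.+1 * cos (k.+1%:R * x + sg n k.+1)).
Proof.
elim: k => [|k [IH1 IH2]].
  split.
    apply: lowtrig_eq (@lowtrig1 R 1 1 0 0 isT) _ => x.
    by rewrite G0 mul0r addr0 cos0 mulr1.
  apply: lowtrig_eq (@lowtrig1 R 1 t 0 0 isT) _ => x.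
  by rewrite G1 mul0r addr0 cos0 mulr1 /sg big_ord1 mul1r expr1; ring.
have IH3 : lowtrig k.+2 (G n k.+1).
  have l1 := @lowtrig1 R k.+2 (2 * (- lambda) ^+ k.+1) k.+1 (sg n k.+1) (ltnSn _).
  by apply: lowtrig_eq (lowtrig_add (lowtrigS IH2) l1) _ => x; rewrite subrK.
split=> //; set s := b * (n + k.+2%:Z)%:~R.
have l1 := lowtrigZ t IH3.
have l2 := lowtrigZ (- lambda) (lowtrig_mulcos s IH2).
have l3 := lowtrigZ (-1) (lowtrigS IH1).
have l4 := @lowtrig1 R k.+2 (2 * (- lambda) ^+ k.+2) k (sg n k.+1 - s) (ltnW (ltnSn _)).
apply: lowtrig_eq (lowtrig_add (lowtrig_add l1 l2) (lowtrig_add l3 l4)) _ => x.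
rewrite GSS -/s.
have -> : sg n k.+2 = sg n k.+1 + s by rewrite /sg big_ord_recr.
have -> : k.+2%:R * x + (sg n k.+1 + s) = k.+1%:R * x + sg n k.+1 + (x + s).
  by rewrite -[k.+2]addn1 natrD; ring.
have -> : k%:R * x + (sg n k.+1 - s) = k.+1%:R * x + sg n k.+1 - (x + s).
  by rewrite -[k.+1]addn1 natrD; ring.
have := cos_mul2 (k.+1%:R * x + sg n k.+1) (x + s).
set u := cos (_ + _ + _); set u' := cos (_ - _) => E.
have -> : u' = 2 * cos (k.+1%:R * x + sg n k.+1) * cos (x + s) - u by rewrite E; ring.
by rewrite [(- lambda) ^+ k.+2]exprS; ring.
Qed.

End Chambers.

Section AlmostMathieu.
Variable R : realType.
Variables (lambda : R) (p : int) (q1 : nat).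
Local Notation q := q1.+1.
Hypothesis cpq : coprime `|p|%N q.
Let alpha : R := p%:~R / q%:R.
Let v (theta : R) : int -> R := fun n => amo_potential lambda (alpha * n%:~R + theta).

Let qR : q%:R != 0 :> R. Proof. by rewrite pnatr_eq0. Qed.

Lemma amo_periodic theta m : v theta (m + q%:Z) = v theta m.
Proof.
rewrite /v /amo_potential.
have -> : 2 * pi * (alpha * (m + q)%:~R + theta) = 2 * pi * (alpha * m%:~R + theta) + 2 * pi * p%:~R.
  by rewrite intrD /alpha -[q%:Z%:~R]/(q%:R); field.
by rewrite full_turns.
Qed.

Lemma chambers : exists2 kappa, `|kappa| = `|lambda| ^+ q & forall theta theta0 t,
  (disc (v theta) 0 q).[t] - 2 * kappa * cos (2 * pi * q%:R * theta) =
  (disc (v theta0) 0 q).[t] - 2 * kappa * cos (2 * pi * q%:R * theta0).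
Proof.
pose b : R := 2 * pi * alpha.
pose sg : R := \sum_(i < q) b * (0 + i.+1%:Z)%:~R.
have [s s1 sE] := half_turns R (p * q.+1%:Z).
(* The phases add up to [(2 pi p / q) q (q + 1) / 2], a multiple of [pi], so the phase of the top
   harmonic reduces to the sign [s]. *)
have sgE : sg = (p * q.+1%:Z)%:~R * pi.
  rewrite /sg -mulr_sumr (eq_bigr (fun i : 'I_q => (i.+1%:R : R))) => [|i _]; last by rewrite add0r.
  have H : 2 * \sum_(i < q) (i.+1%:R : R) = q%:R * q.+1%:R.
    elim: (q) => [|k IH]; first by rewrite big_ord0 mulr0 mul0r.
    by rewrite big_ord_recr /= mulrDr IH -[k.+2]addn1 -[k.+1]addn1 !natrD; ring.
  rewrite intrM -[q.+1%:Z%:~R]/(q.+1%:R) /b /alpha.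
  apply: (mulfI (_ : q%:R != 0 :> R)) => //.
  rewrite (_ : _ * (2 * pi * _ * _) = pi * p%:~R * (2 * \sum_(i < q) i.+1%:R)); last by field.
  by rewrite H; ring.
exists ((- lambda) ^+ q * s); first by rewrite normrM s1 mulr1 normrX normrN.
move=> theta theta0 t.
pose w (x : R) : int -> R := fun n => 2 * lambda * cos (x + b * n%:~R).
have vw th : v th = w (2 * pi * th).
  by apply/funext => n; rewrite /v /w /amo_potential /b; congr (_ * cos _); ring.
pose f (x : R) := (disc (w x) 0 q).[t] - 2 * (- lambda) ^+ q * cos (q%:R * x + sg).
have lf : lowtrig q f.
  have [_ l1] := continuant_trig lambda b t 0 q1.
  have l2 : lowtrig q (fun x => (pd (w x) 1 q1).[t]).
    case: (q1) => [|k].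
      by apply: lowtrig_eq (Lowtrig0 _ _) _ => x; rewrite pd0 horner0.
    by have [l2 _] := continuant_trig lambda b t 1 k; exact: lowtrigS.
  apply: lowtrig_eq (lowtrig_add l1 (lowtrigZ (-1) l2)) _ => x.
  by rewrite /f /disc hornerD hornerN add0r; ring.
have wper x m : w x (m + q%:Z) = w x m.
  rewrite /w (_ : x + b * (m + q)%:~R = x + b * m%:~R + 2 * pi * p%:~R) ?full_turns//.
  by rewrite intrD -[q%:Z%:~R]/(q%:R) /b /alpha; field.
(* Rotating [x] by this angle shifts the potential by one site, which does not affect the
   discriminant. *)
have fper x : f (x + 2 * pi * p%:~R / q%:R) = f x.
  rewrite /f; congr (_ - _ * _).
    have -> : w (x + 2 * pi * p%:~R / q%:R) = fun n => w x (n + 1).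
      by apply/funext => n; rewrite /w intrD /b /alpha; congr (_ * cos _); ring.
    rewrite -(disc_base 1 0 (ltn0Sn q1) (wper x)) /disc.
    have sh m k : pd (fun n => w x (n + 1)) m k = pd (w x) (m + 1) k.
      by apply: pd_shift => j; rewrite addrAC.
    by rewrite !sh add0r.
  rewrite (_ : _ + sg = q%:R * x + sg + 2 * pi * p%:~R) ?full_turns//.
  by field.
have fE th : f (2 * pi * th) = (disc (v th) 0 q).[t] - 2 * ((- lambda) ^+ q * s) * cos (2 * pi * q%:R * th).
  rewrite /f vw sgE (sE _).1 (_ : q%:R * (2 * pi * th) = 2 * pi * q%:R * th); last by ring.
  by rewrite !mulrA.
by rewrite -!fE; exact: (lowtrig_invariant (ltn0Sn q1) cpq lf fper).
Qed.

(** At the phase [1 / (4 q)] the cosine in Chambers' formula vanishes, so that [n1] realises the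
    mean discriminant. The phases 0 and [1 / (2 q)] give the values 1 and -1 and force the upper
    bound. *)
Lemma S_minus_bounds : exists n1 : int -> R, [/\ forall m, n1 (m + q%:Z) = n1 m,
  forall t, `|(disc n1 0 q).[t]| < 2 - 2 * `|lambda| ^+ q -> S_minus (amo_potential lambda) alpha t &
  forall t, S_minus (amo_potential lambda) alpha t -> `|(disc n1 0 q).[t]| <= 2 - 2 * `|lambda| ^+ q].
Proof.
have [k kE ch] := chambers; pose th0 : R := (4 * q%:R)^-1.
have c0 : cos (2 * pi * q%:R * th0) = 0.
  rewrite (_ : _ * th0 = pi / 2) ?cos_pihalf// /th0; by field.
exists (v th0); split; first exact: amo_periodic.
- move=> t ht th _; apply: (ac_spectrum_inner (q1 := q1)); first exact: amo_periodic.
  have := ch th th0 t; rewrite c0 mulr0 subr0 => /eqP; rewrite subr_eq => /eqP E.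
  rewrite -/(v th) E; apply: le_lt_trans (ler_normD _ _) _.
  have : `|2 * k * cos (2 * pi * q%:R * th)| <= 2 * `|lambda| ^+ q.
    by rewrite !normrM kE normr_nat ler_piMr ?cos_max// mulr_ge0// exprn_ge0.
  lra.
move=> t St.
have H th : `|(disc (v th) 0 q).[t]| <= 2.
  rewrite leNgt; apply/negP => /(@ac_spectrum_outer R (amo_potential lambda) alpha th q1 (amo_periodic th)).
  by apply; exact: St.
have h1 := H 0; have h2 := H (2 * q%:R)^-1.
have := ch 0 th0 t; have := ch (2 * q%:R)^-1 th0 t; rewrite c0 mulr0 subr0 mulr0 cos0.
rewrite (_ : 2 * pi * q%:R * (2 * q%:R)^-1 = pi); last by field.
rewrite cospi => e1 e2; move: h1 h2; set X1 := _.[t] in e2 *; set X2 := _.[t] in e1 *.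
have kk : `|lambda| ^+ q <= `|k| by rewrite kE.
move: kk e1 e2; rewrite !ler_norml; set X := (disc (v th0) 0 q).[t]; set L := _ ^+ q.
have [k0|k0] := ger0P k => kk e1 e2 /andP[h1 h2] /andP[h3 h4]; apply/andP; split; lra.
Qed.

End AlmostMathieu.

Lemma addr_rearrange (V : nmodType) (a b c d e : V) :
  a + (b + (c + d + e)) = c + (a + d) + (e + b).
Proof. by rewrite [b + _]addrC !addrA [a + c]addrC. Qed.

(** * Upper bound for the capacity *)

Section BoundedBelow.
Context d (T : measurableType d) (R : realType).
Variable mu : probability T R.
Implicit Types (f g : T -> \bar R) (C : R).

Lemma integral_cst_prob (c : \bar R) : (\int[mu]_x c = c)%E.
Proof.
have := integral_cst mu measurableT c; rewrite /cst => ->.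
by have := probability_setT mu; rewrite /= => ->; rewrite mule1.
Qed.

(** The integral may be infinite, so additivity for integrable functions does not suffice; the lower
    bound keeps the negative part finite. *)
Lemma integral_addEFin f C : measurable_fun setT f -> (forall x, - C%:E <= f x)%E ->
  (\int[mu]_x (f x + C%:E) = \int[mu]_x f x + C%:E)%E.
Proof.
move=> mf fC.
have ge0 x : (0 <= f x + C%:E)%E.
  by have := leeD2r C%:E (fC x); rewrite -EFinN -EFinD addNr.
have mC : measurable_fun (setT : set T) (fun=> C%:E) by exact: measurable_cst.
have fD : (fun x => f x) = (fun x => (f x + C%:E) - C%:E)%E.
  by apply/funext => x; rewrite addeK.
have iC (a : R) : mu.-integrable setT (fun=> a%:E).
  exact: finite_measure_integrable_cst.
have [fin|inf] := eqVneq (\int[mu]_x (f x + C%:E))%E +oo%E; last first.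
  have intf : mu.-integrable setT (fun x => f x + C%:E)%E.
    apply/integrableP; split; first exact: emeasurable_funD.
    rewrite (eq_integral (fun x => f x + C%:E)%E) => [|x _]; last by rewrite gee0_abs.
    by rewrite ltey.
  have -> : (\int[mu]_x f x = \int[mu]_x (f x + C%:E - C%:E))%E.
    by apply: eq_integral => x _; rewrite addeK.
  rewrite integralB//.
  by rewrite integral_cst_prob subeK.
rewrite fin; rewrite (_ : (\int[mu]_x f x)%E = +oo%E)//.
rewrite integralE.
have neg : (\int[mu]_x f^\- x <= `|C|%:E)%E.
  rewrite -[leRHS](_ : (\int[mu]_x (cst (`|C|%:E) x) = _)%E); last first.
    by rewrite integral_cst_prob.
  apply: ge0_le_integral => //.
  - exact: measurable_funeneg.
  - move=> x _; rewrite funenegE ge_max lee_fin normr_ge0 andbT leeNl.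
    by apply: le_trans (fC x); rewrite -EFinN lee_fin lerN2 ler_norm.
have inf : (\int[mu]_x (f^\+ x + `|C|%:E) = +oo)%E.
  apply/eqP; rewrite -leye_eq -fin; apply: ge0_le_integral => //.
  - exact: emeasurable_funD.
  - by apply: emeasurable_funD => //; exact: measurable_funepos.
  - move=> x _; apply: leeD; last by rewrite lee_fin ler_norm.
    by rewrite funeposE le_max lexx.
have pos : (\int[mu]_x f^\+ x = +oo)%E.
  move: inf; rewrite ge0_integralD//=; last exact: measurable_funepos.
  by rewrite integral_cst_prob; case: (\int[mu]_x _)%E.
rewrite pos; case: (\int[mu]_x f^\- x)%E neg => // r.
Qed.

(** The slack 1 avoids strictness issues; accumulated over [n] choices it costs [n], negligible
    against the quadratic energy. *)
Lemma exists_le_mean f (c : R) (K : set T) : measurable K -> mu (~` K) = 0%E ->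
  measurable_fun setT f -> (forall x, 0 <= f x)%E ->
  (\int[mu]_x f x <= c%:E)%E -> exists2 x, K x & (f x <= (c + 1)%:E)%E.
Proof.
move=> mK K0 mf f0 fc; apply: contrapT => H.
have lo x : K x -> ((c + 1)%:E <= f x)%E.
  by move=> Kx; rewrite leNgt; apply/negP => /ltW h; apply: H; exists x.
have c0 : 0 <= c by rewrite -lee_fin; apply: le_trans fc; exact: integral_ge0.
have : ((c + 1)%:E <= \int[mu]_x f x)%E.
  have -> : (\int[mu]_x f x = \int[mu]_(x in K) f x)%E.
    have := @ge0_negligible_integral _ _ _ mu setT (~` K) f (measurableC mK) measurableT mf (fun x _ => f0 x) K0.
    by rewrite setTD setCK.
  have K1 : mu K = 1%E by have := probability_setC mu mK; rewrite K0; have := @probability_setC _ _ _ mu (~` K) (measurableC mK); rewrite K0 setCK sube0.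
  rewrite -[leLHS]mule1 -K1 -integral_cst//; apply: ge0_le_integral => //.
  - by move=> x _; rewrite lee_fin addr_ge0.
  - exact: measurable_funTS.
by move=> /le_trans /(_ fc); rewrite lee_fin; lra.
Qed.

End BoundedBelow.

Section FeketeSelection.
Context d (T : measurableType d) (R : realType).
Variable mu : probability T R.
Variables (K : set T) (k : T -> T -> \bar R).
Hypotheses (mK : measurable K) (K0 : mu (~` K) = 0%E).
Hypotheses (mk : measurable_fun setT (fun z : T * T => k z.1 z.2)) (k0 : forall y z, (0 <= k y z)%E).

Fixpoint pair_energy (zs : seq T) : \bar R :=
  if zs is z :: zs' then (pair_energy zs' + \sum_(y <- zs') k y z)%E else 0%E.

Let U y := (\int[mu]_z k y z)%E.
Let W := (\int[mu]_y U y)%E.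

Let U0 y : (0 <= U y)%E. Proof. by apply: integral_ge0 => z _. Qed.

Let mU : measurable_fun setT U.
Proof. by have := @measurable_fun_fubini_tonelli_F _ _ _ _ _ mu _ mk (fun z => k0 z.1 z.2). Qed.

Let mky y : measurable_fun setT (k y).
Proof.
have -> : k y = (fun z : T * T => k z.1 z.2) \o (fun z => (y, z)) by [].
exact: measurableT_comp mk (measurable_pair1 y).
Qed.

(* The mean of the pair energy of [zs] extended by [m] independent points of law
   [mu]; each new point can be chosen so as not to increase it. *)
Let Phi m zs : \bar R := (pair_energy zs + (\sum_(y <- zs) U y) *+ m + W *+ 'C(m, 2))%R.

Let mulrn_ge0E (x : \bar R) m : (0 <= x)%E -> (0 <= (x *+ m)%R)%E.
Proof. by move=> x0; elim: m => [|m IH]; rewrite ?mulr0n// mulrS adde_ge0. Qed.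

Let integral_mulrn (f : T -> \bar R) m : measurable_fun setT f -> (forall x, 0 <= f x)%E ->
  measurable_fun setT (fun x => (f x *+ m)%R) /\
  (\int[mu]_x (f x *+ m)%R = ((\int[mu]_x f x)%E *+ m)%R)%E.
Proof.
move=> mf f0; elim: m => [|m [IH1 IH2]].
  by split; [exact: measurable_cst|rewrite mulr0n integral0].
have E : (fun x => (f x *+ m.+1)%R) = (fun x => f x + (f x *+ m)%R)%E.
  by apply/funext => x; rewrite mulrS.
rewrite E; split; first exact: emeasurable_funD.
by rewrite ge0_integralD// ?IH2 ?mulrS// => x _; exact: mulrn_ge0E.
Qed.

Let pair_energy_ge0 zs : (0 <= pair_energy zs)%E.
Proof. by elim: zs => //= z zs IH; rewrite adde_ge0// sume_ge0. Qed.

Let Phi_ge0 m zs : (0 <= Phi m zs)%E.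
Proof. by rewrite !adde_ge0// mulrn_ge0E// ?sume_ge0//; exact: integral_ge0. Qed.

Let Phi_mean m zs : measurable_fun setT (fun z => Phi m (z :: zs)) /\
  (\int[mu]_z Phi m (z :: zs) = Phi m.+1 zs)%E.
Proof.
have [m1 i1] := integral_mulrn m mU U0.
have s1 : measurable_fun setT (fun z => \sum_(y <- zs) k y z)%E by exact: emeasurable_sum.
have E z : Phi m (z :: zs) = (\sum_(y <- zs) k y z + ((U z *+ m)%R +
    (pair_energy zs + (\sum_(y <- zs) U y) *+ m + W *+ 'C(m, 2))%R))%E.
  rewrite /Phi /= big_cons mulrnDl.
  rewrite [(pair_energy zs + _)%E]addrC -!addrA; congr (_ + _)%R.
  by rewrite addrCA.
have W0 : (0 <= W)%E by exact: integral_ge0.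
have c0 : (0 <= (pair_energy zs + (\sum_(y <- zs) U y) *+ m + W *+ 'C(m, 2))%R)%E.
  by rewrite !adde_ge0// mulrn_ge0E// sume_ge0.
rewrite (funext E); split.
  by apply: emeasurable_funD => //; apply: emeasurable_funD.
rewrite ge0_integralD//; first last.
- by apply: emeasurable_funD.
- by move=> z _; rewrite adde_ge0// mulrn_ge0E.
- by move=> z _; rewrite sume_ge0.
rewrite ge0_integralD//; last by move=> z _; exact: mulrn_ge0E.
rewrite ge0_integral_sum// i1 integral_cst_prob -/W.
rewrite /Phi binS bin1 mulrnDr mulrS.
exact: (addr_rearrange (V := \bar R)).
Qed.

Lemma fekete_points n (w : R) : W = w%:E -> exists zs : seq T, [/\ size zs = n,
  forall z, z \in zs -> K z & (pair_energy zs <= (w *+ 'C(n, 2) + n%:R)%:E)%E].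
Proof.
move=> Ww.
have H j : (j <= n)%N -> exists zs : seq T, [/\ size zs = j, forall z, z \in zs -> K z &
    (Phi (n - j) zs <= (w *+ 'C(n, 2) + j%:R)%:E)%E].
  elim: j => [|j IH] jn.
    exists [::]; split=> //; rewrite subn0 /Phi /= big_nil mul0rn !add0r Ww addr0.
    by rewrite EFin_natmul.
  have [zs [szs Kzs zsE]] := IH (ltnW jn).
  have [mP iP] := Phi_mean (n - j.+1) zs.
  rewrite -subnSK// -iP in zsE.
  have [z Kz zE] := exists_le_mean mK K0 mP (fun z => Phi_ge0 _ _) zsE.
  exists (z :: zs); split; [by rewrite /= szs|by move=> y; rewrite inE => /predU1P[->//|/Kzs]|].
  by rewrite -natr1 addrA.
have [zs [szs Kzs zsE]] := H n (leqnn n).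
exists zs; split=> //; apply: le_trans zsE; rewrite subnn /Phi mulr0n addr0.
by rewrite addr0.
Qed.

End FeketeSelection.

Section Vandermonde.
Variable R : realType.
Implicit Types (s : seq R) (P : nat -> {poly R}).

Fixpoint vprod s : R := if s is x :: s' then (\prod_(y <- s') `|y - x|) * vprod s' else 1.

Lemma vprod_det s : vprod s = `|\det (Vandermonde (size s) (\row_(i < size s) s`_i))|.
Proof.
rewrite det_Vandermonde normr_prod.
rewrite (eq_bigr (fun i : 'I_(size s) => \prod_(j < size s | (i < j)%N) `|s`_j - s`_i|)); last first.
  by move=> i _; rewrite normr_prod; apply: eq_bigr => j _; rewrite !mxE.
elim: s => [|x s IH] /=; first by rewrite big_ord0.
rewrite [RHS]big_ord_recl IH; congr (_ * _).
  by rewrite [RHS]big_mkcond big_ord_recl /= mul1r (big_nth 0) big_mkord.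
by apply: eq_bigr => i _; rewrite [RHS]big_mkcond big_ord_recl /= mul1r -big_mkcond.
Qed.

(** Replacing monomials by monic polynomials multiplies the Vandermonde matrix by a unitriangular
    one, which preserves the determinant; the Leibniz formula then bounds each of the [n!] terms. *)
Lemma vprod_le s P (B : nat -> R) : (forall k, P k \is monic) -> (forall k, size (P k) = k.+1) ->
  (forall k x, x \in s -> `|(P k).[x]| <= B k) ->
  vprod s <= (size s)`!%:R * \prod_(k < size s) B k.
Proof.
move=> mP sP PB; set n := size s; set V := Vandermonde n (\row_(i < n) s`_i).
pose L : 'M[R]_n := \matrix_(i, k) (P i)`_k.
have detL : \det L = 1.
  rewrite det_trig; last by apply/is_trig_mxP => i j ij; rewrite mxE nth_default// sP.
  by rewrite big1// => i _; rewrite mxE; have := monicP (mP i); rewrite lead_coefE sP.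
have -> : vprod s = `|\det (L *m V)| by rewrite det_mulmx detL mul1r vprod_det.
have ME i j : (L *m V) i j = (P i).[s`_j].
  rewrite mxE (horner_coef_wide _ (_ : (size (P i) <= n)%N)) ?sP//.
  by apply: eq_bigr => k _; rewrite !mxE.
rewrite /determinant; apply: le_trans (ler_norm_sum _ _ _) _.
apply: (@le_trans _ _ (\sum_(g : 'S_n) \prod_(k < n) B k)); last first.
  by rewrite sumr_const card_Sn mulr_natl.
apply: ler_sum => g _; rewrite normrM normrX normrN1 expr1n mul1r normr_prod.
apply: ler_prod => i _; rewrite normr_ge0 ME PB//; exact: mem_nth.
Qed.

Section Chebyshev.
Variables (D : {poly R}) (q1 : nat) (c : R).
Local Notation q := q1.+1.
Hypotheses (mD : D \is monic) (sD : size D = q.+1) (c0 : 0 < c).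

(** The pair of indices [m] and [m + 1] of [2 (c/2)^m T_m(D/c)], with [T_m] the Chebyshev
    polynomial. At index 0 this is the constant 2, which [ch] replaces by 1 in order to be monic. *)
Fixpoint cheb2 m : {poly R} * {poly R} :=
  if m is m'.+1 then ((cheb2 m').2, D * (cheb2 m').2 - ((c / 2) ^+ 2)%:P * (cheb2 m').1)
  else (2, D).
Let ch m := if m is 0 then 1 else (cheb2 m).1.

Let chSS m : (cheb2 m.+2).1 = D * (cheb2 m.+1).1 - ((c / 2) ^+ 2)%:P * (cheb2 m).1.
Proof. by []. Qed.

Let ch_monic m : (cheb2 m.+1).1 \is monic /\ size (cheb2 m.+1).1 = (m.+1 * q).+1.
Proof.
have D0 : D != 0 by exact: monic_neq0.
elim/ltn_ind: m => -[|m] IH; first by rewrite mul1n /=.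
have [m1 s1] := IH m (ltnSn _).
have sM : size (D * (cheb2 m.+1).1) = (m.+2 * q).+1.
  by rewrite size_monicM ?monic_neq0// s1 sD; lia.
have sl : (size (((c / 2) ^+ 2)%:P * (cheb2 m).1)%R < (m.+2 * q).+1)%N.
  rewrite mul_polyC; apply: leq_ltn_trans (size_scale_leq _ _) _.
  case: m IH {m1 s1 sM} => [|m] IH; first by rewrite /= -[2]/(2%:R) -polyC_natr (leq_ltn_trans (size_polyC_leq1 _)).
  by have [_ ->] := IH m (ltnW (ltnSn _)); rewrite ltnS ltn_pmul2r.
rewrite chSS; split; last by rewrite size_polyDl ?sM// size_polyN.
rewrite monicE lead_coefDl; last by rewrite size_polyN sM.
by rewrite lead_coefM (monicP mD) (monicP m1) mulr1.
Qed.

Let ch_cos m t phi : D.[t] = c * cos phi ->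
  (cheb2 m).1.[t] = 2 * (c / 2) ^+ m * cos (m%:R * phi).
Proof.
move=> Dt; elim/ltn_ind: m => -[|[|m]] IH.
- by rewrite /= mul0r cos0 expr0 !mulr1 -[2]/(2%:R) -polyC_natr hornerC.
- by rewrite /= Dt mul1r expr1; field.
rewrite chSS hornerD hornerN !hornerM hornerC Dt (IH m.+1)// (IH m (ltnW (ltnSn _)))//.
have := cos_mul2 (m.+1%:R * phi) phi.
have -> : m.+1%:R * phi + phi = m.+2%:R * phi by rewrite -[m.+2]addn1 natrD mulrDl mul1r.
have -> : m.+1%:R * phi - phi = m%:R * phi by rewrite -[m.+1]addn1 natrD; ring.
move=> h; have -> : cos (m%:R * phi) = 2 * cos (m.+1%:R * phi) * cos phi - cos (m.+2%:R * phi).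
  by rewrite h; ring.
by rewrite !exprS; field.
Qed.

(** Degrees that are not multiples of [q] are reached by a factor ['X^(k %% q)]; the constant [A]
    absorbs it together with the factor 2. *)
Lemma chebyshev_family (B : R) : exists P : nat -> {poly R}, exists2 A : R, 1 <= A &
  forall k, [/\ P k \is monic, size (P k) = k.+1 &
    forall t, `|t| <= B -> `|D.[t]| <= c -> `|(P k).[t]| <= A * (c / 2) ^+ (k %/ q)].
Proof.
pose B1 := `|B| + 1; have B11 : 1 <= B1 by rewrite /B1 lerDr.
exists (fun k => 'X^(k %% q) * ch (k %/ q)), (2 * B1 ^+ q).
  have := exprn_ege1 q B11; lra.
move=> k; have chP m : ch m \is monic /\ size (ch m) = (m * q).+1.
  by case: m => [|m]; [rewrite monic1 size_poly1|exact: ch_monic].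
have [m1 s1] := chP (k %/ q)%N; split.
- by rewrite monicMl ?monicXn.
- by rewrite size_monicM ?monicXn ?monic_neq0// s1 size_polyXn addSn /= addnS [in RHS](divn_eq k q) addnC.
move=> t tB Dt; rewrite hornerM hornerXn normrM normrX.
have cc : 0 <= (c / 2) ^+ (k %/ q) by rewrite exprn_ge0// divr_ge0// ltW.
have tB1 : `|t| <= B1 by apply: (le_trans tB); rewrite (le_trans (ler_norm _))// lerDl.
rewrite mulrAC mulrC; apply: ler_pM; rewrite ?exprn_ge0//; last first.
  apply: (@le_trans _ _ (B1 ^+ (k %% q))); first by rewrite lerXn2r ?nnegrE// (le_trans _ B11).
  by rewrite ler_weXn2l// ltnW// ltn_pmod.
have [phi Dphi] : exists phi, D.[t] = c * cos phi.
  exists (acos (D.[t] / c)); rewrite acosK; first by rewrite mulrCA divff ?mulr1// gt_eqF.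
  rewrite in_itv /= -ler_norml normrM normfV (gtr0_norm c0) ler_pdivrMr// mul1r//.
rewrite /ch; case: (k %/ q)%N cc => [|m] cc; first by rewrite hornerC normr1 expr0 mulr1 ler1n.
rewrite (ch_cos _ Dphi) !normrM (ger0_norm cc) normr_nat ler_piMr ?cos_max//.
exact: mulr_ge0.
Qed.

End Chebyshev.
End Vandermonde.

Section LineKernel.
Variable R : realType.
Local Notation plane := (measurableTypeR R * measurableTypeR R)%type.

Lemma measurable_lne : measurable_fun (setT : set (measurableTypeR R)) (fun r : R => lne r%:E).
Proof.
have -> : (fun r : R => lne r%:E) = fun r => if (0 < r)%R then (ln r)%:E else -oo%E.
  apply/funext => r; have [r0|r0] := ltP 0 r; first by rewrite lne_EFin.
  by rewrite le0_lneNy.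
apply: measurable_fun_ifT => //; last first.
  by apply/measurable_EFinP; exact: measurable_ln.
exact: measurable_fun_ltr.
Qed.

Lemma measurable_plane_dist :
  measurable_fun (setT : set (plane * plane)) (fun zw => plane_dist zw.1 zw.2).
Proof.
have mc f : measurable_fun (setT : set (plane * plane)) f ->
    measurable_fun (setT : set (plane * plane)) (fun zw => (f zw : R) ^+ 2).
  by move=> mf; exact: measurable_funX.
apply: (measurableT_comp (f := @Num.sqrt R)).
  by apply: continuous_measurable_fun; exact: sqrt_continuous.
apply: measurable_funD; apply: mc; apply: measurable_funB.
- exact: measurableT_comp measurable_fst measurable_fst.
- exact: measurableT_comp measurable_fst measurable_snd.
- exact: measurableT_comp measurable_snd measurable_fst.
- exact: measurableT_comp measurable_snd measurable_snd.
Qed.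

Lemma measurable_log_kernel : measurable_fun (setT : set (plane * plane))
  (fun zw => - lne (plane_dist zw.1 zw.2)%:E)%E.
Proof.
apply: measurableT_comp => //.
exact: (measurableT_comp measurable_lne measurable_plane_dist).
Qed.

Lemma plane_dist_line (x y : R) : plane_dist (x, 0) (y, 0) = `|x - y|.
Proof. by rewrite /plane_dist /= subrr expr0n addr0 sqrtr_sqr. Qed.

Lemma compact_on_line (K : set (R * R)) (E : set R) : compact K -> K `<=` on_real_line E ->
  measurable (K : set plane) /\ exists B, forall z, K z -> [/\ `|z.1| <= B, z.2 = 0 & E z.1].
Proof.
move=> cK KE.
have KE' z : K z -> z.2 = 0 /\ E z.1 by move=> /KE[x Ex <-].
have cF : compact (fst @` K : set R).
  apply: continuous_compact => //; apply: continuous_subspaceT => z; exact: cvg_fst.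
split.
  have -> : K = (fst @` K) `*` [set 0].
    apply/seteqP; split=> [[x y] Kz|[x y] [/= [z Kz <-] ->]].
      by split => /=; [exists (x, y)|have [] := KE' _ Kz].
    by have [<- _] := KE' _ Kz; rewrite -surjective_pairing.
  apply: measurableX; last exact: measurable_set1.
  by apply: closed_measurable; apply: compact_closed.
have [B [_ HB]] := compact_bounded cF.
exists (`|B| + 1) => z Kz; have [z2 Ez] := KE' _ Kz; split => //.
apply: (HB (`|B| + 1)); last by exists z.
by rewrite (le_lt_trans (ler_norm _))// ltrDl.
Qed.

(** On a bounded support the kernel already exceeds [-C], so the truncation is inactive almost
    everywhere, while the shifted kernel is nonnegative on the whole plane. *)
Lemma truncated_energy (mu : probability plane R) (K : set plane) (C : R) :
  measurable K -> mu (~` K) = 0%E ->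
  (forall z w, K z -> K w -> (- C%:E <= - lne (plane_dist z w)%:E)%E) ->
  (\int[mu]_z \int[mu]_w (maxe (- lne (plane_dist z w)%:E) (- C%:E) + C%:E) = log_energy mu + C%:E)%E.
Proof.
move=> mK K0 HC; set kl := fun z w : plane => (- lne (plane_dist z w)%:E)%E.
pose kC z w := (maxe (kl z w) (- C%:E))%E.
have mkl := measurable_log_kernel.
have mkC : measurable_fun (setT : set (plane * plane)) (fun zw => kC zw.1 zw.2).
  exact: measurable_maxe.
have mkz (f : plane -> plane -> \bar R) z :
    measurable_fun (setT : set (plane * plane)) (fun zw => f zw.1 zw.2) -> measurable_fun setT (f z).
  by move=> mf; exact: (measurableT_comp mf (pair1_measurable z)).
have kC_ge z w : (- C%:E <= kC z w)%E by rewrite le_max lexx orbT.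
have mU : measurable_fun setT (fun z => \int[mu]_w kl z w)%E.
  rewrite (_ : (fun z => _) = fun z => (\int[mu]_w (kl z)^\+ w - \int[mu]_w (kl z)^\- w)%E); last first.
    by apply/funext => z; rewrite integralE.
  have Ep : (fun zw : plane * plane => (kl zw.1)^\+ zw.2)%E = ((fun zw => kl zw.1 zw.2)^\+)%E.
    by apply/funext => zw; rewrite !funeposE.
  have En : (fun zw : plane * plane => (kl zw.1)^\- zw.2)%E = ((fun zw => kl zw.1 zw.2)^\-)%E.
    by apply/funext => zw; rewrite !funenegE.
  apply: emeasurable_funB.
    apply: (measurable_fun_fubini_tonelli_F (fun zw => (kl zw.1)^\+ zw.2)%E) => [|zw].
      by rewrite Ep; apply: measurable_funepos; exact: mkl.
    exact: funepos_ge0.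
  apply: (measurable_fun_fubini_tonelli_F (fun zw => (kl zw.1)^\- zw.2)%E) => [|zw].
    by rewrite En; apply: measurable_funeneg; exact: mkl.
  exact: funeneg_ge0.
have mkCC : measurable_fun (setT : set (plane * plane)) (fun zw => kC zw.1 zw.2 + C%:E)%E.
  exact: emeasurable_funD.
have kCC0 z w : (0 <= kC z w + C%:E)%E.
  by have := leeD2r C%:E (kC_ge z w); rewrite -EFinN -EFinD addNr.
have inner z : (\int[mu]_w (kC z w + C%:E) = \int[mu]_w kC z w + C%:E)%E.
  by apply: integral_addEFin => //; exact: mkz.
have mUC' : measurable_fun setT (fun z => \int[mu]_w (kC z w + C%:E))%E.
  exact: (measurable_fun_fubini_tonelli_F (fun zw => kC zw.1 zw.2 + C%:E)%E).
have mUC : measurable_fun setT (fun z => \int[mu]_w kC z w)%E.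
  rewrite (_ : (fun z => _) = fun z => (\int[mu]_w (kC z w + C%:E) - C%:E)%E).
    exact: emeasurable_funB.
  by apply/funext => z; rewrite inner addeK.
rewrite (eq_integral (fun z => \int[mu]_w kC z w + C%:E)%E) => [|z _]; last by rewrite inner.
have UC_ge z : (- C%:E <= \int[mu]_w kC z w)%E.
  have h : (0 <= \int[mu]_w (kC z w + C%:E))%E by apply: integral_ge0 => w _; exact: kCC0.
  by rewrite inner -leeBlDr// sub0e in h.
rewrite (@integral_addEFin _ _ _ mu (fun z => \int[mu]_w kC z w)%E C mUC UC_ge).
have aeK : {ae mu, forall z, K z}.
  by exists (~` K); split => //; exact: measurableC.
suff -> : (\int[mu]_z \int[mu]_w kC z w)%E = log_energy mu by [].
apply: ae_eq_integral; [exact: measurableT|exact: mUC|exact: mU|].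
apply: (filterS _ aeK) => z Kz _.
apply: ae_eq_integral; [exact: measurableT|exact: (mkz kC z mkC)|exact: (mkz kl z mkl)|].
apply: (filterS _ aeK) => w Kw _; rewrite /kC /Order.max; case: ifP => // h.
by apply/eqP; rewrite eq_le; apply/andP; split; [exact: HC|apply: ltW; exact: h].
Qed.

End LineKernel.

Lemma sum_divn (N q : nat) : (0 < q)%N -> (\sum_(k < N * q) k %/ q = q * 'C(N, 2))%N.
Proof.
move=> q0; elim: N => [|N IH]; first by rewrite mul0n big_ord0 bin0n muln0.
rewrite -(big_mkord predT (fun k => k %/ q)%N) (@big_cat_nat _ _ _ (N * q))//=; last first.
  by rewrite leq_mul2r leqnSn orbT.
rewrite big_mkord IH -{1}[(N * q)%N]add0n big_addn mulSn addnK.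
rewrite (eq_big_nat _ _ (F2 := fun=> N)) => [|k /andP[_ kq]]; last first.
  by rewrite addnC divnMDl// divn_small// addn0.
by rewrite sum_nat_const_nat subn0 binS bin1 mulnDr.
Qed.

Lemma ln_fact_le (R : realType) n : (0 < n)%N -> ln (n`!%:R : R) <= n%:R * ln n%:R.
Proof.
case: n => // n _; elim: n => [|n IH]; first by rewrite (_ : 1`! = 1)%N// mul1r.
rewrite factS natrM lnM ?posrE ?ltr0n ?fact_gt0//.
have -> : n.+2%:R * ln (n.+2%:R : R) = ln n.+2%:R + n.+1%:R * ln n.+2%:R.
  by rewrite -[n.+2 in X in X * _]add1n natrD; ring.
rewrite lerD2l.
apply: le_trans IH _; apply: ler_wpM2l => //.
by rewrite ler_ln ?posrE ?ltr0n// ler_nat.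
Qed.

(* The exponent n = (q M)^2 with M large makes the quadratic term dominate 2 q M >= ln n. *)
Lemma log_growth_absurd (R : realType) (q : nat) (h l G : R) : (0 < q)%N ->
  (forall N, (0 < N)%N -> ((N * q)%:R - 1) / 2 * h - (N * q)%:R / 2 * l <= ln (N * q)%:R + G) -> h <= l.
Proof.
move=> q0 H; rewrite leNgt; apply/negP => lh.
have d0 : 0 < h - l by rewrite subr_gt0.
pose e := 4 + 2 * `|G| + `|h|; pose b := e / (h - l) + 1.
have b1 : 1 <= b.
  by rewrite lerDr divr_ge0 ?(ltW d0)// !addr_ge0// mulr_ge0.
have bd : e < b * (h - l).
  by rewrite /b mulrDl -mulrA mulVf ?gt_eqF// mulr1 mul1r ltrDl.
have [M Mb] : exists M : nat, b < M%:R by exists (Num.bound b); apply: archi_boundP; exact: le_trans b1.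
have M0 : (0 < M)%N by rewrite -(ltr0n R); apply: lt_trans Mb; lra.
have := H (q * M ^ 2)%N; rewrite muln_gt0 q0 expn_gt0 M0 /= => /(_ isT).
have -> : (q * M ^ 2 * q = (q * M) ^ 2)%N by rewrite expnMn; ring.
set x : R := (q * M)%:R; have -> : ((q * M) ^ 2)%:R = x ^+ 2 :> R by rewrite natrX.
have xM : M%:R <= x by rewrite /x natrM ler_peMl// ler1n.
have x0 : 0 < x by apply: lt_le_trans xM; rewrite ltr0n.
have -> : ln (x ^+ 2) = 2 * ln x by rewrite lnXn// mulr_natl.
have lx : ln x <= x by apply: ltW; exact: ln_sublinear.
have xb : b < x := lt_le_trans Mb xM.
have hx := ler_norm h; have Gx := ler_norm G => K.
have G0 := normr_ge0 G; have h0 := normr_ge0 h.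
have e1 : x * (x * (h - l)) <= 4 * x + (2 * `|G| + `|h|) by rewrite mulrA -expr2; lra.
have e2 : x * e <= x * (x * (h - l)).
  apply: ler_wpM2l; first exact: ltW.
  by apply: le_trans (ltW bd) _; apply: ler_wpM2r; exact: ltW.
have x1 : 1 < x by apply: le_lt_trans xb.
have e3 : x * e = 4 * x + x * (2 * `|G| + `|h|) by rewrite /e; ring.
have e4 : 2 * `|G| + `|h| <= x * (2 * `|G| + `|h|) by rewrite ler_peMl ?addr_ge0 ?mulr_ge0// ltW.
have e5 : x * e < x * (x * (h - l)).
  rewrite ltr_pM2l//; apply: lt_trans bd _; rewrite ltr_pM2r//.
lra.
Qed.

(** Logarithms are taken and the quadratic terms in [n] compared. Restricting to multiples of [q]
    makes the sum of the exponents [k %/ q] exactly [q 'C(N, 2)]. *)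
Lemma fekete_limit (R : realType) (q : nat) (A b h : R) : (0 < q)%N -> 0 < A -> 0 < b ->
  (forall N n, (0 < N)%N -> n = (N * q)%N ->
    'C(n, 2)%:R * h - n%:R <= ln (n`!%:R * \prod_(k < n) (A * b ^+ (k %/ q)))) ->
  h <= q%:R^-1 * ln b.
Proof.
move=> q0 A0 b0 main; set l := _ * ln b.
have qR : q%:R != 0 :> R by rewrite pnatr_eq0 -lt0n.
have lE : ln b = q%:R * l by rewrite /l mulVKf.
apply: (@log_growth_absurd R q _ _ (1 + ln A - q%:R / 2 * l)) => // N N0.
have [n nE] : exists n, n = (N * q)%N by exists (N * q)%N.
have nER : n%:R = N%:R * q%:R :> R by rewrite nE natrM.
rewrite -nE; have mn := main N n N0 nE.
have n0 : (0 < n)%N by rewrite nE muln_gt0 N0.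
have nR : 0 < n%:R :> R by rewrite ltr0n.
have pE : \prod_(k < n) (A * b ^+ (k %/ q)) = A ^+ n * b ^+ (q * 'C(N, 2)).
  by rewrite big_split /= prodr_const card_ord prodrXr nE sum_divn.
have lf := ln_fact_le R n0.
have binE m : 'C(m, 2)%:R = m%:R * (m%:R - 1) / 2 :> R.
  elim: m => [|m IH]; first by rewrite bin0n !mul0r.
  by rewrite binS bin1 natrD IH -[m.+1]addn1 natrD; field.
have fn0 : 0 < n`!%:R :> R by rewrite ltr0n fact_gt0.
have lAb : ln (A ^+ n * b ^+ (q * 'C(N, 2))) = n%:R * ln A + n%:R * ((n%:R - q%:R) / 2 * l).
  rewrite lnM ?posrE ?exprn_gt0// !lnXn// -(mulr_natl (ln A)) -(mulr_natl (ln b)); congr (_ + _).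
  rewrite lE natrM binE nER.
  by move: (q%:R) (N%:R) => x y; field.
move: mn; rewrite pE lnM ?posrE//; last by rewrite mulr_gt0 ?exprn_gt0.
rewrite lAb binE => h1; rewrite -(ler_pM2l nR).
apply: (@le_trans _ _ (ln n`!%:R + n%:R * (1 + ln A - q%:R / 2 * l))); last by rewrite [leRHS]mulrDr lerD2r.
move: h1; set F := ln n`!%:R; lra.
Qed.

Section CapacityUpper.
Variable R : realType.
Local Notation plane := (measurableTypeR R * measurableTypeR R)%type.
Variables (D : {poly R}) (q1 : nat) (c : R) (E : set R).
Local Notation q := q1.+1.
Hypotheses (mD : D \is monic) (sD : size D = q.+1) (c0 : 0 < c).
Hypothesis (ED : forall t, E t -> `|D.[t]| <= c).


(** Finiteness of the energy forces the points to be distinct, since coinciding points would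
    contribute [+oo]; sums of logarithms then become the logarithm of a Vandermonde product. *)
Lemma pair_energy_vprod (kk : plane -> plane -> \bar R) (K : set plane) (C : R) (zs : seq plane) :
  (forall y z, 0 <= kk y z)%E ->
  (forall y z, K y -> K z -> kk y z = (- lne `|z.1 - y.1|%:E + C%:E)%E) ->
  (forall z, z \in zs -> K z) -> (pair_energy kk zs < +oo)%E ->
  0 < vprod [seq z.1 | z <- zs] /\
  pair_energy kk zs = ('C(size zs, 2)%:R * C - ln (vprod [seq z.1 | z <- zs]))%:E.
Proof.
move=> k0 kE; elim: zs => [|z zs IH] Kzs.
  by move=> _ /=; rewrite ltr01 ln1 subr0 bin0n /= mul0r.
have Kz : K z by apply: Kzs; rewrite mem_head.
have Kzs' y : y \in zs -> K y by move=> yzs; apply: Kzs; rewrite inE yzs orbT.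
have pe0 : (0 <= pair_energy kk zs)%E by elim: (zs) => //= x xs ?; rewrite adde_ge0// sume_ge0.
have s0 : (0 <= \sum_(y <- zs) kk y z)%E by exact: sume_ge0.
have fin (a b : \bar R) : (0 <= a -> 0 <= b -> a + b < +oo -> a < +oo /\ b < +oo)%E.
  by case: a b => [a||] [b||] //= _ _ _; rewrite !ltry.
have sE : (\sum_(y <- zs) kk y z < +oo)%E -> 0 < \prod_(y <- [seq z0.1 | z0 <- zs]) `|y - z.1| /\
    (\sum_(y <- zs) kk y z)%E = ((size zs)%:R * C - ln (\prod_(y <- [seq z0.1 | z0 <- zs]) `|y - z.1|))%:E.
  elim: zs Kzs' {IH Kzs pe0 s0} => [|y zs IH] Kzs'.
    by rewrite !big_nil ltr01 ln1 mul0r subr0.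
  have Ky : K y by apply: Kzs'; rewrite mem_head.
  rewrite map_cons !big_cons => h.
  have [k1 k2] : (kk y z < +oo /\ \sum_(j <- zs) kk j z < +oo)%E.
    by apply: fin h => //; exact: sume_ge0.
  have [|p0 pE] := IH _ k2.
    by move=> w wzs; apply: Kzs'; rewrite inE wzs orbT.
  have zy : z.1 != y.1.
    apply/eqP => zy; move: k1; rewrite kE// zy subrr normr0 le0_lneNy//=.
  have d0 : 0 < `|z.1 - y.1| by rewrite normr_gt0 subr_eq0.
  have kyz : kk y z = (C - ln `|z.1 - y.1|)%:E by rewrite kE// lne_EFin// EFinB addeC.
  rewrite kyz distrC; split; first exact: mulr_gt0.
  rewrite pE -EFinD lnM ?posrE//= -[(size zs).+1]addn1 natrD; congr EFin; ring.
move=> /(fin _ _ pe0 s0)[h1 h2].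
have [p0 pE] := IH Kzs' h1; have [r0 rE] := sE h2.
split; first exact: mulr_gt0.
rewrite /= pE rE -EFinD lnM ?posrE// binS bin1 natrD; congr EFin; ring.
Qed.

Lemma log_energy_lower (mu : probability plane R) :
  compactly_supported_in (on_real_line E) mu -> ((- (q%:R^-1 * ln (c / 2)))%:E <= log_energy mu)%E.
Proof.
move=> [K [cK KE K0]]; have [mK [B KB]] := compact_on_line cK KE.
pose C := ln (2 * `|B| + 1).
have L0 : 0 < 2 * `|B| + 1 by have := normr_ge0 B; lra.
have line (z w : plane) : K z -> K w -> plane_dist z w = `|z.1 - w.1|.
  move=> /KB[_ z2 _] /KB[_ w2 _]; rewrite -plane_dist_line; congr plane_dist.
    by rewrite [LHS]surjective_pairing z2.
  by rewrite [LHS]surjective_pairing w2.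
have HC z w : K z -> K w -> (- C%:E <= - lne (plane_dist z w)%:E)%E.
  move=> Kz Kw; rewrite leeN2 line//.
  have [zB _ _] := KB _ Kz; have [wB _ _] := KB _ Kw.
  have [d0|d0] := ltP 0 `|z.1 - w.1|; last by rewrite le0_lneNy ?lee_fin// leNye.
  rewrite lne_EFin// lee_fin /C ler_ln ?posrE//.
  have := ler_normB z.1 w.1; have := ler_norm B; lra.
pose kk (z w : plane) : \bar R := (maxe (- lne (plane_dist z w)%:E) (- C%:E) + C%:E)%E.
have kk0 z w : (0 <= kk z w)%E.
  have : (- C%:E <= maxe (- lne (plane_dist z w)%:E) (- C%:E))%E by rewrite le_max lexx orbT.
  by move=> /(leeD2r C%:E); rewrite -EFinN -EFinD addNr.
have mkk : measurable_fun (setT : set (plane * plane)) (fun zw => kk zw.1 zw.2).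
  apply: emeasurable_funD => //; apply: measurable_maxe => //.
  exact: measurable_log_kernel.
have tE := truncated_energy mK K0 HC.
have -> : log_energy mu = (\int[mu]_z \int[mu]_w kk z w - C%:E)%E by rewrite tE addeK.
rewrite leeBrDr//.
have [->|Winf] := eqVneq (\int[mu]_z \int[mu]_w kk z w)%E +oo%E; first by rewrite leey.
have W0 : (0 <= \int[mu]_z \int[mu]_w kk z w)%E.
  by apply: integral_ge0 => z _; exact: integral_ge0.
have [w Ww] : exists w, (\int[mu]_z \int[mu]_w kk z w)%E = w%:E.
  by exists (fine (\int[mu]_z \int[mu]_w kk z w)%E); rewrite fineK// ge0_fin_numE// ltey.
rewrite Ww -EFinD lee_fin.
have kkE y z : K y -> K z -> kk y z = (- lne `|z.1 - y.1|%:E + C%:E)%E.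
  by move=> Ky Kz; rewrite /kk distrC -line// max_l//; exact: HC.
have [P [A A1 PP]] := chebyshev_family mD sD c0 B.
have A0 : 0 < A by lra.
have main N n : (0 < N)%N -> n = (N * q)%N ->
    'C(n, 2)%:R * (C - w) - n%:R <= ln (n`!%:R * \prod_(k < n) (A * (c / 2) ^+ (k %/ q))).
  move=> N0 nE; have [zs [szs Kzs zsE]] := fekete_points mK K0 mkk kk0 n Ww.
  have lt : (pair_energy kk zs < +oo)%E by apply: le_lt_trans zsE _; rewrite ltey.
  have [v0 vE] := pair_energy_vprod kk0 kkE Kzs lt.
  move: zsE; rewrite vE lee_fin szs -(mulr_natr w) => h.
  have vle : vprod [seq z.1 | z <- zs] <= n`!%:R * \prod_(k < n) (A * (c / 2) ^+ (k %/ q)).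
    have sm : size [seq z.1 | z <- zs] = n by rewrite size_map.
    have := @vprod_le R [seq z.1 | z <- zs] P (fun k => A * (c / 2) ^+ (k %/ q)).
    rewrite sm; apply=> [k|k|k _ /mapP[z zzs ->]]; have [P1 P2 P3] := PP k => //.
    by have [? _ ?] := KB _ (Kzs _ zzs); apply: P3 => //; exact: ED.
  have : ln (vprod [seq z.1 | z <- zs]) <= ln (n`!%:R * \prod_(k < n) (A * (c / 2) ^+ (k %/ q))).
    by rewrite ler_ln ?posrE//; exact: lt_le_trans vle.
  lra.
have c2 : 0 < c / 2 by rewrite divr_gt0.
have := fekete_limit (ltn0Sn q1) A0 c2 main.
set l := _ * ln _; move=> h; lra.
Qed.

Lemma capacity_upper : (capacity (on_real_line E) <= ((c / 2) `^ q%:R^-1)%:E)%E.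
Proof.
have c2 : 0 < c / 2 by rewrite divr_gt0.
rewrite /capacity ge_max; apply/andP; split; first by rewrite lee_fin powR_ge0.
apply: ge_ereal_sup => _ [mu smu <-].
have := log_energy_lower smu; rewrite -leeN2 -EFinN opprK => h.
apply: (@le_trans _ _ (expeR (q%:R^-1 * ln (c / 2))%:E)); first by rewrite lee_expeR.
by rewrite /= lee_fin /powR gt_eqF.
Qed.

End CapacityUpper.

(** * Lower bound for the capacity *)

Section LogSine.
Variable R : realType.
Local Notation P := (unitP R).

Lemma affine_lebesgue (a b : R) (B : set R) : a != 0 -> measurable B ->
  lebesgue_measure ((fun s : R => a * s + b) @^-1` B) = (`|a|^-1%:E * lebesgue_measure B)%E.
Proof.
move=> a0 mB.
have mf : measurable_fun (setT : set (measurableTypeR R)) (fun s : R => a * s + b : measurableTypeR R).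
  by apply: measurable_funD => //; exact: measurable_funM.
pose nu : {measure set (measurableTypeR R) -> \bar R} :=
  @measure_function_pushforward__canonical__measure_function_Measure _ _ _ _ R (@lebesgue_measure R) _ mf.
have a1 : 0 <= `|a| by [].
have nuX X : mscale (NngNum a1) nu X =
  (`|a|%:E * lebesgue_measure ((fun s : R => (a * s + b)%R) @^-1` X))%E by [].
have H := @lebesgue_measure_unique R (mscale (NngNum a1) nu) _ B mB.
rewrite H; last first.
  move=> _ [[x y]] _ <-; apply: (eq_trans _ (esym (nuX _))).
  have [a_gt0|a_le0] := ltP 0 a.
    rewrite (_ : _ @^-1` _ = `](x - b) / a, (y - b) / a]%classic); last first.
      apply/seteqP; split => s /=; rewrite !in_itv /= ltr_pdivrMr// ler_pdivlMr// ltrBlDr lerBrDr mulrC//.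
    rewrite !lebesgue_measure_itv /= !lte_fin ltr_pM2r ?invr_gt0// ltrD2r.
    case: ifPn => _; last by rewrite mule0.
    by rewrite -EFinD -EFinM gtr0_norm//; congr EFin; field.
  have {}a_lt0 : a < 0 by rewrite lt_neqAle a0.
  rewrite (_ : _ @^-1` _ = `[(y - b) / a, (x - b) / a[%classic); last first.
    apply/seteqP; split => s /=; rewrite !in_itv /= ler_ndivrMr// ltr_ndivlMr// ltrBlDr lerBrDr [s * a]mulrC andbC//.
  rewrite !lebesgue_measure_itv /= !lte_fin ltr_nM2r ?invr_lt0// ltrD2r.
  case: ifPn => _; last by rewrite mule0.
  by rewrite -EFinD -EFinM ltr0_norm//; congr EFin; field.
rewrite [X in (_ * X)%E]nuX muleA -EFinM mulVf ?mul1e// normr_eq0//.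
Qed.

(** The maps [s / 2] and [1 - s / 2] send the unit interval onto its two halves, and each image law
    has density 2 there. *)
Lemma integral_unit_split (g : R -> \bar R) : measurable_fun setT g -> (forall s, 0 <= g s)%E ->
  (\int[P]_s g (2^-1 * (s : R) + 0)%R + \int[P]_s g (- 2^-1 * (s : R) + 1)%R = \int[P]_s g s + \int[P]_s g s)%E.
Proof.
move=> mg g0.
pose phi (j : nat) (s : R) : R := if j is 0 then 2^-1 * s + 0 else - 2^-1 * s + 1.
have mphi j : measurable_fun (setT : set (measurableTypeR R)) (phi j : R -> measurableTypeR R).
  by case: j => [|j]; apply: measurable_funD => //; exact: measurable_funM.
have [nu [nuE nuI _]] := @mixture_measure _ _ (measurableTypeR R) (measurableTypeR R) R 2 (fun=> P) phi mphi.
have := nuI g mg g0; rewrite !big_ord_recl big_ord0 /= adde0 => <-.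
have h2 : 0 <= 2 :> R by [].
rewrite (@eq_measure_integral _ _ R setT (mscale (NngNum h2) P)) => [|B mB _].
  by rewrite ge0_integral_mscale//= mule_natl mule2n.
apply: (eq_trans (nuE B)); rewrite !big_ord_recl big_ord0 /= adde0.
rewrite -[RHS]/(2%:E * P B)%E.
have i2 : `|2^-1 : R|^-1 = 2 by rewrite gtr0_norm ?invr_gt0// invrK.
have mI (a b : R) : measurable (B `&` `]a, b[ : set (measurableTypeR R)).
  by apply: measurableI => //; exact: measurable_itv.
have sc0 X : measurable (X : set R) ->
    lebesgue_measure ((fun s : R => 2^-1 * s + 0) @^-1` X) = (2%:E * lebesgue_measure X)%E.
  by move=> mX; rewrite affine_lebesgue ?i2// gt_eqF ?invr_gt0.
have sc1 X : measurable (X : set R) ->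
    lebesgue_measure ((fun s : R => - 2^-1 * s + 1) @^-1` X) = (2%:E * lebesgue_measure X)%E.
  by move=> mX; rewrite affine_lebesgue ?normrN ?i2// oppr_eq0 gt_eqF ?invr_gt0.
have -> : P ((fun s : R => 2^-1 * s + 0) @^-1` B) = (2%:E * lebesgue_measure (B `&` `]0%R, 2^-1%R[))%E.
  rewrite unitPE; last by rewrite -[X in measurable X]setTI; exact: (mphi 0).
  rewrite -sc0; last exact: mI.
  congr lebesgue_measure; apply/seteqP; split=> s /=; rewrite !in_itv /= => -[Bs /andP[s1 s2]]; split=> //; apply/andP; split; lra.
have -> : P ((fun s : R => - 2^-1 * s + 1) @^-1` B) = (2%:E * lebesgue_measure (B `&` `]2^-1%R, 1%R[))%E.
  rewrite unitPE; last by rewrite -[X in measurable X]setTI; exact: (mphi 1).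
  rewrite -sc1; last exact: mI.
  congr lebesgue_measure; apply/seteqP; split=> s /=; rewrite !in_itv /= => -[Bs /andP[s1 s2]]; split=> //; apply/andP; split; lra.
rewrite -muleDr//; last by rewrite ge0_adde_def// inE measure_ge0.
congr (_ * _)%E; rewrite unitPE// -measureU; [|exact: mI|exact: mI|]; last first.
  apply/seteqP; split => s //= []; rewrite !in_itv /= => -[_ /andP[_ s1]] [_ /andP[s2 _]]; lra.
apply/eqP; rewrite eq_le; apply/andP; split.
  apply: le_measure; rewrite ?inE; [by apply: measurableU; exact: mI|exact: mI|].
  move=> s /= [] [Bs]; rewrite !in_itv /= => /andP[s1 s2]; split=> //; apply/andP; split; lra.
apply: (@le_trans _ _ (lebesgue_measure ((B `&` `]0%R, 2^-1%R[ `|` B `&` `]2^-1%R, 1%R[) `|` [set 2^-1%R]))).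
  apply: le_measure; rewrite ?inE; [exact: mI|by apply: measurableU => //; apply: measurableU; exact: mI|].
  move=> s /= [Bs]; rewrite !in_itv /= => /andP[s1 s2].
  have [h|h|h] := ltgtP s 2^-1; [by left; left; split=> //; apply/andP|by left; right; split=> //; apply/andP|by right].
have mU : measurable (B `&` `]0%R, 2^-1%R[ `|` B `&` `]2^-1%R, 1%R[ : set (measurableTypeR R)).
  by apply: measurableU; exact: mI.
have := @measureU2 _ _ _ (@lebesgue_measure R) _ [set 2^-1 : R] mU (measurable_set1 _).
move=> /le_trans; apply; rewrite [X in (_ + X <= _)%E](_ : _ = 0%E) ?adde0//.
exact: lebesgue_measure_set1.
Qed.


(** The series counts the dyadic scales above [y], and [ln 2 <= 1]. It makes the logarithmic
    singularity integrable term by term. *)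
Lemma dyadic_series_ge (y : R) : 0 <= y <= 1 ->
  (- lne y%:E <= \sum_(0 <= k <oo) (if (y <= (2^-1) ^+ k)%R then 1 else 0))%E.
Proof.
move=> /andP[y0 y1]; set S := (\sum_(0 <= k <oo) _)%E.
have lo n : y <= 2^-1 ^+ n -> (n.+1%:R%:E <= S)%E.
  move=> yn; apply: le_trans (nneseries_lim_ge n.+1 _) => [|k _ _]; last by case: ifP.
  rewrite big_mkord (eq_bigr (fun=> 1%E)) => [|k _].
    by rewrite sumr_const card_ord EFin_natmul.
  rewrite ifT//; apply: (le_trans yn); apply: ler_wiXn2l; first by rewrite invr_ge0.
    by rewrite invf_le1// ler1n.
  by rewrite -ltnS.
have [y_eq0|yn0] := eqVneq y 0.
  suff -> : S = +oo%E by rewrite leey.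
  apply/eqyP => A A0; apply: le_trans (lo (Num.bound A) _); last by rewrite y_eq0 exprn_ge0// invr_ge0.
  by rewrite lee_fin ltW// (lt_trans (archi_boundP (ltW A0)))// ltr_nat.
have {}y0 : 0 < y by rewrite lt_neqAle eq_sym yn0.
have [n yn] : exists n, 2^-1 ^+ n < y.
  exists (Num.bound y^-1); rewrite exprVn invf_plt ?posrE ?exprn_gt0//.
  apply: (lt_le_trans (archi_boundP (ltW _))); first by rewrite invr_gt0.
  by rewrite -natrX ler_nat ltnW// ltn_expl.
have : exists n, y <= 2^-1 ^+ n /\ 2^-1 ^+ n.+1 < y.
  elim: n yn => [|n IH] yn; first by move: yn; rewrite expr0 ltNge y1.
  have [h|h] := lerP y (2^-1 ^+ n); first by exists n.
  exact: IH.
move=> [m [ym my]]; apply: le_trans (lo m ym).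
rewrite lne_EFin// -EFinN lee_fin -lnV ?posrE//.
apply: (@le_trans _ _ (ln (2 ^+ m.+1))).
  by rewrite ler_ln ?posrE ?invr_gt0 ?exprn_gt0// invf_ple ?posrE ?exprn_gt0// -exprVn ltW.
rewrite lnXn// -(mulr_natl (ln 2)) ler_piMr//.
have := @ln_sublinear R 2; have := @le_ln1Dx R 1; rewrite (_ : 1 + 1 = 2 :> R); last by ring.
by move=> h _; apply: h; lra.
Qed.

Lemma measurable_near_indic (u r : R) :
  measurable_fun (setT : set (measurableTypeR R))
    (fun s : R => if (`|u - s| <= r)%R then 1%E else 0%R : \bar R) /\
  (fun s : R => if (`|u - s| <= r)%R then 1%E else 0%R : \bar R) = EFin \o \1_`[u - r, u + r]%classic.
Proof.
have E : (fun s : R => if (`|u - s| <= r)%R then 1%E else 0%R : \bar R) = EFin \o \1_`[u - r, u + r]%classic.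
  apply/funext => s; rewrite /= indicE.
  have -> : (s \in `[u - r, u + r]%classic) = (`|u - s| <= r).
    by apply/idP/idP; rewrite inE /= in_itv /= ler_norml => /andP[h1 h2]; apply/andP; split; lra.
  by case: ifP.
split=> //; rewrite E; apply/measurable_EFinP; apply: measurable_indic; exact: measurable_itv.
Qed.

Lemma log_distance_integral (u : R) :
  (\int[P]_s (\sum_(0 <= k <oo) (if (`|u - (s : R)| <= (2^-1) ^+ k)%R then 1 else 0)) <= 4%:E)%E.
Proof.
pose f (k : nat) (s : R) : \bar R := (if (`|u - s| <= (2^-1) ^+ k)%R then 1 else 0)%E.
have fE k : f k = EFin \o \1_`[u - 2^-1 ^+ k, u + 2^-1 ^+ k]%classic.
  by rewrite /f (measurable_near_indic u _).2.
have mI k : measurable (`[u - 2^-1 ^+ k, u + 2^-1 ^+ k]%classic : set (measurableTypeR R)).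
  exact: measurable_itv.
rewrite -/(f _ _) integral_nneseries//; first last.
- by move=> k s _; rewrite -/(f k s) fE lee_fin.
- by move=> k; rewrite -/(f k) fE; apply/measurable_EFinP; exact: measurable_indic.
have fi k : (\int[P]_s f k s <= (2 * 2^-1 ^+ k)%:E)%E.
  have -> : (\int[P]_s f k s)%E = P `[u - 2^-1 ^+ k, u + 2^-1 ^+ k]%classic.
    by rewrite fE integral_indic// setIT.
  rewrite unitPE//.
  apply: (@le_trans _ _ (lebesgue_measure `[u - 2^-1 ^+ k, u + 2^-1 ^+ k]%classic)).
    by apply: le_measure; rewrite ?inE//; apply: measurableI => //; exact: measurable_itv.
  rewrite lebesgue_measure_itv /= lte_fin; case: ifPn => _.
    by rewrite -EFinD lee_fin; lra.
  by rewrite lee_fin mulr_ge0// exprn_ge0// invr_ge0.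
apply: lime_le; first by apply: is_cvg_nneseries => k _ _; apply: integral_ge0 => s _; rewrite -/(f k s) fE lee_fin.
apply: nearW => n; apply: (@le_trans _ _ (\sum_(0 <= k < n) (2 * 2^-1 ^+ k)%:E)%E); first by apply: lee_sum => k _; exact: fi.
rewrite sumEFin lee_fin big_mkord -mulr_sumr.
have : 2^-1 * \sum_(i < n) 2^-1 ^+ i = 1 - 2^-1 ^+ n :> R.
  elim: n => [|n IH]; first by rewrite big_ord0 mulr0 expr0 subrr.
  by rewrite big_ord_recr /= mulrDr IH exprS; field.
have : 0 <= 2^-1 ^+ n :> R by rewrite exprn_ge0// invr_ge0.
lra.
Qed.


Definition cheb_potential (x : R) : \bar R := (\int[P]_s (- lne `|x - 2 * cos (pi * (s : R))|%:E))%E.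

Let measurable_cos_pi : measurable_fun (setT : set (measurableTypeR R)) (fun s : R => 2 * cos (pi * s)).
Proof. by apply: continuous_measurable_fun; exact: continuous_cos_pi. Qed.

Lemma measurable_cheb_kernel (x : R) :
  measurable_fun (setT : set (measurableTypeR R)) (fun s : R => - lne `|x - 2 * cos (pi * s)|%:E)%E.
Proof.
apply: measurableT_comp => //.
apply: (measurableT_comp (@measurable_lne R)); apply: measurableT_comp => //.
by apply: measurable_funB.
Qed.

Lemma oppe_lne_ge (y C : R) : 0 < C -> y <= C -> (- (ln C)%:E <= - lne y%:E)%E.
Proof.
move=> C0 yC; rewrite leeN2; have [y0|y0] := ltP 0 y; last by rewrite le0_lneNy ?lee_fin// leNye.
by rewrite lne_EFin// lee_fin ler_ln.
Qed.

Lemma cheb_kernel_ge (x s : R) : `|x| <= 2 -> (- (ln 4)%:E <= - lne `|x - 2 * cos (pi * s)|%:E)%E.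
Proof.
move=> x2; apply: oppe_lne_ge => //; apply: le_trans (ler_normB _ _) _.
have := cos_max (pi * s); rewrite normrM normr_nat; lra.
Qed.

Lemma oppe_lne_anti (a b : R) : 0 <= a -> a <= b -> (- lne b%:E <= - lne a%:E)%E.
Proof.
rewrite leeN2 le_eqVlt => /predU1P[<- _|a0 ab]; first by rewrite le0_lneNy// leNye.
by rewrite !lne_EFin ?lee_fin ?ler_ln ?posrE// (lt_le_trans a0).
Qed.

Lemma lne_norm (b : R) : (lne `|b|%:E = if b == 0%R then -oo else (ln `|b|)%:E)%E.
Proof.
have [->|b0] := eqVneq b 0; first by rewrite normr0 le0_lneNy.
by rewrite lne_EFin ?normr_gt0.
Qed.

Lemma lneN_mul (a b : R) : (- lne `|(a * b)%R|%:E = - lne `|a|%:E - lne `|b|%:E)%E.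
Proof.
rewrite !lne_norm mulf_eq0; have [_|a0] := eqVneq a 0; have [_|b0] := eqVneq b 0 => //=.
by rewrite normrM lnM ?posrE ?normr_gt0// -EFinD opprD.
Qed.

(** As [x^2 - 2 - 2 cos (pi s) = (x - 2 cos (pi s / 2)) (x + 2 cos (pi s / 2))], the kernel splits
    into its values at [s / 2] and [1 - s / 2], which [integral_unit_split] recombines. Adding
    [ln 4] makes it nonnegative for [|x| <= 2]. *)
Lemma cheb_potential_square (x : R) : `|x| <= 2 ->
  (cheb_potential (x ^+ 2 - 2) = cheb_potential x + cheb_potential x)%E.
Proof.
move=> x2; pose g (s : R) := (- lne `|x - 2 * cos (pi * s)|%:E)%E.
have E (s : R) : (- lne `|x ^+ 2 - 2 - 2 * cos (pi * s)|%:E = g (2^-1 * s + 0)%R + g (- 2^-1 * s + 1)%R)%E.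
  rewrite -lneN_mul addr0.
  have -> : pi * (2^-1 * s) = pi * s / 2 by ring.
  have -> : pi * (- 2^-1 * s + 1) = - (pi * s / 2) + pi by ring.
  rewrite cosDpi cosN.
  have -> : pi * s = pi * s / 2 + pi * s / 2 by field.
  rewrite cosD -!expr2 sin2cos2.
  have -> : (pi * s / 2 + pi * s / 2) / 2 = pi * s / 2 by field.
  by congr (- lne `|_|%:E)%E; ring.
have mg : measurable_fun setT (fun s => g s + (ln 4)%:E)%E.
  by apply: emeasurable_funD => //; exact: measurable_cheb_kernel.
have g0 s : (0 <= g s + (ln 4)%:E)%E.
  by have := leeD2r (ln 4)%:E (cheb_kernel_ge s x2); rewrite -EFinN -EFinD addNr.
have ms a b : measurable_fun (setT : set (measurableTypeR R)) (fun s : R => g (a * s + b)).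
  apply: (measurableT_comp (measurable_cheb_kernel x)).
  by apply: measurable_funD => //; exact: measurable_funM.
have sh a b : (\int[P]_s (g (a * (s : R) + b)%R + (ln 4)%:E) = \int[P]_s g (a * (s : R) + b)%R + (ln 4)%:E)%E.
  by apply: integral_addEFin => [|s]; [exact: ms|exact: cheb_kernel_ge].
have split := integral_unit_split mg g0.
have gg : (\int[P]_s (g s + (ln 4)%:E) = cheb_potential x + (ln 4)%:E)%E.
  by apply: integral_addEFin => [|s]; [exact: measurable_cheb_kernel|exact: cheb_kernel_ge].
have E2 : (cheb_potential (x ^+ 2 - 2) + (ln 4 + ln 4)%:E =
    \int[P]_s ((g (2^-1 * (s : R) + 0)%R + (ln 4)%:E) + (g (- 2^-1 * (s : R) + 1)%R + (ln 4)%:E)))%E.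
  have EE (s : R) : ((g (2^-1 * s + 0)%R + (ln 4)%:E) + (g (- 2^-1 * s + 1)%R + (ln 4)%:E) =
      - lne `|x ^+ 2 - 2 - 2 * cos (pi * s)|%:E + (ln 4 + ln 4)%:E)%E.
    by rewrite E EFinD addeACA.
  transitivity (\int[P]_s (- lne `|(x ^+ 2 - 2 - 2 * cos (pi * (s : R)))%R|%:E + (ln 4 + ln 4)%:E))%E.
    symmetry; apply: integral_addEFin => [|s]; first exact: measurable_cheb_kernel.
    rewrite E -EFinN opprD EFinD.
    by apply: leeD; rewrite EFinN; exact: cheb_kernel_ge.
  by apply: eq_integral => s _; rewrite EE.
rewrite ge0_integralD//= in E2; last first.
- by apply: emeasurable_funD => //; exact: ms.
- by apply: emeasurable_funD => //; exact: ms.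
rewrite split gg addeACA -EFinD in E2.
by have := congr1 (fun y => y - (ln 4 + ln 4)%:E)%E E2; rewrite !addeK.
Qed.


Lemma mul_cos_le_sin (y : R) : 0 <= y <= pi / 2 -> y * cos y <= sin y.
Proof.
move=> /andP[y0 y1].
have [c cI E] : exists2 c, c \in `[0, y] & sin y - sin 0 = cos c * (y - 0).
  apply: MVT_segment => //; last by apply: continuous_subspaceT; exact: continuous_sin.
move: E; rewrite sin0 !subr0 => ->; rewrite mulrC ler_wpM2r//.
move: cI; rewrite in_itv /= => /andP[c0 cy].
have pi0 := pi_gt0 R.
by rewrite leNgt; apply/negP => h; move: h; rewrite ltr_cos ?in_itv/=; [lra|apply/andP; split; lra|apply/andP; split; lra].
Qed.

Lemma half_le_sin (x : R) : 0 <= x <= pi / 2 -> x / 2 <= sin x.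
Proof.
move=> /andP[x0 x1]; have pi0 := pi_gt0 R.
have c0 : 0 <= cos x by apply: cos_ge0_pihalf; apply/andP; split; lra.
have ch : 0 <= cos (x / 2) by apply: cos_ge0_pihalf; apply/andP; split; lra.
have h : x / 2 * cos (x / 2) <= sin (x / 2) by apply: mul_cos_le_sin; apply/andP; split; lra.
have E : x = x / 2 + x / 2 by field.
have s2 : sin x = 2 * (sin (x / 2) * cos (x / 2)) by rewrite {1}E sinD; ring.
have c2 : cos x = 2 * cos (x / 2) ^+ 2 - 1 by rewrite {1}E cosD -!expr2 sin2cos2; ring.
have h2 : x / 2 * cos (x / 2) * cos (x / 2) <= sin (x / 2) * cos (x / 2) by apply: ler_wpM2r.
rewrite s2; nra.
Qed.

(** The difference is [4] times a product of two sines, each at least [|u - s| / 2]. The square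
    reflects the quadratic behaviour of the cosine at the ends. *)
Lemma cos_distance (u s : R) : 0 <= u <= 1 -> 0 <= s <= 1 ->
  (u - s) ^+ 2 <= `|2 * cos (pi * u) - 2 * cos (pi * s)|.
Proof.
wlog su : u s / s <= u => [H u01 s01|/andP[u0 u1] /andP[s0 s1]].
  have [su|us] := leP s u; first exact: H.
  by rewrite -sqrrN opprB distrC; apply: H => //; exact: ltW.
have pi2 := @pi_ge2 R.
have sA (y : R) : 0 <= y <= 1 -> y / 2 <= sin (pi * y / 2).
  move=> /andP[y0 y1]; apply: (@le_trans _ _ (pi * y / 2 / 2)).
    by rewrite ler_pM2r// ler_pdivlMr// mulrC; apply: ler_wpM2r.
  apply: half_le_sin; apply/andP; split; first by rewrite divr_ge0// mulr_ge0//; lra.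
  by rewrite ler_pM2r// ler_piMr//; lra.
have h1 : (u - s) / 2 <= sin (pi * (u - s) / 2) by apply: sA; apply/andP; split; lra.
have h2 : (u - s) / 2 <= sin (pi * (u + s) / 2).
  have [us|us] := leP (u + s) 1.
    by apply: le_trans (sA (u + s) _); [lra|apply/andP; split; lra].
  rewrite (_ : pi * (u + s) / 2 = pi - pi * (2 - (u + s)) / 2); last by field.
  rewrite sinB sinpi cospi mul0r mulN1r sub0r opprK.
  by apply: le_trans (sA (2 - (u + s)) _); [lra|apply/andP; split; lra].
have -> : 2 * cos (pi * u) - 2 * cos (pi * s) = - (4 * (sin (pi * (u + s) / 2) * sin (pi * (u - s) / 2))).
  have -> : pi * u = pi * (u + s) / 2 + pi * (u - s) / 2 by field.
  have -> : pi * s = pi * (u + s) / 2 - pi * (u - s) / 2 by field.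
  by rewrite cosD cosB; ring.
have m : (u - s) / 2 * ((u - s) / 2) <= sin (pi * (u + s) / 2) * sin (pi * (u - s) / 2).
  by apply: ler_pM => //; lra.
rewrite normrN ger0_norm; last by rewrite mulr_ge0//; apply: le_trans m; rewrite -expr2 sqr_ge0.
by rewrite expr2; lra.
Qed.

Let cheb_ge (x : R) : `|x| <= 2 -> (- (ln 4)%:E <= cheb_potential x)%E.
Proof.
move=> x2; have h : (0 <= \int[P]_s (- lne `|(x - 2 * cos (pi * (s : R)))%R|%:E + (ln 4)%:E))%E.
  apply: integral_ge0 => s _.
  by have := leeD2r (ln 4)%:E (cheb_kernel_ge s x2); rewrite -EFinN -EFinD addNr.
rewrite integral_addEFin in h; [|exact: measurable_cheb_kernel|by move=> s; exact: cheb_kernel_ge].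
by rewrite -leeBlDr// sub0e in h.
Qed.

Lemma cos2_le (u : R) : `|2 * cos (pi * u)| <= 2.
Proof. by have := cos_max (pi * u); rewrite normrM normr_nat; lra. Qed.

Lemma cheb_potential_bounded : exists M : R, forall u, 0 <= u <= 1 ->
  (cheb_potential (2 * cos (pi * u)) <= M%:E)%E.
Proof.
(* By [cos_distance] the kernel is at most twice [- ln |u - s|], and each copy integrates to at most
   4. *)
exists 8 => u u01; have x2 := cos2_le u.
pose S (s : R) := (\sum_(0 <= k <oo) (if (`|u - s| <= (2^-1) ^+ k)%R then 1 else 0%R : \bar R))%E.
have mS : measurable_fun (setT : set (measurableTypeR R)) S.
  apply: ge0_emeasurable_sum => [k s _ _|k _]; first by case: ifP.
  exact: (measurable_near_indic u _).1.
have S0 s : (0 <= S s)%E by apply: nneseries_ge0 => k _ _; case: ifP.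
have h : (\int[P]_s (- lne `|(2 * cos (pi * u) - 2 * cos (pi * (s : R)))%R|%:E + (ln 4)%:E) <=
    \int[P]_s (S s + S s + (ln 4)%:E))%E.
  apply: ae_ge0_le_integral => //.
  - move=> s _.
    by have := leeD2r (ln 4)%:E (cheb_kernel_ge s x2); rewrite -EFinN -EFinD addNr.
  - by apply: emeasurable_funD => //; exact: measurable_cheb_kernel.
  - by move=> s _; rewrite !adde_ge0// lee_fin ln_ge0// ler1n.
  - by apply: emeasurable_funD => //; exact: emeasurable_funD.
  exists (~` `]0, 1[%classic); split; [exact: measurableC|exact: unitP_itv01|].
  move=> s /= H; rewrite in_itv /= => /andP[s0 s1]; apply: H => _.
  apply: leeD => //; have s01 : 0 <= s <= 1 by rewrite !ltW.
  apply: (@le_trans _ _ (- lne `|(u - s) * (u - s)|%:E)%E).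
    have := cos_distance u01 s01; rewrite -expr2 [`|_ ^+ 2|]ger0_norm ?sqr_ge0// => cd.
    by apply: oppe_lne_anti => //; exact: sqr_ge0.
  rewrite lneN_mul; have d1 : 0 <= `|u - s| <= 1.
    by rewrite normr_ge0 /= ler_norml; move: u01 => /andP[? ?]; apply/andP; split; lra.
  by apply: leeD; exact: dyadic_series_ge.
rewrite integral_addEFin in h; [|exact: measurable_cheb_kernel|by move=> s; exact: cheb_kernel_ge].
move: h; rewrite ge0_integralD//; first last.
- by move=> s _; rewrite lee_fin ln_ge0// ler1n.
- exact: emeasurable_funD.
- by move=> s _; exact: adde_ge0.
rewrite ge0_integralD// integral_cst_prob leeD2rE// => /le_trans; apply.
have := leeD (log_distance_integral u) (log_distance_integral u); rewrite -EFinD (_ : 4 + 4 = 8)//; ring.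
Qed.

(* A positive value would be doubled at each iteration of [x |-> x^2 - 2]. *)
Lemma cheb_potential_le0 (u : R) : (cheb_potential (2 * cos (pi * u)) <= 0)%E.
Proof.
have [M HM] := cheb_potential_bounded.
pose r u := fine (cheb_potential (2 * cos (pi * u))).
(* Doubling the angle leaves [[0, 1]], so the bound is extended to all real [w] through the
   arccosine. *)
have HM' w : (cheb_potential (2 * cos (pi * w)) <= M%:E)%E.
  pose w' := acos (cos (pi * w)) / pi; have pi0 := pi_gt0 R.
  have cI : -1 <= cos (pi * w) <= 1 by rewrite cos_geN1 cos_le1.
  have [/andP[a0 a1] aE] := acos_def cI.
  have -> : cos (pi * w) = cos (pi * w') by rewrite /w' mulrCA divff ?mulr1 ?aE// gt_eqF.
  by apply: HM; rewrite /w' divr_ge0 ?(ltW pi0)//= ler_pdivrMr// mul1r.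
have rE w : cheb_potential (2 * cos (pi * w)) = (r w)%:E.
  rewrite /r fineK// fin_numElt; apply/andP; split.
    by apply: lt_le_trans (cheb_ge (cos2_le w)); rewrite -EFinN ltNyr.
  by apply: le_lt_trans (HM' w) _; rewrite ltry.
have r2 w : r (2 * w) = 2 * r w.
  have := cheb_potential_square (cos2_le w).
  have -> : (2 * cos (pi * w)) ^+ 2 - 2 = 2 * cos (pi * (2 * w)).
    rewrite (_ : pi * (2 * w) = pi * w + pi * w); last by ring.
    by rewrite cosD -!expr2 sin2cos2; ring.
  by rewrite !rE -EFinD => -[->]; ring.
have rk k w : r (2 ^+ k * w) = 2 ^+ k * r w.
  elim: k => [|k IH]; first by rewrite !mul1r.
  by rewrite !exprS -!mulrA r2 IH.
rewrite rE lee_fin leNgt; apply/negP => r0.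
have H k : r u * 2 ^+ k <= M * 1 ^+ k.
  by rewrite expr1n mulr1 mulrC -rk -lee_fin -rE.
have b12 : 0 <= (1 : R) < 2 by apply/andP; split; lra.
exact: (geometric_squeeze r0 b12 H).
Qed.

End LogSine.

Lemma integral_shift d (T : measurableType d) (R : realType) (mu : probability T R)
    (f : T -> \bar R) (C a : R) : measurable_fun setT f -> (forall x, - C%:E <= f x)%E ->
  (\int[mu]_x (f x + a%:E) = \int[mu]_x f x + a%:E)%E.
Proof.
move=> mf fC.
have h1 := integral_addEFin mu mf fC.
have mfa : measurable_fun setT (fun x => f x + a%:E)%E by exact: emeasurable_funD.
have fa x : (- (C - a)%:E <= f x + a%:E)%E.
  by rewrite EFinB oppeB// ; apply: leeD.
have := integral_addEFin mu mfa fa.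
rewrite (eq_integral (fun x => f x + C%:E)%E) => [|x _]; last first.
  by rewrite -addeA -EFinD [(a + _)%R]addrC subrK.
rewrite h1 => E.
have := congr1 (fun y => y - (C - a)%:E)%E E; rewrite addeK// => <-.
by rewrite -addeA -EFinB; congr (_ + _%:E)%E; ring.
Qed.

Lemma sum_lneN (R : realType) (n : nat) (a : nat -> R) (C : R) :
  (\sum_(j < n) (- lne `|a j|%:E + C%:E) = - lne `|(\prod_(j < n) a j)%R|%:E + (n%:R * C)%:E)%E.
Proof.
elim: n => [|n IH]; first by rewrite !big_ord0 normr1 lne1 oppe0 mul0r adde0.
rewrite !big_ord_recr /= IH lneN_mul addeACA -EFinD -[in RHS]natr1 mulrDl mul1r//.
Qed.

Section CapacityLower.
Variable R : realType.
Local Notation P := (unitP R).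
Local Notation plane := (measurableTypeR R * measurableTypeR R)%type.

Lemma uniform_mixture (q1 : nat) (phi : nat -> R -> plane) :
  (forall j, measurable_fun (setT : set (measurableTypeR R)) (phi j : measurableTypeR R -> plane)) ->
  exists nu : probability plane R,
    (forall B, (forall j s, ~ B (phi j s)) -> nu B = 0%E) /\
    forall f : plane -> \bar R, measurable_fun setT f -> (forall z, 0 <= f z)%E ->
      (\int[nu]_z f z = q1.+1%:R^-1%:E * \sum_(j < q1.+1) \int[P]_s f (phi j s))%E.
Proof.
move=> mphi.
have [nu0 [nuE nuI _]] := @mixture_measure _ _ (measurableTypeR R) plane R q1.+1 (fun=> P) phi mphi.
have nuT : nu0 setT = q1.+1%:R%:E.
  rewrite nuE (eq_bigr (fun=> 1%E)) => [|j _]; last by rewrite preimage_setT; exact: probability_setT.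
  by rewrite sumr_const card_ord EFin_natmul.
pose nu : probability plane R := mnormalize nu0 (dirac (point : plane)).
have q0 : 0 <= q1.+1%:R^-1 :> R by rewrite invr_ge0.
have nuX B : nu B = (nu0 B * q1.+1%:R^-1%:E)%E.
  have H (ev : \bar R) (g : set plane -> \bar R) : ev = q1.+1%:R%:E ->
    (if (ev == 0%E) || (ev == +oo%E) then g else fun U => (nu0 U * (fine ev)^-1%:E)%E) B =
    (nu0 B * q1.+1%:R^-1%:E)%E.
    by move=> ->; rewrite ifF//; apply/negbTE; rewrite negb_or eqe pnatr_eq0.
  exact: (H _ _ nuT).
exists nu; split => [B HB|f mf f0].
  rewrite nuX nuE big1 ?mul0e// => j _.
  by rewrite (_ : _ @^-1` _ = set0) ?measure0//; apply/seteqP; split => // s /= /HB.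
rewrite -nuI// -(ge0_integral_mscale nu0 measurableT (NngNum q0) mf)//.
by apply: eq_measure_integral => B mB _; apply: (eq_trans (nuX B)); rewrite muleC.
Qed.

Variables (D : {poly R}) (q1 : nat) (z : nat -> R).
Local Notation q := q1.+1.
Hypotheses (mD : D \is monic) (sD : size D = q.+1) (Dz : alternating 2 D q z).

(** For [a] in the support with [D(a) = c cos (pi u)], summing the kernel over the [q] preimages of
    [c cos (pi s)] gives [- ln |D(a) - c cos (pi s)|], that is [- ln (c/2)] plus the arcsine kernel,
    whose integral is at most 0. Strictness of [c < 2] keeps all levels where the inverse branches
    exist. *)
Lemma equilibrium_energy (c : R) : 0 < c < 2 -> exists nu : probability plane R,
  compactly_supported_in (on_real_line [set t | `|D.[t]| <= c]) nu /\
  (log_energy nu <= (- (q%:R^-1 * ln (c / 2)))%:E)%E.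
Proof.
move=> /andP[c0 c2]; have [t tP] := band_rootsP mD sD Dz.
pose x (s : R) : R := c * cos (pi * s).
have xc s : `|x s| <= c by rewrite /x normrM (gtr0_norm c0) ger_pMr// cos_max.
have x2 s : `|x s| < 2 by apply: le_lt_trans (xc s) c2.
pose J j := minn j q1; have Jq j : (J j < q)%N by rewrite ltnS geq_minr.
have JE j : (j < q)%N -> J j = j by rewrite ltnS => /minn_idPl.
pose phi j (s : R) : plane := (t (J j) (x s), 0).
have mt j : measurable_fun (setT : set (measurableTypeR R)) (fun s : R => t (J j) (x s)).
  apply: continuous_measurable_fun => s.
  apply: (@continuous_comp _ _ _ x (t (J j))); first exact: continuous_cos_pi.
  exact: (band_continuous mD sD Dz tP).
have mphi j : measurable_fun (setT : set (measurableTypeR R)) (phi j : measurableTypeR R -> plane).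
  by apply: measurable_fun_pair; [exact: mt|exact: measurable_cst].
have [nu [nu0 nuI]] := uniform_mixture q1 mphi.
pose E0 : set R := `[z 0, z q]%classic `&` [set y | `|D.[y]| <= c].
pose K : set (R * R) := E0 `*` [set 0].
have cE0 : compact E0.
  apply: (subclosed_compact _ (@segment_compact _ (z 0) (z q))); last by move=> y [].
  apply: closedI; first exact: interval_closed.
  rewrite (_ : [set y | _] = (fun y => `|D.[y]|) @^-1` [set r | r <= c])//.
  apply: closed_comp; last exact: closed_le.
  move=> y _; apply: continuous_comp; last exact: norm_continuous.
  exact: continuous_horner.
have cK : compact K by apply: compact_setX => //; exact: compact_set1.
have phiE0 j s : E0 (t (J j) (x s)).
  have [tx _] := tP _ (x2 s); have /andP[h1 h2] := tx _ (Jq j).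
  have [zi _] := Dz; split; last by rewrite /= (band_root tP)//.
  rewrite /= in_itv /=; apply/andP; split.
    by apply: le_trans (ltW h1); apply: (incr_chainW zi); rewrite leq0n ltnW.
  by apply: le_trans (ltW h2) _; apply: (incr_chainW zi); rewrite Jq leqnn.
have Kphi j s : K (phi j s) by split => //=; exact: phiE0.
have K0 : nu (~` K) = 0%E by apply: nu0 => j s; apply.
have KE : K `<=` on_real_line [set y | `|D.[y]| <= c].
  by move=> [a b] [/= [_ Da] ->]; exists a.
exists nu; split; first by exists K.
have [mK _] := compact_on_line cK KE.
have zz : 0 < z q - z 0 + 1.
  by have [zi _] := Dz; have := incr_chainW zi (i := 0) (j := q); rewrite leqnn /= => /(_ isT); lra.
pose C := ln (z q - z 0 + 1).
have Kdist (a b : plane) : K a -> K b -> plane_dist a b = `|a.1 - b.1|.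
  by move: a b => [a1 a2] [b1 b2] [_ /= ->] [_ /= ->]; exact: plane_dist_line.
have HC a b : K a -> K b -> (- C%:E <= - lne (plane_dist a b)%:E)%E.
  move=> Ka Kb; rewrite Kdist//; apply: oppe_lne_ge => //.
  have E0b (y : plane) : K y -> z 0 <= y.1 <= z q by move=> [[h _] _]; move: h; rewrite /= in_itv.
  have /andP[h1 h2] := E0b a Ka; have /andP[h3 h4] := E0b b Kb.
  by rewrite ler_norml; apply/andP; split; lra.
pose kk (a b : plane) : \bar R := (maxe (- lne (plane_dist a b)%:E) (- C%:E) + C%:E)%E.
have kk0 a b : (0 <= kk a b)%E.
  have : (- C%:E <= maxe (- lne (plane_dist a b)%:E) (- C%:E))%E by rewrite le_max lexx orbT.
  by move=> /(leeD2r C%:E); rewrite -EFinN -EFinD addNr.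
have mkk : measurable_fun (setT : set (plane * plane)) (fun ab => kk ab.1 ab.2).
  apply: emeasurable_funD => //; apply: measurable_maxe => //.
  exact: measurable_log_kernel.
have tE := truncated_energy mK K0 HC.
have mkk1 a : measurable_fun setT (kk a) by exact: (measurableT_comp mkk (pair1_measurable a)).
have mU : measurable_fun setT (fun a => \int[nu]_b kk a b)%E.
  exact: (measurable_fun_fubini_tonelli_F (fun ab => kk ab.1 ab.2)).
have U0 a : (0 <= \int[nu]_b kk a b)%E by apply: integral_ge0.
have qR : 0 < q%:R :> R by rewrite ltr0n.
have iq : (0 <= q%:R^-1%:E :> \bar R)%E by rewrite lee_fin invr_ge0 ltW.
have inner a : K a -> (\int[nu]_b kk a b <= (- (q%:R^-1 * ln (c / 2)) + C)%:E)%E.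
  move=> Ka; rewrite nuI//.
  have -> : (- (q%:R^-1 * ln (c / 2)) + C)%:E = (q%:R^-1%:E * (- ln (c / 2) + q%:R * C)%:E)%E.
    by rewrite -EFinM mulrDr mulrA mulVf ?mul1r ?mulrN// gt_eqF.
  apply: lee_wpmul2l => //; rewrite -ge0_integral_sum//; last first.
    by move=> j; exact: (measurableT_comp (mkk1 a) (mphi j)).
  have Da : `|D.[a.1]| <= c by case: Ka => -[].
  pose u := acos (D.[a.1] / c) / pi.
  have Du : D.[a.1] = c * cos (pi * u).
    rewrite /u mulrCA divff ?mulr1 ?gt_eqF ?pi_gt0// acosK; first by rewrite mulrCA divff ?mulr1// gt_eqF.
    by rewrite in_itv /= -ler_norml normrM normfV (gtr0_norm c0) ler_pdivrMr// mul1r.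
  have c20 : 0 < c / 2 by rewrite divr_gt0.
  have kE s : (\sum_(j < q) kk a (phi j s) =
      - lne `|2 * cos (pi * u) - 2 * cos (pi * s)|%:E + (- ln (c / 2) + q%:R * C)%:E)%E.
    rewrite (eq_bigr (fun j : 'I_q => - lne `|a.1 - t j (x s)|%:E + C%:E)%E) => [|j _]; last first.
      by rewrite /kk max_l ?HC// Kdist//= JE.
    rewrite (@sum_lneN R q (fun j => a.1 - t j (x s)) C) -(band_horner tP)// Du /x.
    have -> : c * cos (pi * u) - c * cos (pi * s) = c / 2 * (2 * cos (pi * u) - 2 * cos (pi * s)) by field.
    rewrite lneN_mul (gtr0_norm c20) lne_EFin// -EFinN EFinD addeA; congr (_ + _)%E.
    by rewrite addeC.
  have -> : (\int[P]_s (\sum_(j < q) kk a (phi j s)) =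
      \int[P]_s (- lne `|(2 * cos (pi * u) - 2 * cos (pi * (s : R)))%R|%:E + (- ln (c / 2) + q%:R * C)%:E))%E.
    by apply: eq_integral => s _; exact: kE.
  rewrite (@integral_shift _ _ _ _ _ (ln 4)); first by rewrite -[leRHS]add0e leeD2r// cheb_potential_le0.
    exact: measurable_cheb_kernel.
  by move=> s; exact: cheb_kernel_ge (cos2_le u).
have : (\int[nu]_a \int[nu]_b kk a b <= (- (q%:R^-1 * ln (c / 2)) + C)%:E)%E.
  rewrite nuI//; set e := (_ + C)%:E.
  apply: (@le_trans _ _ (q%:R^-1%:E * \sum_(j < q) e)%E).
    apply: lee_wpmul2l => //; apply: lee_sum => j _.
    rewrite -[leRHS](integral_cst_prob P); apply: ge0_le_integral => //.
    - exact: (measurableT_comp mU (mphi j)).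
    - by move=> s _; exact: inner.
  by rewrite /e sumEFin -EFinM lee_fin sumr_const card_ord -[X in _ * X]mulr_natl mulrA mulVf ?mul1r// gt_eqF.
have -> : (\int[nu]_a \int[nu]_b kk a b = log_energy nu + C%:E)%E by exact: tE.
by rewrite EFinD leeD2rE.
Qed.

Lemma capacity_lower (c : R) (E : set R) : 0 < c <= 2 ->
  (forall t, `|D.[t]| < c -> E t) -> (((c / 2) `^ q%:R^-1)%:E <= capacity (on_real_line E))%E.
Proof.
move=> /andP[c0 c2] DE.
have H c' : 0 < c' < c -> (((c' / 2) `^ q%:R^-1)%:E <= capacity (on_real_line E))%E.
  move=> /andP[c'0 c'c]; have [|nu [[K [cK KE K0]] en]] := @equilibrium_energy c'.
    by rewrite c'0; apply: lt_le_trans c2.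
  rewrite /capacity le_max; apply/orP; right.
  apply: (@le_trans _ _ (expeR (- log_energy nu))); last first.
    apply: ereal_sup_ubound; exists nu => //; exists K; split => //.
    by move=> y /KE[t tc <-]; exists t => //; apply: DE; apply: le_lt_trans c'c.
  apply: (@le_trans _ _ (expeR (q%:R^-1 * ln (c' / 2))%:E)).
    by rewrite /= lee_fin /powR gt_eqF ?divr_gt0.
  by rewrite lee_expeR leeNr -EFinN.
have : (0 <= capacity (on_real_line E))%E by rewrite /capacity le_max lexx.
have qR : q%:R != 0 :> R by rewrite pnatr_eq0.
have pq (y : R) : 0 <= y -> (y `^ q%:R^-1) ^+ q = y.
  by move=> y0; rewrite -powR_mulrn ?powR_ge0// -powRrM mulVf// powRr1.
case: (capacity _) H => [r||] H //; last by move=> _; rewrite leey.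
rewrite !lee_fin => r0; rewrite leNgt; apply/negP => rc.
have rq : r ^+ q < c / 2.
  by rewrite -[ltRHS]pq ?divr_ge0 ?(ltW c0)// ltrXn2r// nnegrE ?powR_ge0.
have rq0 : 0 <= r ^+ q by rewrite exprn_ge0.
(* Half of this level is the midpoint of [r^q] and [c / 2], so the level is below [c] and its
   capacity bound exceeds [r]. *)
have := H (r ^+ q + c / 2); rewrite lee_fin => h.
have : ((r ^+ q + c / 2) / 2) `^ q%:R^-1 <= r by apply: h; apply/andP; split; lra.
move=> h2; have : (r ^+ q + c / 2) / 2 <= r ^+ q.
  by rewrite -[leLHS]pq; [rewrite lerXn2r// nnegrE powR_ge0|rewrite divr_ge0// addr_ge0// divr_ge0// ltW].
lra.
Qed.

End CapacityLower.

(** * The almost Mathieu operator *)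

Section Assembly.
Variable R : realType.

Lemma capacity_S_minus (lambda : R) (p : int) (q : nat) :
  0 < `|lambda| < 1 -> (0 < q)%N -> coprime `|p|%N q ->
  capacity (on_real_line (S_minus (amo_potential lambda) (p%:~R / q%:R))) =
    ((1 - `|lambda| ^+ q) `^ (q%:R^-1))%:E.
Proof.
move=> /andP[l0 l1]; case: q => // q1 _ cpq.
have [w [_ lo up]] := S_minus_bounds lambda cpq.
have [mD sD] := disc_monic_size w 0 (ltn0Sn q1).
have [z [Dz _]] := disc_alternating w 0 (ltn0Sn q1).
have lq1 : `|lambda| ^+ q1.+1 < 1 by rewrite exprn_ilt1.
have lq0 : 0 < `|lambda| ^+ q1.+1 by rewrite exprn_gt0.
set c := 2 - 2 * `|lambda| ^+ q1.+1 in lo up.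
have -> : 1 - `|lambda| ^+ q1.+1 = c / 2 by rewrite /c; field.
have c0 : 0 < c by rewrite /c; lra.
apply/eqP; rewrite eq_le; apply/andP; split; first exact: (capacity_upper mD sD c0 up).
by apply: (capacity_lower mD sD Dz) lo; rewrite c0 /c /=; lra.
Qed.

(** Modulo integers the difference is a fraction with denominator [b n] and, as [u n] differs from
    [x] in the torus, nonzero numerator; its size is at least [1 / b n], so small differences force
    large denominators. *)
Lemma torus_cvg_denominators (x : R) (u : nat -> R) (a : nat -> int) (b : nat -> nat) :
  torus_cvg u x -> (\forall n \near \oo, ~ torus_eq (u n) x) -> (forall n, (0 < b n)%N) ->
  (forall n, torus_eq (x - u n) ((a n)%:~R / (b n)%:R)) ->
  forall C : R, \forall n \near \oo, C < (b n)%:R.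
Proof.
move=> ux unx b0 ab C.
pose e := (`|C| + 1)^-1; have e0 : 0 < e by rewrite invr_gt0 ltr_wpDl.
near=> n.
have [m mE] : exists m : int, `|u n - x - m%:~R| < e by near: n; exact: ux.
have nx : ~ torus_eq (u n) x by near: n; exact: unx.
have [m' m'E] := ab n.
have bn : 0 < (b n)%:R :> R by rewrite ltr0n.
have E : u n - x - m%:~R = - ((a n + (m + m') * b n)%:~R / (b n)%:R).
  have -> : u n - x = - (m'%:~R + (a n)%:~R / (b n)%:R) by rewrite -m'E; ring.
  by rewrite intrD intrM intrD -[(b n)%:Z%:~R]/((b n)%:R); field; rewrite gt_eqF.
have k0 : a n + (m + m') * b n != 0.
  apply/eqP => k0; apply: nx; exists m; apply/eqP; rewrite -subr_eq0 E k0.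
  by rewrite mul0r oppr0.
have k1 : 1 <= `|(a n + (m + m') * b n)%:~R| :> R.
  by rewrite -intr_norm -[1]/(1%:~R) ler_int -gtz0_ge1 normr_gt0.
move: mE; rewrite E normrN normrM normfV (gtr0_norm bn) ltr_pdivrMr// => h.
have : 1 < e * (b n)%:R := le_lt_trans k1 h.
rewrite /e mulrC ltr_pdivlMr ?mul1r; last by rewrite ltr_wpDl.
by apply: le_lt_trans; apply: le_trans (ler_norm C) _; rewrite lerDl.
Unshelve. all: by end_near. Qed.

Lemma root_lower (b : R) (k : nat) : 0 < b <= 1 -> (0 < k)%N ->
  1 + ln b / k%:R <= b `^ (k%:R^-1) <= 1.
Proof.
move=> /andP[b0 b1] k0; rewrite /powR gt_eqF// mulrC; apply/andP; split; first exact: expR_ge1Dx.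
by rewrite -expR0 ler_expR mulr_ge0_le0 ?invr_ge0// ln_le0.
Qed.

End Assembly.

Theorem mainTheorem8 (R : realType) (lambda : R)
  (p : int) (q : nat) (pn : nat -> int) (qn : nat -> nat)
  (pt : nat -> int) (qt : nat -> nat)
  (hlambda : 0 < `|lambda| < 1)
  (hq : (0 < q)%N) (hpq : coprime `|p|%N q)
  (hqn : forall n, (0 < qn n)%N)
  (hcvg : torus_cvg (fun n => (pn n)%:~R / (qn n)%:R) (p%:~R / q%:R : R))
  (hneq : \forall n \near \oo,
     ~ torus_eq ((pn n)%:~R / (qn n)%:R) (p%:~R / q%:R : R))
  (hqt : forall n, (0 < qt n)%N)
  (hpqt : forall n, coprime `|pt n|%N (qt n))
  (hpt : forall n, torus_eq (p%:~R / q%:R - (pn n)%:~R / (qn n)%:R)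
                            ((pt n)%:~R / (qt n)%:R : R)) :
  [/\ capacity (on_real_line
        (S_minus (amo_potential lambda) ((pt n)%:~R / (qt n)%:R)))
        @[n --> \oo] --> (1 : \bar R)%E,
      (1 : R) <> (1 - `|lambda| ^+ q) `^ (q%:R^-1)
    & ((1 - `|lambda| ^+ q) `^ (q%:R^-1))%:E
        = capacity (on_real_line
            (S_minus (amo_potential lambda) (p%:~R / q%:R)))].
Proof.
have /andP[l0 l1] := hlambda.
split; last by rewrite capacity_S_minus.
- rewrite (_ : (fun n => _) = fun n => ((1 - `|lambda| ^+ qt n) `^ ((qt n)%:R^-1))%:E); last first.
    by apply/funext => n; rewrite capacity_S_minus.
  apply: cvg_EFin; first exact: nearW.
  apply/cvgrPdist_lt => e e0.
  have b0 : 0 < 1 - `|lambda| by lra.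
  have b1 : 1 - `|lambda| <= 1 by lra.
  (* Since [|lambda|^(qt n) <= |lambda|], the base can be replaced by the fixed number
     [1 - |lambda|]; a denominator above [C] brings its root within [e] of 1, by
     [exp y >= 1 + y]. *)
  pose C := - ln (1 - `|lambda|) / e; near=> n.
  have qC : C < (qt n)%:R by near: n; exact: (torus_cvg_denominators hcvg hneq hqt hpt).
  have qn0 : 0 < (qt n)%:R :> R by rewrite ltr0n.
  have lq : `|lambda| ^+ qt n <= `|lambda|.
    by rewrite -[leRHS]expr1 ler_wiXn2l// ltW.
  have lq0 : 0 <= `|lambda| ^+ qt n by rewrite exprn_ge0.
  have /andP[h1 _] := root_lower (introT andP (conj b0 b1)) (hqt n).
  have h2 : (1 - `|lambda|) `^ (qt n)%:R^-1 <= (1 - `|lambda| ^+ qt n) `^ (qt n)%:R^-1.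
    by rewrite ge0_ler_powR ?invr_ge0 ?nnegrE//; lra.
  have /andP[_ h3] : 1 + ln (1 - `|lambda| ^+ qt n) / (qt n)%:R <=
      (1 - `|lambda| ^+ qt n) `^ (qt n)%:R^-1 <= 1.
    by apply: root_lower => //; apply/andP; split; lra.
  rewrite /= ger0_norm ?subr_ge0//.
  have : - ln (1 - `|lambda|) / (qt n)%:R < e.
    by rewrite ltr_pdivrMr// mulrC -ltr_pdivrMr.
  by rewrite mulNr; lra.
- move=> h; have lq0 : 0 < `|lambda| ^+ q by rewrite exprn_gt0.
  have lq1 : `|lambda| ^+ q < 1 by rewrite exprn_ilt1// -lt0n.
  have := congr1 (fun y => y `^ q%:R) h.
  rewrite powR1 -powRrM mulVf ?pnatr_eq0 -?lt0n// powRr1; lra.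
Unshelve. all: by end_near. Qed.
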